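(* Let $X$ be an open set in $\mathbb{R}^n$ and assume that $0\leq q < p \leq \infty$. Suppose that $T: C^p(X,E) \to C^q(Y,F)$ is a compact, separating, nowhere trivial linear operator with support map $h$. Then there exist $\ell\in \mathbb{N}_p$ and functions $\Phi_k: Y\times \mathcal{S}^k(\mathbb{R}^n,E) \to F$, $0 \leq k \leq \ell$, so that $T$ has the representation $$Tf(y) = \sum^{\ell}_{k=0}\Phi_k(y, D^kf(h(y)))$$ for all $f\in C^p(X,E)$ and all $y \in Y$. For a given $y$, $\Phi_k(y,\cdot)$ is a bounded linear operator from $\mathcal{S}^k(\mathbb{R}^n,E)$ into $F$. The set $h(Y)$ is relatively compact in $X$. There exists a dense open set $U$ in $Y$ so that $h$ is $C^q$ on $U$. For each $S \in \mathcal{S}^k(\mathbb{R}^n,E)$, $\Phi_k(y,S)$ belongs to $C^q(U,F)$ as a function of $y \in U$. Moreover, for any $k \leq \ell$, (a) for any $y \in U$ and $m \in \mathbb{N}_q$, the map $D_y^m\Phi_k(y,\cdot): \mathcal{S}^k(\mathbb{R}^n,E) \to \mathcal{S}^m(H,F)$ is a compact operator; (b) for each $m \in \mathbb{N}_q$, the map $y\mapsto D_y^m\Phi_k(y,\cdot)$ from $U$ into the space of bounded linear operators $L(\mathcal{S}^k(\mathbb{R}^n,E), \mathcal{S}^m(H,F))$ is continuous with respect to the operator norm topology.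
   Context: $H,E,F$ are real Banach spaces, $G=\mathbb{R}^n$, and $Y\subseteq H$ is open. $\mathbb{N}_p=\{i\in\mathbb{N}\cup\{0\}: i\le p\}$ (all nonnegative integers if $p=\infty$). $\mathcal{S}^k(G,E)$ is the Banach space of bounded symmetric $k$-linear maps $G^k\to E$, with $\mathcal{S}^0(G,E)=E$. $C^p(X,E)$ is the space of all $f:X\to E$ such that for all $k\in\mathbb{N}_p$ the Fréchet derivative $D^kf$ ($D^0f=f$) is a continuous function from $X$ to $\mathcal{S}^k(G,E)$; $C^p(X)=C^p(X,\mathbb{R})$. $C^p(X,E)$ carries the topology generated by the seminorms $\rho_{K,k}(f)=\sup_{x\in K}\sup_{0\le j\le k}\|D^jf(x)\|$, $K\subseteq X$ compact, $k\in\mathbb{N}_p$; similarly for $C^q(Y,F)$. $D_y^m\Phi_k(y,\cdot)$ denotes the map sending $S$ to the $m$-th derivative, at $y$, of the function $y\mapsto\Phi_k(y,S)$. A linear map between topological vector spaces is compact if it maps some (nonempty) open set onto a relatively compact set. Two functions are disjoint if at every point at least one of them is $0$. A map $T$ is separating if it maps disjoint functions to disjoint functions. $T$ is nowhere trivial if for every $y\in Y$ there is $f\in C^p(X,E)$ with $Tf(y)\ne0$. Support map: let $\mathbb{R}_\infty$ be the one-point compactification of $\mathbb{R}$, $i:X\to\mathbb{R}_\infty^{C^p(X)}$, $i(x)(\psi)=\psi(x)$ (a homeomorphic embedding), and let $\mathcal{A}X$ be the closure of $i(X)$. For $f\in C^p(X,E)$ let $\overline{C}(f)$ be the closure in $\mathcal{A}X$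 of $i(\{x:f(x)\ne0\})$. For $y\in Y$ let $\mathcal{O}_y$ be the family of open subsets $U$ of $\mathcal{A}X$ for which there is $f\in C^p(X,E)$ with $Tf(y)\ne0$ and $\overline{C}(f)\subseteq U$. Then $h(y)$ is the unique point of $\bigcap\{\overline{U}^{\mathcal{A}X}:U\in\mathcal{O}_y\}$; for $T$ continuous, separating and nowhere trivial, $h(y)\in i(X)$, and $i(X)$ is identified with $X$, so that $h:Y\to X$ (a continuous map). *)

(* Defs.v *)
From HB Require Import structures.
From mathcomp Require Import all_boot all_order all_algebra all_fingroup.
From mathcomp Require Import all_classical all_reals all_analysis.

Set Implicit Arguments.
Unset Strict Implicit.
Unset Printing Implicit Defensive.

Import Order.TTheory GRing.Theory Num.Theory.
Import numFieldNormedType.Exports.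

Local Open Scope classical_set_scope.
Local Open Scope ring_scope.

(* Smoothness orders live in [option nat], with [None] standing for infinity. *)
Definition inN (p : option nat) (k : nat) : bool :=
  if p is Some p' then (k <= p')%N else true.

Definition ltinf (q : nat) (p : option nat) : bool :=
  if p is Some p' then (q < p')%N else true.

Section SymmetricForms.
Context (R : realType) (k : nat) (V W : normedModType R).
Implicit Types (M : ('I_k -> V) -> W) (v : 'I_k -> V).

Definition multilinear M : Prop := forall (i : 'I_k) v (a : R) (x y : V),
  M (dfwith v i (a *: x + y)) = a *: M (dfwith v i x) + M (dfwith v i y).

Definition symmetric_map M : Prop :=
  forall (s : {perm 'I_k}) v, M (v \o s) = M v.

Definition bounded_map M : Prop :=
  exists C : R, forall v, `|M v| <= C * \prod_(i < k) `|v i|.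

Definition sympred : {pred (('I_k -> V) -> W)} :=
  mem [set M | [/\ multilinear M, symmetric_map M & bounded_map M]].

Record symform := SymForm {
  symform_val :> ('I_k -> V) -> W ;
  symform_valP : symform_val \in sympred }.

HB.instance Definition _ := [isSub for symform_val].
HB.instance Definition _ := [Choice of symform by <:].

Lemma sympred_submod_closed : submod_closed sympred.
Proof.
split.
  rewrite inE; split=> //; first by move=> i v a x y; rewrite scaler0 addr0.
  by exists 0 => v; rewrite mul0r normr0.
move=> a f g; rewrite !inE => -[fm fs [C fC]] [gm gs [D gD]].
have E v : (a *: f + g) v = a *: f v + g v by [].
split.
- move=> i v b x y; rewrite !E fm gm !scalerDr !scalerA [b * a]mulrC.
  by rewrite addrACA.
- by move=> s v; rewrite !E fs gs.
- exists (`|a| * C + D) => v; rewrite E.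
  rewrite (le_trans (ler_normD _ _))// normrZ mulrDl lerD//.
  by rewrite -mulrA ler_wpM2l.
Qed.

HB.instance Definition _ :=
  GRing.isSubmodClosed.Build _ _ sympred sympred_submod_closed.
HB.instance Definition _ := [SubChoice_isSubLmodule of symform by <:].

Implicit Types S : symform.

Lemma symformP S : [/\ multilinear S, symmetric_map S & bounded_map S].
Proof. by have := symform_valP S; rewrite inE. Qed.

Lemma symform_ext S S' : (forall v, S v = S' v) -> S = S'.
Proof. by move=> e; apply/val_inj/funext. Qed.

Lemma symform0E v : (0 : symform) v = 0. Proof. by []. Qed.

Lemma symformDE S S' v : (S + S') v = S v + S' v. Proof. by []. Qed.

Lemma symformZE (a : R) S v : (a *: S) v = a *: S v. Proof. by []. Qed.

Definition polyball : set ('I_k -> V) := [set v | forall i, `|v i| <= 1].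

Definition symnorm S : R := sup [set `|S v| | v in polyball].

Lemma symnorm_has_sup S : has_sup [set `|S v| | v in polyball].
Proof.
split.
  by exists `|S (cst 0)|; exists (cst 0) => // i; rewrite normr0.
have [_ _ [C SC]] := symformP S.
exists `|C| => _ [v vB <-].
rewrite (le_trans (SC v))// (le_trans (ler_norm _))// normrM.
rewrite ler_piMr//.
rewrite normr_prod.
have H : 0 <= \prod_(i < k) `| `|v i| | <= 1.
  elim/big_rec: _ => [|i x _ /andP[x0 x1]]; first by rewrite ler01 lexx.
  by rewrite normr_id mulr_ge0//= mulr_ile1.
by case/andP: H.
Qed.

Lemma symnorm_ub S v : polyball v -> `|S v| <= symnorm S.
Proof.
by move=> vB; apply: (sup_upper_bound (symnorm_has_sup S)); exists v.
Qed.

Lemma symnorm_le S (c : R) :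
  (forall v, polyball v -> `|S v| <= c) -> symnorm S <= c.
Proof.
move=> h; apply: ge_sup; first by case: (symnorm_has_sup S).
by move=> _ [v vB <-]; exact: h.
Qed.

Lemma symform_eq0 S v i : v i = 0 -> S v = 0.
Proof.
move=> vi0; have [Sm _ _] := symformP S.
have -> : v = dfwith v i 0 by apply/funext => j; case: dfwithP.
have := Sm i v (-1) 0 0; rewrite scaler0 addr0 => ->.
by rewrite scaleN1r addNr.
Qed.

Lemma symform_scale1 S v i (a : R) : S (dfwith v i (a *: v i)) = a *: S v.
Proof.
have [Sm _ _] := symformP S.
have := Sm i v a (v i) 0; rewrite addr0 => ->.
rewrite (@symform_eq0 S (dfwith v i 0) i) ?dfwithin// addr0.
by congr (_ *: S _); apply/funext => j; case: dfwithP.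
Qed.

Lemma symform_scale S v (a : 'I_k -> R) :
  S (fun i => a i *: v i) = (\prod_(i < k) a i) *: S v.
Proof.
have H (s : seq 'I_k) : uniq s ->
    S (fun i => if i \in s then a i *: v i else v i) =
    (\prod_(i <- s) a i) *: S v.
  elim: s => [_|i s IH /= /andP[si us]].
    by rewrite big_nil scale1r.
  rewrite big_cons -scalerA -IH// -(symform_scale1 _ _ i).
  congr (S _); apply/funext => j; rewrite (negbTE si).
  case: dfwithP => [|j' ij]; first by rewrite mem_head.
  by rewrite inE eq_sym (negbTE ij).
have := H (index_enum 'I_k) (index_enum_uniq _) => <-.
by congr (S _); apply/funext => i; rewrite mem_index_enum.
Qed.

Lemma symnorm_bound S v : `|S v| <= symnorm S * \prod_(i < k) `|v i|.
Proof.
have [[i vi0]|nz] := pselect (exists i, v i = 0).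
  by rewrite (symform_eq0 S vi0) normr0 (bigD1 i)//= vi0 normr0 mul0r mulr0.
have nz' i : v i != 0 by apply/eqP => vi0; apply: nz; exists i.
have {1}-> : v = (fun i => `|v i| *: (`|v i|^-1 *: v i)).
  by apply/funext => i; rewrite scalerA divff ?scale1r// normr_eq0.
rewrite symform_scale normrZ mulrC ger0_norm ?prodr_ge0//.
rewrite ler_wpM2r ?prodr_ge0// symnorm_ub// => i.
by rewrite normrZ normfV normr_id mulVf ?normr_eq0.
Qed.

Lemma symnormD S S' : symnorm (S + S') <= symnorm S + symnorm S'.
Proof.
apply: symnorm_le => v vB; rewrite symformDE (le_trans (ler_normD _ _))//.
by rewrite lerD// symnorm_ub.
Qed.

Lemma symnorm_ge0 S : 0 <= symnorm S.
Proof.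
by apply: (le_trans (normr_ge0 (S (cst 0)))); apply: symnorm_ub => i;
  rewrite normr0.
Qed.

Lemma symnormZ (a : R) S : symnorm (a *: S) = `|a| * symnorm S.
Proof.
have le (b : R) S' : symnorm (b *: S') <= `|b| * symnorm S'.
  apply: symnorm_le => v vB; rewrite symformZE normrZ.
  by rewrite ler_wpM2l// symnorm_ub.
apply/eqP; rewrite eq_le le/=.
have [->|a0] := eqVneq a 0; first by rewrite normr0 mul0r symnorm_ge0.
have := le a^-1 (a *: S); rewrite scalerA mulVf// scale1r normfV.
by rewrite ler_pdivlMl ?normr_gt0.
Qed.

Lemma symnorm0_eq0 S : symnorm S = 0 -> S = 0.
Proof.
move=> S0; apply: symform_ext => v; apply/eqP.
by rewrite symform0E -normr_eq0 eq_le normr_ge0 andbT -[leRHS](mul0r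
  (\prod_(i < k) `|v i|)) -S0 symnorm_bound.
Qed.

HB.instance Definition _ :=
  @Lmodule_isNormed.Build R symform symnorm symnormD symnormZ symnorm0_eq0.

End SymmetricForms.

(* The (k+1)-linear map associated with the differential at [x] of a map into
   k-linear maps; locked because failing conversions on ['d] may diverge. *)
HB.lock Definition diff_form (R : realType) (V W : normedModType R) (k : nat)
  (f : V -> symform k V W) (x : V) : ('I_k.+1 -> V) -> W :=
  fun v => 'd f x (v ord0) (v \o lift ord0).

Section IteratedDerivative.
Context (R : realType) (V W : normedModType R).

Lemma diff_formE k (f : V -> symform k V W) x v :
  diff_form f x v = 'd f x (v ord0) (v \o lift ord0).
Proof. by rewrite diff_form.unlock. Qed.

Lemma diff_form0 k (x : V) : diff_form (cst (0 : symform k V W)) x = 0.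
Proof.
apply/funext => v; rewrite diff_formE.
exact: (congr1 (fun A => (A (v ord0) : symform k V W) (v \o lift ord0))
  (diff_cst (0 : symform k V W) x)).
Qed.

Lemma cst_sympred (w : W) : (fun _ : 'I_0 -> V => w) \in @sympred R 0 V W.
Proof.
rewrite inE; split=> //; first by move=> -[].
by exists `|w| => v; rewrite big_ord0 mulr1.
Qed.

(* The identification of [W] with the space of symmetric 0-linear maps. *)
Definition symform0 (w : W) : symform 0 V W := SymForm (cst_sympred w).

(* [insubd] returns 0 when its argument is not a bounded symmetric multilinear
   map; this never happens for the functions in [is_C] below. *)
Fixpoint iterDiff (k : nat) (f : V -> W) : V -> symform k V W :=
  match k with
  | 0 => fun x => symform0 (f x)
  | k'.+1 => fun x => insubd 0 (diff_form (iterDiff k' f) x)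
  end.

(* [f] is of class C^p on the open set [X]; only the values of [f] on [X]
   matter. The membership in [sympred] is redundant (symmetry of second
   derivatives). *)
Definition is_C (p : option nat) (X : set V) (f : V -> W) : Prop :=
  (forall k, inN p k.+1 -> forall x, X x ->
     differentiable (iterDiff k f) x /\
     diff_form (iterDiff k f) x \in @sympred R k.+1 V W) /\
  (forall k, inN p k -> {within X, continuous (iterDiff k f)}).

Lemma inNW p k : inN p k.+1 -> inN p k.
Proof. by case: p => //= p /ltnW. Qed.

Lemma iterDiffS_val k f x :
  diff_form (iterDiff k f) x \in @sympred R k.+1 V W ->
  iterDiff k.+1 f x = diff_form (iterDiff k f) x :> (_ -> _).
Proof. by move=> s; exact: (insubdK (0 : symform k.+1 V W) s). Qed.

Lemma near_eq_diff (W' : normedModType R) (f g : V -> W') (x : V) :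
  (\forall y \near x, f y = g y) -> differentiable f x ->
  differentiable g x /\ 'd g x = 'd f x :> (V -> W').
Proof.
move=> fg /diff_locallyP[dfc dfe].
have fgx : f x = g x by exact: nbhs_singleton fg.
have E : g \o shift x = cst (g x) + 'd f x +o_ 0 id.
  apply/eqaddoP => e e0.
  move/eqaddoP : dfe => /(_ e e0) dfe.
  have fg0 : \forall y \near (0 : V), f (y + x) = g (y + x).
    rewrite (near_shift x); near do rewrite sub0r /= subrK.
    by [].
  near=> y.
  have <- : (f \o shift x - (cst (f x) + 'd f x)) y =
            (g \o shift x - (cst (g x) + 'd f x)) y.
    rewrite /GRing.add/= /GRing.opp/= /GRing.add/= fgx.
    by congr (_ - _); near: y.
  by near: y.
have dgf := diff_unique dfc E.
split; last exact: dgf.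
by apply/diff_locallyP; rewrite dgf; split; [exact: dfc|exact: E].
Unshelve. all: by end_near. Qed.

Lemma diff_form_lin k f g (a : R) x :
  differentiable (iterDiff k f) x -> differentiable (iterDiff k g) x ->
  'd (iterDiff k (a *: f + g)) x =
    'd (a *: iterDiff k f + iterDiff k g) x :> (V -> symform k V W) ->
  diff_form (iterDiff k (a *: f + g)) x =
  a *: diff_form (iterDiff k f) x + diff_form (iterDiff k g) x.
Proof.
move=> df dg dE; apply/funext => v.
have dD := etrans dE (diffD (differentiableZ a df) dg).
have e1 := congr1 (fun A => A (v ord0) : symform k V W) dD.
have e2 := congr1 (fun A => A (v ord0) : symform k V W) (diffZ a df).
have e3 := etrans e1 (congr1 (fun S => S + 'd (iterDiff k g) x (v ord0)) e2).
have e4 := congr1 (fun S : symform k V W => S (v \o lift ord0)) e3.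
rewrite diff_formE; apply: (etrans e4).
exact: (congr2 (fun A B => a *: A + B) (esym (diff_formE (iterDiff k f) x v))
  (esym (diff_formE (iterDiff k g) x v))).
Qed.

Lemma iterDiff_lin p X f g (a : R) k x : open X -> is_C p X f -> is_C p X g ->
  inN p k -> X x -> iterDiff k (a *: f + g) x = a *: iterDiff k f x + iterDiff k g x.
Proof.
move=> oX fC gC; elim: k x => [|k IH] x pk Xx; first exact: symform_ext.
have [df sf] := fC.1 _ pk _ Xx; have [dg sg] := gC.1 _ pk _ Xx.
have daf := differentiableZ a df.
have near_eq : \forall y \near x,
    (a *: iterDiff k f + iterDiff k g) y = iterDiff k (a *: f + g) y.
  near=> y; rewrite IH//; first exact: inNW.
  by near: y; exact: open_nbhs_nbhs.
have [_ dE] := near_eq_diff near_eq (differentiableD daf dg).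
have uE : diff_form (iterDiff k (a *: f + g)) x =
    a *: diff_form (iterDiff k f) x + diff_form (iterDiff k g) x.
  exact: diff_form_lin df dg dE.
have sfg : diff_form (iterDiff k (a *: f + g)) x \in @sympred R k.+1 V W.
  have := (sympred_submod_closed k.+1 V W).2 a _ _ sf sg.
  by move/(eq_ind_r (fun M => M \in @sympred R k.+1 V W)) => /(_ _ uE).
apply: val_inj; apply: (etrans (iterDiffS_val sfg)); apply: (etrans uE).
have ef := congr1 (fun M => a *: M) (esym (iterDiffS_val sf)).
exact: (congr2 +%R ef (esym (iterDiffS_val sg))).
Unshelve. all: by end_near. Qed.

Lemma is_C_lin p X f g (a : R) : open X -> is_C p X f -> is_C p X g ->
  is_C p X (a *: f + g).
Proof.
move=> oX fC gC.
have near_eq k x : inN p k -> X x -> \forall y \near x,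
    (a *: iterDiff k f + iterDiff k g) y = iterDiff k (a *: f + g) y.
  move=> pk Xx; near=> y; rewrite (@iterDiff_lin p X)//.
  by near: y; exact: open_nbhs_nbhs.
split=> k pk; last first.
  rewrite continuous_open_subspace// => x /[!inE] Xx.
  have := gC.2 k pk; rewrite continuous_open_subspace// => /(_ x (mem_set Xx)).
  have := fC.2 k pk; rewrite continuous_open_subspace// => /(_ x (mem_set Xx)).
  move=> cf cg.
  have cs : (a *: iterDiff k f + iterDiff k g) @ x --> iterDiff k (a *: f + g) x.
    rewrite (iterDiff_lin a oX fC gC pk Xx).
    exact: (cvgD (cvgZl_tmp (k := a) cf) cg).
  apply: cvg_trans cs; apply: near_eq_cvg.
  exact: near_eq k x pk Xx.
move=> x Xx.
have [df sf] := fC.1 _ pk _ Xx; have [dg sg] := gC.1 _ pk _ Xx.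
have daf := differentiableZ a df.
have [dfg dE] := near_eq_diff (near_eq k x (inNW pk) Xx) (differentiableD daf dg).
split; first exact: dfg.
have := (sympred_submod_closed k.+1 V W).2 a _ _ sf sg.
move/(eq_ind_r (fun M => M \in @sympred R k.+1 V W)).
by move=> /(_ _ (diff_form_lin df dg dE)).
Unshelve. all: by end_near. Qed.

Lemma iterDiff0 k x : iterDiff k (0 : V -> W) x = 0.
Proof.
elim: k x => [|k IH] x; first exact: symform_ext.
have E : iterDiff k (0 : V -> W) = cst 0 by apply/funext => y; exact: IH.
rewrite /= E diff_form0.
by apply/val_inj; rewrite val_insubd rpred0.
Qed.

Lemma is_C0 p X : is_C p X (0 : V -> W).
Proof.
have E k : iterDiff k (0 : V -> W) = cst 0 by apply/funext => y; exact: iterDiff0.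
split=> k pk; last by rewrite E; apply: continuous_subspaceT; exact: cst_continuous.
move=> x _; rewrite E; split; first exact: differentiable_cst.
by rewrite diff_form0 rpred0.
Qed.

End IteratedDerivative.

Section Cspace.
Context (R : realType) (V : normedModType R) (p : option nat).
Context (X : set V) (oX : open X) (W : normedModType R).

(* A function on [X] is encoded by its extension by 0. The proof argument
   makes the openness of [X] available to the instances below. *)
Definition Cpred_of (_ : open X) : {pred V -> W} :=
  mem [set f | is_C p X f /\ forall x, ~ X x -> f x = 0].
Local Notation Cpred := (Cpred_of oX).

Record Cspace := CSpace { Cfun :> V -> W ; CfunP : Cfun \in Cpred }.

HB.instance Definition _ := [isSub for Cfun].
HB.instance Definition _ := [Choice of Cspace by <:].

Lemma Cpred_submod_closed : submod_closed Cpred.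
Proof.
split; first by rewrite inE; split => //; exact: is_C0.
move=> a f g; rewrite !inE => -[fC f0] [gC g0]; split; first exact: is_C_lin.
move=> x nXx; rewrite [LHS](_ : _ = a *: f x + g x)// f0// g0//.
by rewrite scaler0 addr0.
Qed.

HB.instance Definition _ :=
  GRing.isSubmodClosed.Build _ _ Cpred Cpred_submod_closed.
HB.instance Definition _ := [SubChoice_isSubLmodule of Cspace by <:].
HB.instance Definition _ := isPointed.Build Cspace 0.

Definition Cseminorm (K : set V) (k : nat) (f : Cspace) : R :=
  sup [set sup [set `|iterDiff j f x| | j in `I_k.+1] | x in K].

Definition Cball_dom : set (Cspace * set V * nat * R) :=
  [set i | let: (f, K, k, e) := i in
     [/\ compact K, K `<=` X, inN p k & 0 < e]].

Definition Cball (i : Cspace * set V * nat * R) : set Cspace :=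
  let: (f, K, k, e) := i in [set g | Cseminorm K k (g - f) < e].

(* The topology generated by the seminorms: their open balls form a subbase. *)
HB.instance Definition _ := @isSubBaseTopological.Build Cspace
  (Cspace * set V * nat * R)%type Cball_dom Cball.

End Cspace.

Arguments Cspace {R V} p {X} oX W.

Definition disjoint_on (V : Type) (W : zmodType) (X : set V) (f g : V -> W) :=
  forall x, X x -> f x = 0 \/ g x = 0.

Definition compact_map (A B : topologicalType) (T : A -> B) : Prop :=
  exists U : set A, [/\ open U, U !=set0 & precompact (T @` U)].

Section Operators.
Context (R : realType) (V H E F : normedModType R) (p q : option nat).
Context (X : set V) (oX : open X) (Y : set H) (oY : open Y).
Implicit Types (T : Cspace p oX E -> Cspace q oY F) (h : H -> V).

Definition separating T : Prop :=
  forall f g : Cspace p oX E,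
    disjoint_on X f g -> disjoint_on Y (T f) (T g).

Definition nowhere_trivial T : Prop :=
  forall y, Y y -> exists f, T f y <> 0.

(* [Some] is the embedding of a space in its one-point compactification. *)
Definition support_emb (x : V) :
    prod_topology (fun _ : Cspace p oX R^o => one_point_compactification R^o) :=
  fun psi => Some (psi x).

Definition support_cpt : set (prod_topology
    (fun _ : Cspace p oX R^o => one_point_compactification R^o)) :=
  closure (support_emb @` X).

Definition csupport (f : Cspace p oX E) : set support_cpt :=
  closure (set_val @^-1` (support_emb @` [set x | X x /\ f x <> 0])).

Definition support_nbhs T (y : H) : set (set support_cpt) :=
  [set U | open U /\ exists f, T f y <> 0 /\ csupport f `<=` U].

(* [h y] is identified with its image [support_emb (h y)]. *)
Definition is_support_map T h : Prop := forall y, Y y ->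
  X (h y) /\
  \bigcap_(U in support_nbhs T y) closure U =
    [set z | set_val z = support_emb (h y)].

End Operators.

Section BoundedOperators.
Context (R : realType) (V W : normedModType R).

Definition bounded_linear (A : V -> W) : Prop :=
  linear A /\ exists C : R, forall v, `|A v| <= C * `|v|.

Definition opnorm (A : V -> W) : R :=
  sup [set `|A v| | v in [set v | `|v| <= 1]].

Definition norm_continuous_on (H : topologicalType) (U : set H)
    (A : H -> V -> W) : Prop :=
  (forall y, U y -> bounded_linear (A y)) /\
  forall y, U y -> opnorm (A z - A y) @[z --> within U (nbhs y)] --> (0 : R).

End BoundedOperators.

(* Main.v *)
Require Import Defs.
From HB Require Import structures.
From mathcomp Require Import finmap.
From mathcomp Require Import all_boot all_order all_algebra all_fingroup.
From mathcomp Require Import all_classical all_reals all_analysis.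
From mathcomp Require Import ring lra.

Set Implicit Arguments.
Unset Strict Implicit.
Unset Printing Implicit Defensive.

Import Order.TTheory GRing.Theory Num.Theory.
Import numFieldNormedType.Exports.

Local Open Scope classical_set_scope.
Local Open Scope ring_scope.

(** Compactness of [T] provides a compact set [K] of [X] and an order [l] such
    that [T] maps a ball of the seminorm of order [l] over [K] into a compact
    set; in particular [T f y] is dominated, for each [y], by that seminorm of
    [f] ([compact_operator_ball], [compact_operator_eval]). The support map
    says that [T f y] vanishes when [f] vanishes near [h y]: if [T f y] is
    nonzero, then [h y] lies in the closure of every neighbourhood of the
    support of [f], whereas a bump function at [h y] separates the two
    ([support_map_local], [vanish_near]). Continuity of [h] and the inclusion
    of [h Y] in [K] follow by multiplying functions by bumps.

    The representation rests on one estimate. If all derivatives of [f] of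
    order at most [l] vanish at [h y], then [T f y] does not change when [f] is
    multiplied by a bump of radius [r] at [h y], and the seminorm of the
    product tends to 0 with [r]: weighting the derivative of order [j] by
    [r ^+ j], the bump stays bounded while [f] is o([r ^+ l])
    ([small_jets], [vanish_jets]). Subtracting from [f] its Taylor polynomial
    at [h y] gives the formula, where [jet_coef y S] is the value at [y] of the
    image under [T] of the monomial [S (x - h y, ..., x - h y)], divided by k!.

    For the regularity of [h], fix a coordinate [j] and write [h_j y] for the
    [j]-th coordinate of [h y]. By the vanishing of jets,
    [T ((x_j - h_j y) ^+ l.+1 f) y = 0] for every [f]. Hence on every nonempty
    open set there is an exponent [a] for which [T ((x_j - h_j y) ^+ a f) y] is
    nonzero at some point, while it is identically zero for [a.+1]. Composing
    with a norming functional of [F], the number [h_j y] becomes a zero of a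
    polynomial in [t], the image of [(x_j - t) ^+ a.+1 f], whose coefficients
    are [C^q] functions of [y] and whose derivative at [h_j y] is nonzero; so
    [h_j] is [C^q] there ([is_C_implicit], [coord_regular_somewhere]). The set
    of points near which [h] is [C^q] is therefore dense.

    Expanding the monomials along the coordinates writes [jet_coef] as a finite
    sum of products of a [C^q] function of [y] (a polynomial in [h y]) and an
    image under [T] of a function depending linearly and boundedly on [S]. Such
    images of the unit ball lie in a compact subset of the space of [C^q]
    functions, a property stable under restriction, sums and products with
    [C^q] functions ([compact_family]). Compact sets of [C^q] functions have
    compact images under the evaluation of derivatives, and are totally bounded
    over a convergent sequence with its limit: these are the compactness and
    the norm continuity claimed for the coefficients.

    All of this needs a differential calculus of [is_C]. It is developed by
    induction on the order through [is_C_of_deriv] and [is_C_deriv]: [f] is of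
    class [C^(k+1)] if and only if it has a derivative of class [C^k]. The only
    analytic inputs are the mean value inequality and the symmetry of second
    derivatives ([schwarz]). *)

(** * Operators as symmetric 1-forms *)
Section Operator.
Context (R : realType).
Implicit Types U V W : normedModType R.

(** Operators are the elements of [symform 1 V W], so that the derivative of a
    function and its [iterDiff 1] live in the same normed space. *)
Definition app V W (A : symform 1 V W) (v : V) : W := A (fun=> v).

Arguments app : simpl never.

Lemma app_linear V W (A : symform 1 V W) : linear (app A).
Proof.
move=> a x y; rewrite /app.
have [Am _ _] := symformP A.
have E (z : V) : (fun=> z) = dfwith (fun=> z) (ord0 : 'I_1) z.
  by apply/funext => i; rewrite (ord1 i) dfwithin.
have E' (z t : V) : dfwith (fun=> z) (ord0 : 'I_1) t = fun=> t.
  by apply/funext => i; rewrite (ord1 i) dfwithin.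
by rewrite E Am !E'.
Qed.

HB.instance Definition _ V W (A : symform 1 V W) :=
  GRing.isLinear.Build R V W _ (app A) (app_linear A).

Lemma app_le V W (A : symform 1 V W) v : `|app A v| <= `|A| * `|v|.
Proof. by have := symnorm_bound A (fun=> v); rewrite big_ord1. Qed.

Lemma appDl V W (A B : symform 1 V W) v : app (A + B) v = app A v + app B v.
Proof. by []. Qed.

Lemma appZl V W a (A : symform 1 V W) v : app (a *: A) v = a *: app A v.
Proof. by []. Qed.

Lemma app0l V W v : app (0 : symform 1 V W) v = 0.
Proof. by []. Qed.

Lemma app_ext V W (A B : symform 1 V W) : app A =1 app B -> A = B.
Proof.
move=> AB; apply: symform_ext => v.
by have := AB (v ord0); rewrite /app;
  have -> : v = (fun=> v ord0) by apply/funext => i; rewrite (ord1 i).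
Qed.

Lemma symform_le k V W (S : symform k V W) v :
  `|S v| <= `|S| * \prod_(i < k) `|v i|.
Proof. exact: symnorm_bound. Qed.

Lemma symform_norm_le k V W (S : symform k V W) c : 0 <= c ->
  (forall v, `|S v| <= c * \prod_(i < k) `|v i|) -> `|S| <= c.
Proof.
move=> c0 Sc; apply: symnorm_le => v vB; apply: (le_trans (Sc v)).
rewrite ler_piMr//; elim/big_rec: _ => [//|i x _ x1].
by rewrite (le_trans (ler_wpM2l (normr_ge0 _) x1))// mulr1 vB.
Qed.

Lemma app_norm_le V W (A : symform 1 V W) c : 0 <= c ->
  (forall v, `|app A v| <= c * `|v|) -> `|A| <= c.
Proof.
move=> c0 Ac; apply: symform_norm_le => // v; rewrite big_ord1.
have -> : v = (fun=> v ord0) by apply/funext => i; rewrite (ord1 i).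
exact: Ac.
Qed.

(** The value 0 is taken when [g] is not linear and bounded. *)
Definition mkop V W (g : V -> W) : symform 1 V W :=
  insubd 0 (fun v : 'I_1 -> V => g (v ord0)).

Lemma mkopE V W (g : V -> W) : bounded_linear g -> app (mkop g) =1 g.
Proof.
move=> [gl [C gC]] v; rewrite /app /mkop insubdK// inE; split.
- by move=> i w a x y; rewrite (ord1 i) !dfwithin gl.
- by move=> s w /=; rewrite (ord1 (s ord0)).
- by exists C => w; rewrite big_ord1.
Qed.

Lemma mkop_norm_le V W (g : V -> W) c : linear g -> 0 <= c ->
  (forall v, `|g v| <= c * `|v|) -> `|mkop g| <= c.
Proof.
move=> gl c0 gc; apply: app_norm_le => // v; rewrite mkopE//.
by split=> //; exists c.
Qed.

Lemma bounded_linear_app V W (A : symform 1 V W) : bounded_linear (app A).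
Proof. by split; [exact: app_linear|exists `|A| => v; exact: app_le]. Qed.

Lemma bounded_linear_ge0 V W (g : V -> W) : bounded_linear g ->
  exists2 C, 0 <= C & forall v, `|g v| <= C * `|v|.
Proof.
move=> [_ [C gC]]; exists `|C|; first by [].
by move=> v; apply: (le_trans (gC v)); rewrite ler_wpM2r// ler_norm.
Qed.

Lemma lin0 V W (g : V -> W) : linear g -> g 0 = 0.
Proof.
by move=> gl; have := gl (-1) 0 0; rewrite scaler0 addr0 scaleN1r addNr.
Qed.

Lemma linZ V W (g : V -> W) a v : linear g -> g (a *: v) = a *: g v.
Proof. by move=> gl; have := gl a v 0; rewrite !addr0 (lin0 gl) addr0. Qed.

Lemma linD V W (g : V -> W) u v : linear g -> g (u + v) = g u + g v.
Proof. by move=> gl; have := gl 1 u v; rewrite !scale1r. Qed.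

Lemma linB V W (g : V -> W) u v : linear g -> g (u - v) = g u - g v.
Proof.
by move=> gl; rewrite linD// -scaleN1r linZ// scaleN1r.
Qed.

End Operator.

(** * Fréchet derivatives *)
Section Deriv.
Context (R : realType).
Implicit Types U V W : normedModType R.

Definition is_deriv V W (f : V -> W) (x : V) (A : symform 1 V W) : Prop :=
  forall e : R, 0 < e -> \forall y \near x,
    `|f y - f x - app A (y - x)| <= e * `|y - x|.

Lemma bounded_linear_cts V W (g : V -> W) :
  bounded_linear g -> continuous g.
Proof.
move=> gb x; have [C C0 gC] := bounded_linear_ge0 gb.
apply/cvgrPdist_le => e e0.
have d0 : 0 < e / (C + 1) by rewrite divr_gt0// ltr_wpDl.
near=> y; rewrite -linB; last by case: gb.
apply: (le_trans (gC _)).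
have : `|x - y| <= e / (C + 1).
  by near: y; move/cvgrPdist_le : (@cvg_id _ (nbhs x)) => /(_ _ d0).
rewrite ler_pdivlMr ?ltr_wpDl// mulrC; apply: le_trans.
by rewrite ler_wpM2r// lerDl.
Unshelve. all: by end_near. Qed.

Lemma is_deriv_diff V W (f : V -> W) x A : is_deriv f x A ->
  differentiable f x /\ 'd f x = app A :> (V -> W).
Proof.
move=> fA.
have Ac : continuous (app A) by exact: bounded_linear_cts (bounded_linear_app A).
have E : f \o shift x = cst (f x) + app A +o_ 0 id.
  apply/eqaddoP => e e0; have := fA e e0.
  rewrite (near_shift 0 x) => fAe; near=> y.
  have : `|f (y + x) - f x - app A (y + x - x)| <= e * `|y + x - x|.
    by near: y; rewrite /= subr0 in fAe; exact: fAe.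
  by rewrite addrK /= opprD addrA.
have dE := @diff_unique R _ _ f (app A) x Ac E.
split; last exact: dE.
by apply/diff_locallyP; rewrite dE; split; [exact: Ac|exact: E].
Unshelve. all: by end_near. Qed.

Lemma bounded_linear_diff V W (f : V -> W) x : differentiable f x ->
  bounded_linear ('d f x).
Proof.
move=> df; split; first exact: linearP.
have := diff_continuous df => /linear_bounded_continuous.
move=> /linear_boundedP [M [Mr HM]]; exists (`|M| + 1) => v.
by apply: HM; rewrite (le_lt_trans (ler_norm _))// ltrDl.
Qed.

Lemma diff_is_deriv V W (f : V -> W) x : differentiable f x ->
  is_deriv f x (mkop ('d f x)).
Proof.
move=> df e e0.
have /diff_locallyP[_ /eqaddoP/(_ e e0)] := df.
rewrite [X in _ -> X](near_shift 0 x) subr0 => fAe; near=> y.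
rewrite /= mkopE; last exact: bounded_linear_diff.
rewrite addrK -addrA -opprD.
by near: y; exact: fAe.
Unshelve. all: by end_near. Qed.

End Deriv.

(** * Differentiation rules *)
Section DerivRules.
Context (R : realType).
Implicit Types U V W : normedModType R.

Lemma is_deriv_of_diff V W (f : V -> W) x (A : symform 1 V W) :
  differentiable f x -> 'd f x =1 app A -> is_deriv f x A.
Proof.
move=> df dA; have := diff_is_deriv df; congr is_deriv.
by apply: app_ext => v; rewrite mkopE//; exact: bounded_linear_diff.
Qed.

Lemma is_deriv_uniq V W (f : V -> W) x A B :
  is_deriv f x A -> is_deriv f x B -> A = B.
Proof.
move=> /is_deriv_diff[_ fA] /is_deriv_diff[_ fB]; apply: app_ext => v.
by rewrite -fA fB.
Qed.

Lemma is_deriv_near V W (f g : V -> W) x A :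
  (\forall y \near x, f y = g y) -> is_deriv f x A -> is_deriv g x A.
Proof.
move=> fg fA e e0; have fgx : f x = g x by exact: nbhs_singleton fg.
near=> y; rewrite -fgx.
have <- : f y = g y by near: y.
by near: y; exact: fA.
Unshelve. all: by end_near. Qed.

Lemma is_deriv_lipschitz V W (f : V -> W) x A : is_deriv f x A ->
  \forall y \near x, `|f y - f x| <= (`|A| + 1) * `|y - x|.
Proof.
move=> fA; near=> y.
rewrite -[f y - f x](subrK (app A (y - x))) (le_trans (ler_normD _ _))//.
rewrite addrC mulrDl lerD ?app_le//.
by near: y; exact: fA.
Unshelve. all: by end_near. Qed.

Lemma near_dist_le V (x : V) (e : R) : 0 < e -> \forall y \near x, `|y - x| <= e.
Proof.
move=> e0; have /cvgrPdist_le/(_ e e0) := @cvg_id _ (nbhs x).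
by apply: filterS => y; rewrite distrC.
Qed.

Lemma is_deriv_continuous V W (f : V -> W) x A : is_deriv f x A ->
  {for x, continuous f}.
Proof.
move=> /is_deriv_lipschitz fA; apply/cvgrPdist_le => e e0; near=> y.
rewrite distrC; apply: (@le_trans _ _ ((`|A| + 1) * `|y - x|)).
  by near: y; exact: fA.
have A1 : 0 < `|A| + 1 by rewrite ltr_wpDl.
by rewrite mulrC -ler_pdivlMr//; near: y; apply: near_dist_le; exact: divr_gt0.
Unshelve. all: by end_near. Qed.

Lemma is_deriv_cst V W (w : W) (x : V) : is_deriv (cst w) x 0.
Proof.
move=> e e0; near=> y; rewrite /cst subrr app0l subr0 normr0.
by rewrite mulr_ge0// ltW.
Unshelve. all: by end_near. Qed.

Lemma is_deriv_lin V W (a : R) (f g : V -> W) x A B :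
  is_deriv f x A -> is_deriv g x B ->
  is_deriv (fun y => a *: f y + g y) x (a *: A + B).
Proof.
move=> fA gB e e0; near=> y.
have -> : a *: f y + g y - (a *: f x + g x) - app (a *: A + B) (y - x) =
    a *: (f y - f x - app A (y - x)) + (g y - g x - app B (y - x)).
  by rewrite appDl appZl !scalerBr !opprD !addrA; rewrite (ACl (1*3*5*2*4*6)).
have a1 : 0 < 2 * (`|a| + 1) by rewrite mulr_gt0// ltr_wpDl.
have : `|f y - f x - app A (y - x)| <= e / (2 * (`|a| + 1)) * `|y - x|.
  by near: y; apply: fA; exact: divr_gt0.
have : `|g y - g x - app B (y - x)| <= e / 2 * `|y - x|.
  by near: y; apply: gB; exact: divr_gt0.
move=> gy fy; apply: (le_trans (ler_normD _ _)).
rewrite normrZ [e in leRHS]splitr mulrDl lerD//.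
apply: (@le_trans _ _ ((`|a| + 1) * (e / (2 * (`|a| + 1)) * `|y - x|))).
  by rewrite ler_pM// lerDl.
have a2 : `|a| + 1 != 0 by rewrite gt_eqF// ltr_wpDl.
rewrite mulrA ler_wpM2r//.
by rewrite (_ : (`|a| + 1) * (e / (2 * (`|a| + 1))) = e / 2)//; field; exact: a2.
Unshelve. all: by end_near. Qed.

Lemma is_deriv_bounded_linear V W (L : V -> W) x : bounded_linear L ->
  is_deriv L x (mkop L).
Proof.
move=> Lb e e0; near=> y; rewrite mkopE// (linB _ _ Lb.1).
by rewrite subrr normr0 mulr_ge0// ltW.
Unshelve. all: by end_near. Qed.

Lemma bounded_linear_comp U V W (L : V -> W) (M : U -> V) :
  bounded_linear L -> bounded_linear M -> bounded_linear (L \o M).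
Proof.
move=> Lb Mb; have [C C0 LC] := bounded_linear_ge0 Lb.
have [D D0 MD] := bounded_linear_ge0 Mb; split.
  by move=> a u v /=; rewrite (Mb.1 _) (Lb.1 _).
exists (C * D) => v; apply: (le_trans (LC _)).
by rewrite -mulrA ler_wpM2l.
Qed.

Lemma is_deriv_comp U V W (g : V -> W) (f : U -> V) x B A :
  is_deriv g (f x) B -> is_deriv f x A ->
  is_deriv (g \o f) x (mkop (app B \o app A)).
Proof.
move=> /is_deriv_diff[dg gB] /is_deriv_diff[df fA].
apply: is_deriv_of_diff; first exact: differentiable_comp.
move=> v; rewrite mkopE.
  by rewrite diff_comp//= gB fA.
by apply: bounded_linear_comp; exact: bounded_linear_app.
Qed.

Lemma is_deriv_postcomp U V W (L : V -> W) (f : U -> V) x A :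
  bounded_linear L -> is_deriv f x A ->
  is_deriv (L \o f) x (mkop (L \o app A)).
Proof.
move=> Lb fA; have := is_deriv_comp (is_deriv_bounded_linear (f x) Lb) fA.
congr is_deriv; congr mkop; apply/funext => v /=.
by rewrite mkopE.
Qed.

End DerivRules.

(** With [a1 = B (f y) (g y)], [a2 = B (f x) (g x)], [a3 = B (f y) (g x)] and
    [a4 = B (f x) (g y)], this splits the remainder of the product rule into
    three terms, each of which is small. *)
Lemma bilinear_remainder (W : zmodType) (a1 a2 a3 a4 b1 b2 : W) :
  a1 - a2 - (b1 + b2) = (a3 - a2 - b1) + (a4 - a2 - b2) + (a1 - a3 - (a4 - a2)).
Proof.
rewrite (addrACA (a3 - a2)) -opprD [RHS]addrAC; congr (_ - _).
by rewrite -addrA (addrC (a4 - a2)) subrK addrC subrKA.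
Qed.

(** * Bounded bilinear maps *)
Section Bilinear.
Context (R : realType).
Implicit Types U V W : normedModType R.

Definition bilin W1 W2 W3 (C : R) (B : W1 -> W2 -> W3) : Prop :=
  [/\ 0 <= C, forall b, linear (B^~ b), forall a, linear (B a) &
      forall a b, `|B a b| <= C * `|a| * `|b|].

(** [bilin1] and [bilin2] are the two halves of the product rule. They are
    again bounded bilinear maps with the same constant, and this closure is
    what makes inductions on the order of differentiation possible. *)
Definition bilin1 V W1 W2 W3 (B : W1 -> W2 -> W3) (A : symform 1 V W1) (b : W2) :
  symform 1 V W3 := mkop (fun v => B (app A v) b).

Definition bilin2 V W1 W2 W3 (B : W1 -> W2 -> W3) (a : W1) (A : symform 1 V W2) :
  symform 1 V W3 := mkop (fun v => B a (app A v)).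

Lemma bilinC W1 W2 W3 C (B : W1 -> W2 -> W3) : bilin C B ->
  bilin C (fun b a => B a b).
Proof.
by move=> [C0 Bl Br BC]; split=> // a b; rewrite (le_trans (BC _ _))// mulrAC.
Qed.

Section One.
Context (V W1 W2 W3 : normedModType R) (C : R) (B : W1 -> W2 -> W3).
Hypothesis HB : bilin C B.

Lemma bilin1_bounded (A : symform 1 V W1) (b : W2) :
  bounded_linear (fun v => B (app A v) b).
Proof.
have [C0 Bl Br BC] := HB; split.
  by move=> a u v; rewrite (app_linear A a u v) (Bl b a).
exists (C * `|A| * `|b|) => v; apply: (le_trans (BC _ _)).
rewrite [leRHS](_ : _ = C * (`|A| * `|v|) * `|b|); last by ring.
by rewrite ler_wpM2r// ler_wpM2l// app_le.
Qed.

Lemma bilin1E A b v : app (bilin1 (V := V) B A b) v = B (app A v) b.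
Proof. by rewrite /bilin1 mkopE//; exact: bilin1_bounded. Qed.

Lemma bilin1P : bilin C (bilin1 (V := V) B).
Proof.
have [C0 Bl Br BC] := HB; split => //.
- by move=> b a A A'; apply: app_ext => v; rewrite appDl appZl !bilin1E (Bl b a).
- by move=> A a b b'; apply: app_ext => v; rewrite appDl appZl !bilin1E (Br _ a).
- move=> A b; apply: app_norm_le; first by rewrite !mulr_ge0.
  move=> v; rewrite bilin1E; apply: (le_trans (BC _ _)).
  rewrite [leRHS](_ : _ = C * (`|A| * `|v|) * `|b|); last by ring.
  by rewrite ler_wpM2r// ler_wpM2l// app_le.
Qed.

End One.

Lemma bilin2E V W1 W2 W3 C (B : W1 -> W2 -> W3) (a : W1) (A : symform 1 V W2) v :
  bilin C B -> app (bilin2 B a A) v = B a (app A v).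
Proof. by move=> /bilinC HB; exact: (bilin1E HB). Qed.

Lemma bilin2P V W1 W2 W3 C (B : W1 -> W2 -> W3) : bilin C B ->
  bilin C (@bilin2 V _ _ _ B).
Proof. by move=> /bilinC HB; exact: bilinC (bilin1P V HB). Qed.

Lemma is_deriv_bilin V W1 W2 W3 C (B : W1 -> W2 -> W3) (f : V -> W1) (g : V -> W2)
    x A A' : bilin C B -> is_deriv f x A -> is_deriv g x A' ->
  is_deriv (fun y => B (f y) (g y)) x (bilin1 B A (g x) + bilin2 B (f x) A').
Proof.
move=> HB fA gA' e e0; have [C0 Bl Br BC] := HB.
pose K := C * (`|g x| + `|f x| + (`|A| + 1)) + 1.
have K0 : 0 < K by rewrite ltr_wpDl// mulr_ge0// !addr_ge0.
have eK : 0 < e / K by rewrite divr_gt0.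
near=> y.
have -> : B (f y) (g y) - B (f x) (g x) -
    app (bilin1 B A (g x) + bilin2 B (f x) A') (y - x) =
    B (f y - f x - app A (y - x)) (g x) + B (f x) (g y - g x - app A' (y - x))
    + B (f y - f x) (g y - g x).
  rewrite appDl (bilin1E HB) (bilin2E _ _ _ HB).
  rewrite (linB _ _ (Bl _)) (linB _ _ (Bl _)) (linB _ _ (Br _)) (linB _ _ (Br _)).
  rewrite (linB _ _ (Bl _)) (linB _ _ (Br _)) (linB _ _ (Br _)).
  exact: bilinear_remainder.
have f1 : `|f y - f x - app A (y - x)| <= e / K * `|y - x| by near: y; exact: fA.
have g1 : `|g y - g x - app A' (y - x)| <= e / K * `|y - x| by near: y; exact: gA'.
have f2 : `|f y - f x| <= (`|A| + 1) * `|y - x|.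
  by near: y; exact: is_deriv_lipschitz.
have g2 : `|g y - g x| <= e / K.
  near: y; have /cvgrPdist_le/(_ _ eK) := is_deriv_continuous gA'.
  by apply: filterS => y; rewrite distrC.
rewrite (le_trans (ler_normD _ _))// (le_trans (lerD (ler_normD _ _) (lexx _)))//.
apply: (@le_trans _ _ (C * (e / K * `|y - x|) * `|g x| +
    C * `|f x| * (e / K * `|y - x|) + C * ((`|A| + 1) * `|y - x|) * (e / K))).
  apply: lerD; first apply: lerD.
  - by apply: (le_trans (BC _ _)); rewrite ler_wpM2r// ler_wpM2l.
  - by apply: (le_trans (BC _ _)); rewrite ler_wpM2l// mulr_ge0.
  - by apply: (le_trans (BC _ _)); rewrite ler_pM// ?mulr_ge0// ler_wpM2l.
rewrite [leLHS](_ : _ = (e / K * (K - 1)) * `|y - x|); last by rewrite /K; ring.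
rewrite ler_wpM2r// mulrBr mulr1 divfK ?gt_eqF//.
by rewrite gerBl ltW.
Unshelve. all: by end_near. Qed.


End Bilinear.

Lemma add_subl (W : zmodType) (x u : W) : x + u - x = u.
Proof. by rewrite addrC addKr. Qed.

(** * Mean value inequality and symmetry of second derivatives *)
Section MeanValue.
Context (R : realType).
Implicit Types U V W : normedModType R.

(** With a slope slightly larger than [M], the supremum of the times up to
    which the growth is controlled cannot be smaller than 1, because
    differentiability at that time extends the control beyond it. *)
Lemma mean_value_inequality V W (f : V -> W) (a v : V) (M : R) :
  (forall t : R, 0 <= t <= 1 ->
     exists2 A, is_deriv f (a + t *: v) A & `|app A v| <= M) ->
  `|f (a + v) - f a| <= M.
Proof.
move=> fM; apply/ler_addgt0Pr => e e0.
pose g t := f (a + t *: v).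
have glip t : 0 <= t <= 1 -> exists2 d, 0 < d &
    forall s, `|s - t| < d -> `|g s - g t| <= (M + e) * `|s - t|.
  move=> /fM[A fA AM].
  have v1 : 0 < `|v| + 1 by rewrite ltr_wpDl.
  have ev : 0 < e / (`|v| + 1) by rewrite divr_gt0.
  have /nbhs_ballP[r /= r0 fr] := fA _ ev.
  exists (r / (`|v| + 1)) => [|s st]; first by rewrite divr_gt0.
  have E : a + s *: v - (a + t *: v) = (s - t) *: v.
    by rewrite opprD addrACA subrr add0r scalerBl.
  have := fr (a + s *: v); rewrite -ball_normE /= distrC E normrZ.
  move=> /(_ _); have: `|s - t| * `|v| < r.
    move: st; rewrite ltr_pdivlMr//; apply: le_lt_trans.
    by rewrite ler_wpM2l// lerDl.
  move=> h1 /(_ h1) h2.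
  rewrite /g -[f _ - f _](subrK (app A ((s - t) *: v))).
  apply: (le_trans (ler_normD _ _)); rewrite linearZ normrZ mulrDl addrC lerD//.
    by rewrite mulrC ler_wpM2r.
  rewrite linearZ/= in h2; apply: (le_trans h2).
  rewrite mulrCA mulrC ler_wpM2r// mulrAC ler_pdivrMr// ler_wpM2l//.
    exact: ltW.
  by rewrite lerDl.
pose S := [set t : R | 0 <= t <= 1 /\ `|g t - g 0| <= (M + e) * t].
have S0 : S 0 by rewrite /S /= lexx ler01 subrr normr0 mulr0 lexx.
have supS : has_sup S by split; [exists 0|exists 1 => t [/andP[]]].
set c := sup S.
have c0 : 0 <= c by exact: (sup_upper_bound supS).
have c1 : c <= 1 by apply: ge_sup => [|t [/andP[]]//]; exists 0.
have c01 : 0 <= c <= 1 by rewrite c0 c1.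
have [d d0 gd] := glip _ c01.
have Sc : S c.
  have [t [t01 gt] ct] := sup_adherent d0 supS.
  have tc : t <= c by exact: (sup_upper_bound supS).
  split=> //; rewrite -(subrKA (g t)) (le_trans (ler_normD _ _))//.
  have tcd : `|t - c| < d.
    by rewrite distrC ger0_norm ?subr_ge0// ltrBlDr -ltrBlDl -/c.
  have := gd t tcd; rewrite distrC (distrC t c) (ger0_norm (_ : 0 <= c - t)) ?subr_ge0//.
  by move=> h; rewrite (le_trans (lerD h gt))// -mulrDr subrK.
have [c1'|c1'] := ltP c 1; last first.
  have cE : c = 1 by apply/le_anti/andP.
  by move: Sc => [_]; rewrite cE /g scale1r scale0r addr0 mulr1.
pose s := Num.min 1 (c + d / 2).
have cs : c < s by rewrite lt_min c1' ltrDl divr_gt0.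
have sc : `|s - c| < d.
  rewrite ger0_norm ?subr_ge0 ?ltW// ltrBlDl gt_min ltrD2l.
  by rewrite ltr_pdivrMr// ltr_pMr// ltr1n orbT.
suff /(sup_upper_bound supS) : S s by rewrite leNgt cs.
split; first by rewrite (le_trans c0 (ltW cs)) ge_min lexx.
rewrite -(subrKA (g c)) (le_trans (ler_normD _ _))//.
have := gd s sc; rewrite (ger0_norm (_ : 0 <= s - c)) ?subr_ge0 ?(ltW cs)//.
by move=> h; rewrite (le_trans (lerD h Sc.2))// -mulrDr subrK.
Qed.

Lemma is_deriv_shift V W (f : V -> W) (w x : V) A :
  is_deriv f (x + w) A -> is_deriv (fun z => f (z + w)) x A.
Proof.
move=> fA e e0; have := fA e e0.
rewrite (near_shift x) => fAe; near=> y.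
have : `|f (y + w) - f (x + w) - app A (y + w - (x + w))| <= e * `|y + w - (x + w)|.
  have <- : y + (x + w - x) = y + w by rewrite addrAC subrr add0r.
  by near: y; exact: fAe.
by rewrite opprD addrACA subrr addr0.
Unshelve. all: by end_near. Qed.

(** The second difference in directions [v] and [w] is the increment, in the
    direction [v], of [z |-> f (z + w) - f z]; the derivative of that function
    differs from [app D w] by the remainder of [f'] at [x]. *)
Lemma second_difference V W (f : V -> W) (f' : V -> symform 1 V W) x D (e : R) :
  0 < e ->
  (\forall y \near x, is_deriv f y (f' y)) -> is_deriv f' x D ->
  exists2 d, 0 < d & forall v w, `|v| <= d -> `|w| <= d ->
    `|f (x + v + w) - f (x + v) - (f (x + w) - f x) - app (app D w) v|
    <= 2 * e * (`|v| + `|w|) * `|v|.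
Proof.
move=> e0 ff' /(_ _ e0) f'D.
have /nbhs_ballP[r /= r0 fr] : nbhs x (fun y => is_deriv f y (f' y) /\ `|f' y - f' x - app D (y - x)| <= e * `|y - x|) by exact: filterI ff' f'D.
exists (r / 3) => [|v w vr wr]; first by rewrite divr_gt0.
pose F z := f (z + w) - f z - app (app D w) z.
have -> : f (x + v + w) - f (x + v) - (f (x + w) - f x) - app (app D w) v =
    F (x + v) - F x.
  rewrite /F (linD _ _ (app_linear _)).
  set p := f (x + v + w) - _; set q := f (x + w) - _.
  by rewrite [in RHS]opprB [in RHS]opprD !addrA
    [RHS](ACl (1*5*3*(2*4)))/= addNr addr0.
apply: mean_value_inequality => t /andP[t0 t1].
have tv : `|t *: v| <= `|v| by rewrite normrZ ger0_norm// ler_piMl.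
have b1 : `|x + t *: v - x| < r.
  by rewrite add_subl (le_lt_trans tv)// (le_lt_trans vr)// ltr_pdivrMr// ltr_pMr// ltr1n.
have b2 : `|x + t *: v + w - x| < r.
  rewrite -(addrA x) add_subl (le_lt_trans (ler_normD _ _))//.
  by rewrite (le_lt_trans (lerD (le_trans tv vr) wr))//; lra.
have := fr (x + t *: v); rewrite -ball_normE /= distrC => /(_ b1)[d1 e1].
have := fr (x + t *: v + w); rewrite -ball_normE /= distrC => /(_ b2)[d2 e2].
exists (f' (x + t *: v + w) - f' (x + t *: v) - app D w).
  have h1 := is_deriv_lin (-1) d1 (is_deriv_shift d2).
  have h2 := is_deriv_lin (-1) (is_deriv_bounded_linear (x + t *: v)
    (bounded_linear_app (app D w))) h1.
  move: h2; rewrite !scaleN1r (_ : mkop (app (app D w)) = app D w); last first.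
    by apply: app_ext => u; rewrite mkopE//; exact: bounded_linear_app.
  rewrite (addrC (- f' _)) (addrC (- app D w)).
  congr is_deriv; apply/funext => z; rewrite /F !scaleN1r addrC; congr (_ - _).
  by rewrite addrC.
apply: (le_trans (app_le _ _)); rewrite ler_wpM2r//.
set y1 := x + t *: v in d1 e1 d2 e2 b1 b2 *; set y2 := y1 + w in d2 e2 b2 *.
have -> : f' y2 - f' y1 - app D w = (f' y2 - f' x - app D (y2 - x)) -
     (f' y1 - f' x - app D (y1 - x)).
  have -> : y2 - x = w + (y1 - x) by rewrite [RHS]addrA [w + y1]addrC.
  rewrite (linD _ _ (app_linear _)) !opprD !opprK !addrA.
  by rewrite [RHS](ACl (1*5*3*(2*6)*(4*7)))/=; rewrite !addNr !addr0.
rewrite (le_trans (ler_normB _ _))// (le_trans (lerD e2 e1))// -mulrDr.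
have -> : 2 * e * (`|v| + `|w|) = e * ((`|v| + `|w|) + (`|v| + `|w|)) by ring.
rewrite ler_wpM2l ?(ltW e0)// lerD//.
  rewrite /y2 /y1 -(addrA x) add_subl (le_trans (ler_normD _ _))//.
  by rewrite lerD2r.
by rewrite /y1 add_subl (le_trans tv)// lerDl.
Qed.

(** The second difference is symmetric in its two directions, and it
    approximates both values of the second derivative up to
    o((|v| + |w|)^2); both are homogeneous of degree 2, hence equal. *)
Lemma schwarz V W (f : V -> W) (f' : V -> symform 1 V W) x D v w :
  (\forall y \near x, is_deriv f y (f' y)) -> is_deriv f' x D ->
  app (app D v) w = app (app D w) v.
Proof.
move=> ff' f'D; apply/eqP; rewrite -subr_eq0 -normr_le0.
apply/ler_addgt0Pr => e e0; rewrite add0r.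
set N := `|v| + `|w|.
have N1 : 0 < 2 * (N ^+ 2 + 1) by rewrite mulr_gt0// ltr_wpDl// sqr_ge0.
have [d d0 fd] := second_difference (divr_gt0 e0 N1) ff' f'D.
pose t := d / (N + 1).
have N2 : 0 < N + 1 by rewrite ltr_wpDl// addr_ge0.
have t0 : 0 < t by rewrite divr_gt0.
have small u : `|u| <= N -> `|t *: u| <= d.
  move=> uN; rewrite normrZ gtr0_norm// /t mulrAC ler_pdivrMr// ler_wpM2l//.
    exact: ltW.
  by rewrite (le_trans uN)// lerDl.
have vN : `|t *: v| <= d by apply: small; rewrite lerDl.
have wN : `|t *: w| <= d by apply: small; rewrite lerDr.
clearbody t.
have h1 := fd _ _ vN wN; have h2 := fd _ _ wN vN.
rewrite -(ler_pM2l (exprn_gt0 2 t0)).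
have E : t ^+ 2 * `|app (app D v) w - app (app D w) v| =
  `|app (app D (t *: v)) (t *: w) - app (app D (t *: w)) (t *: v)|.
  rewrite !(linZ _ _ (app_linear _)) !appZl !scalerA -expr2 -scalerBr normrZ.
  by rewrite (gtr0_norm (exprn_gt0 _ t0)).
rewrite E.
set a := app (app D (t *: v)) (t *: w) in h2 *; set b := app (app D (t *: w)) (t *: v) in h1 *.
set p := f (x + t *: v + t *: w) in h1.
set q1 := f (x + t *: v) in h1 h2; set q2 := f (x + t *: w) in h1 h2.
have -> : a - b = (p - q1 - (q2 - f x) - b) - (p - q2 - (q1 - f x) - a).
  have -> : p - q2 - (q1 - f x) = p - q1 - (q2 - f x).
    by rewrite !opprB !addrA [LHS](ACl (1*4*3*2)).
  by set P := p - q1 - _; rewrite opprB [RHS]addrC subrKA.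
have h2' : `|p - q2 - (q1 - f x) - a| <=
    2 * (e / (2 * (N ^+ 2 + 1))) * (`|t *: w| + `|t *: v|) * `|t *: w|.
  by move: h2; rewrite (addrAC x).
rewrite (le_trans (ler_normB _ _))// (le_trans (lerD h1 h2'))//.
rewrite !normrZ (gtr0_norm t0).
have -> : 2 * (e / (2 * (N ^+ 2 + 1))) = e / (N ^+ 2 + 1).
  by field; rewrite gt_eqF// ltr_wpDl// sqr_ge0.
rewrite [leLHS](_ : _ = t ^+ 2 * (e * (N ^+ 2 / (N ^+ 2 + 1)))); last first.
  by rewrite /N; ring.
rewrite ler_wpM2l ?sqr_ge0// ler_piMr ?ltW//.
by rewrite ltr_pdivrMr ?mul1r ?ltrDl// ltr_wpDl// sqr_ge0.
Qed.

End MeanValue.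

(** * Currying symmetric forms *)
Section Currying.
Context (R : realType).
Implicit Types V W : normedModType R.

Definition vcons (V : Type) k (w : V) (u : 'I_k -> V) : 'I_k.+1 -> V :=
  fun i => if unlift ord0 i is Some j then u j else w.

Lemma vcons0 (V : Type) k (w : V) (u : 'I_k -> V) : vcons w u ord0 = w.
Proof. by rewrite /vcons unlift_none. Qed.

Lemma vconsS (V : Type) k (w : V) (u : 'I_k -> V) i : vcons w u (lift ord0 i) = u i.
Proof. by rewrite /vcons liftK. Qed.

Lemma vcons_lift (V : Type) k (w : V) (u : 'I_k -> V) : vcons w u \o lift ord0 = u.
Proof. by apply/funext => i /=; rewrite vconsS. Qed.

Lemma vconsK (V : Type) k (v : 'I_k.+1 -> V) : vcons (v ord0) (v \o lift ord0) = v.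
Proof.
by apply/funext => i; case: (unliftP ord0 i) => [j ->|->]; rewrite ?vconsS ?vcons0.
Qed.

Lemma vcons_dfwith V k (w : V) (u : 'I_k -> V) i x :
  vcons w (dfwith u i x) = dfwith (vcons w u) (lift ord0 i) x.
Proof.
apply/funext => l; case: (unliftP ord0 l) => [j ->|->].
  rewrite vconsS; have [->|ij] := eqVneq i j; first by rewrite !dfwithin.
  by rewrite !dfwithout ?vconsS// (inj_eq lift_inj).
by rewrite vcons0 dfwithout ?vcons0// eq_sym neq_lift.
Qed.

Lemma dfwith_vcons V k (w a : V) (u : 'I_k -> V) :
  dfwith (vcons w u) ord0 a = vcons a u.
Proof.
apply/funext => l; case: (unliftP ord0 l) => [j ->|->].
  by rewrite dfwithout ?vconsS// neq_lift.
by rewrite dfwithin vcons0.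
Qed.

Lemma vcons_perm (V : Type) k (w : V) (u : 'I_k -> V) (s : {perm 'I_k}) :
  vcons w (u \o s) = vcons w u \o lift_perm ord0 ord0 s.
Proof.
apply/funext => l /=; case: (unliftP ord0 l) => [j ->|->].
  by rewrite lift_perm_lift !vconsS.
by rewrite lift_perm_id !vcons0.
Qed.

Lemma symform_vcons_le V W k (S : symform k.+1 V W) w u :
  `|S (vcons w u)| <= `|S| * `|w| * \prod_(i < k) `|u i|.
Proof.
have := symform_le S (vcons w u); rewrite big_ord_recl vcons0 mulrA.
by under eq_bigr => i _ do rewrite vconsS.
Qed.

Lemma symform_vcons_lin V W k (S : symform k.+1 V W) u :
  linear (fun w => S (vcons w u)).
Proof.
move=> a x y; have [Sm _ _] := symformP S.
by rewrite -(dfwith_vcons 0 (_ + _) u) Sm !dfwith_vcons.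
Qed.

Lemma symform_lin V W k (S S' : symform k V W) a v :
  (a *: S + S') v = a *: S v + S' v.
Proof. by []. Qed.

Fact contr_sympred V W k (S : symform k.+1 V W) (w : V) :
  (fun u => S (vcons w u)) \in @sympred R k V W.
Proof.
have [Sm Ss _] := symformP S; rewrite inE; split.
- by move=> i v a x y; rewrite !vcons_dfwith Sm.
- by move=> s v; rewrite vcons_perm Ss.
- by exists (`|S| * `|w|) => v; exact: symform_vcons_le.
Qed.

Definition contr V W k (S : symform k.+1 V W) (w : V) : symform k V W :=
  SymForm (contr_sympred S w).

Lemma contrE V W k (S : symform k.+1 V W) w u : contr S w u = S (vcons w u).
Proof. by []. Qed.

Lemma contr_le V W k (S : symform k.+1 V W) w : `|contr S w| <= `|S| * `|w|.
Proof.
apply: symform_norm_le => [|v]; first by rewrite mulr_ge0.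
exact: symform_vcons_le.
Qed.

Lemma contr_bounded V W k (S : symform k.+1 V W) : bounded_linear (contr S).
Proof.
split; last by exists `|S| => v; exact: contr_le.
by move=> a x y; apply: symform_ext => u; rewrite contrE symform_vcons_lin.
Qed.

(** [curh] splits the head variable off into the source of an operator, and
    [cur] splits it off into the target. [iterDiff k.+1 f x] read through
    [curh] is the derivative of [iterDiff k f] at [x]; read through [cur] it is
    the derivative of order [k] of the first derivative of [f]. *)
Definition curh V W k (S : symform k.+1 V W) : symform 1 V (symform k V W) :=
  mkop (contr S).

Lemma curhE V W k (S : symform k.+1 V W) w u : app (curh S) w u = S (vcons w u).
Proof. by rewrite /curh mkopE//; exact: contr_bounded. Qed.

Lemma curh_bounded V W k : bounded_linear (@curh V W k).
Proof.
split.
  move=> a S S'; apply: app_ext => w; apply: symform_ext => u.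
  by rewrite appDl appZl symform_lin !curhE.
exists 1 => S; rewrite mul1r; apply: mkop_norm_le => //.
  by case: (contr_bounded S).
by move=> w; exact: contr_le.
Qed.

Lemma vcons_bounded V W k (S : symform k.+1 V W) u :
  bounded_linear (fun w => S (vcons w u)).
Proof.
split; first exact: symform_vcons_lin.
exists (`|S| * \prod_(i < k) `|u i|) => w.
by rewrite mulrAC; exact: symform_vcons_le.
Qed.

Fact cur_sympred V W k (S : symform k.+1 V W) :
  (fun u => mkop (fun w => S (vcons w u))) \in @sympred R k V (symform 1 V W).
Proof.
have [Sm Ss _] := symformP S; rewrite inE; split.
- move=> i v a x y; apply: app_ext => w.
  rewrite appDl appZl !mkopE; try exact: vcons_bounded.
  by rewrite !vcons_dfwith Sm.
- move=> s v; apply: app_ext => w; rewrite !mkopE; try exact: vcons_bounded.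
  by rewrite vcons_perm Ss.
- exists `|S| => v; apply: mkop_norm_le.
  + exact: symform_vcons_lin.
  + by rewrite mulr_ge0// prodr_ge0.
  + by move=> w; rewrite mulrAC; exact: symform_vcons_le.
Qed.

Definition cur V W k (S : symform k.+1 V W) : symform k V (symform 1 V W) :=
  SymForm (cur_sympred S).

Lemma curE V W k (S : symform k.+1 V W) w u : app (cur S u) w = S (vcons w u).
Proof. by rewrite /cur /= mkopE//; exact: vcons_bounded. Qed.

Lemma cur_inj V W k : injective (@cur V W k).
Proof.
move=> S S' SS'; apply: symform_ext => v.
by rewrite -(vconsK v) -!curE SS'.
Qed.

Lemma norm_cur V W k (S : symform k.+1 V W) : `|cur S| = `|S|.
Proof.
apply/le_anti/andP; split.
  apply: symform_norm_le => // u; apply: app_norm_le.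
    by rewrite mulr_ge0// prodr_ge0.
  by move=> w; rewrite curE mulrAC; exact: symform_vcons_le.
apply: symform_norm_le => // v.
rewrite -{1}(vconsK v) -curE (le_trans (app_le _ _))//.
rewrite big_ord_recl (mulrC `|v ord0|) mulrA ler_wpM2r//.
exact: (symform_le (cur S) (v \o lift ord0)).
Qed.

Lemma cur_lin V W k : linear (@cur V W k).
Proof.
move=> a S S'; apply: symform_ext => u; apply: app_ext => w.
by rewrite symform_lin appDl appZl !curE.
Qed.

Lemma cur_bounded V W k : bounded_linear (@cur V W k).
Proof.
by split; [exact: cur_lin|exists 1 => S; rewrite mul1r norm_cur].
Qed.

(** Averaging over permutations makes the inverse of [cur] a total bounded
    linear map, although [cur] is not surjective: its values come from forms
    which are symmetric in all variables. *)
Definition sym_avg V W k (M : ('I_k -> V) -> W) (v : 'I_k -> V) : W :=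
  (#|{perm 'I_k}|%:R)^-1 *: \sum_(s : {perm 'I_k}) M (v \o s).

Lemma card_perm_gt0 k : (0 < #|{perm 'I_k}|)%N.
Proof. by apply/card_gt0P; exists 1%g. Qed.

Lemma norm_sym_avg_le V W k (M : ('I_k -> V) -> W) C v :
  (forall v, `|M v| <= C * \prod_(i < k) `|v i|) ->
  `|sym_avg M v| <= C * \prod_(i < k) `|v i|.
Proof.
move=> MC; rewrite normrZ ger0_norm ?invr_ge0//.
rewrite ler_pdivrMl ?ltr0n ?card_perm_gt0//.
apply: (le_trans (ler_norm_sum _ _ _)).
apply: (@le_trans _ _ (\sum_(s : {perm 'I_k}) C * \prod_(i < k) `|v i|)).
  apply: ler_sum => s _; rewrite (le_trans (MC _))//.
  by rewrite [X in _ <= _ * X](reindex_inj (@perm_inj _ s)).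
by rewrite sumr_const mulr_natl.
Qed.

Lemma sym_avg_sympred V W k (M : ('I_k -> V) -> W) :
  multilinear M -> bounded_map M -> sym_avg M \in @sympred R k V W.
Proof.
move=> Mm [C MC]; rewrite inE; split.
- move=> i v a x y.
  have E (s : {perm 'I_k}) z : dfwith v i z \o s = dfwith (v \o s) (s^-1%g i) z.
    apply/funext => j /=; have [->|ij] := eqVneq i (s j).
      by rewrite dfwithin permK dfwithin.
    by rewrite !dfwithout// -(inj_eq (@perm_inj _ s)) permKV.
  rewrite /sym_avg scalerA mulrC -scalerA -scalerDr.
  congr (_ *: _); rewrite scaler_sumr -big_split/=.
  by apply: eq_bigr => s _; rewrite !E Mm.
- move=> s v; rewrite /sym_avg; congr (_ *: _).
  rewrite [RHS](reindex_inj (mulIg s)); apply: eq_bigr => t _.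
  by congr M; apply/funext => i /=; rewrite permM.
- by exists C => v; exact: norm_sym_avg_le.
Qed.

Lemma sym_avg_id V W k (M : ('I_k -> V) -> W) :
  symmetric_map M -> sym_avg M = M.
Proof.
move=> Ms; apply/funext => v; rewrite /sym_avg.
under eq_bigr => s _ do rewrite Ms.
rewrite sumr_const -[M v *+ _]scaler_nat scalerA mulVf ?scale1r// pnatr_eq0.
by rewrite -lt0n card_perm_gt0.
Qed.

Definition uncur_map V W k (M : symform k V (symform 1 V W)) (v : 'I_k.+1 -> V) :=
  app (M (v \o lift ord0)) (v ord0).

Lemma uncur_map_le V W k (M : symform k V (symform 1 V W)) v :
  `|uncur_map M v| <= `|M| * \prod_(i < k.+1) `|v i|.
Proof.
rewrite (le_trans (app_le _ _))// big_ord_recl (mulrC `|v ord0|) mulrA ler_wpM2r//.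
exact: (symform_le M (v \o lift ord0)).
Qed.

Lemma lift_dfwith0 V k (v : 'I_k.+1 -> V) x : dfwith v ord0 x \o lift ord0 = v \o lift ord0.
Proof. by apply/funext => j /=; rewrite dfwithout// neq_lift. Qed.

Lemma lift_dfwithS V k (v : 'I_k.+1 -> V) i x :
  dfwith v (lift ord0 i) x \o lift ord0 = dfwith (v \o lift ord0) i x.
Proof.
apply/funext => j /=; have [->|ij] := eqVneq i j; first by rewrite !dfwithin.
by rewrite !dfwithout// (inj_eq lift_inj).
Qed.

Lemma uncur_map_multilinear V W k (M : symform k V (symform 1 V W)) :
  multilinear (uncur_map M).
Proof.
have [Mm _ _] := symformP M.
move=> i v a x y; rewrite /uncur_map; case: (unliftP ord0 i) => [j ->|->].
  rewrite !lift_dfwithS !dfwithout 1?eq_sym ?neq_lift// Mm.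
  by rewrite appDl appZl.
by rewrite !lift_dfwith0 !dfwithin app_linear.
Qed.

Fact uncur_sympred V W k (M : symform k V (symform 1 V W)) :
  sym_avg (uncur_map M) \in @sympred R k.+1 V W.
Proof.
apply: sym_avg_sympred; first exact: uncur_map_multilinear.
by exists `|M| => v; exact: uncur_map_le.
Qed.

Definition uncur V W k (M : symform k V (symform 1 V W)) : symform k.+1 V W :=
  SymForm (uncur_sympred M).

Lemma uncur_bounded V W k : bounded_linear (@uncur V W k).
Proof.
split.
  move=> a M M'; apply: symform_ext => v.
  rewrite symform_lin /uncur/= /sym_avg scalerA mulrC -scalerA -scalerDr.
  congr (_ *: _); rewrite scaler_sumr -big_split/=; apply: eq_bigr => s _.
  by rewrite /uncur_map symform_lin appDl appZl.
exists 1 => M; rewrite mul1r; apply: symform_norm_le => // v.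
by apply: norm_sym_avg_le => u; exact: uncur_map_le.
Qed.

Lemma curK V W k : cancel (@cur V W k) (@uncur V W k).
Proof.
move=> S; apply: symform_ext => v; rewrite /uncur/=.
have -> : uncur_map (cur S) = S :> (_ -> _).
  by apply/funext => u; rewrite /uncur_map curE vconsK.
by rewrite sym_avg_id//; case: (symformP S).
Qed.

(** Permutations fixing 0 together with the transposition of 0 and 1 generate
    all permutations: a transposition of 0 with another index is conjugate to
    that of 0 and 1. *)
Lemma symmetric_of_swap V W k (A : symform 1 V (symform k.+1 V W)) :
  (forall a b u, app A a (vcons b u) = app A b (vcons a u)) ->
  symmetric_map (fun v : 'I_k.+2 -> V => app A (v ord0) (v \o lift ord0)).
Proof.
move=> swap; set M := fun v => _.
pose inv (s : {perm 'I_k.+2}) := forall v, M (v \o s) = M v.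
have inv1 : inv 1%g by move=> v; congr M; apply/funext => i /=; rewrite perm1.
have invM s t : inv s -> inv t -> inv (s * t)%g.
  move=> si ti v; rewrite -[RHS]ti -[RHS]si; congr M.
  by apply/funext => i /=; rewrite permM.
have invV s : inv s -> inv s^-1%g.
  move=> si v; rewrite -[LHS]si; congr M.
  by apply/funext => i /=; rewrite permK.
have invL s : inv (lift_perm ord0 ord0 s).
  move=> v; rewrite /M /= lift_perm_id.
  have [_ Ss _] := symformP (app A (v ord0)).
  rewrite -[RHS](Ss s); congr (app A _ _).
  by apply/funext => i /=; rewrite lift_perm_lift.
pose o1 : 'I_k.+2 := lift ord0 ord0.
have inv01 : inv (tperm ord0 o1).
  move=> v; rewrite /M /= tpermL.
  rewrite -(vconsK (v \o lift ord0)) swap /=; congr (app A _ _).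
  apply/funext => i; case: (unliftP ord0 i) => [j ->|->].
    by rewrite vconsS /= tpermD// ?neq_lift// (inj_eq lift_inj) neq_lift.
  by rewrite vcons0 /= tpermR.
have inv0 j : inv (tperm ord0 (lift ord0 j)).
  have -> : tperm ord0 (lift ord0 j) =
      ((tperm ord0 o1) ^ (lift_perm ord0 ord0 (tperm ord0 j)))%g.
    by rewrite tpermJ lift_perm_id lift_perm_lift tpermL.
  by rewrite /conjg; apply: (invM _ _ (invV _ _) (invM _ _ _ _)).
have invT i j : inv (tperm i j).
  case: (unliftP ord0 i) => [i' ->|->]; case: (unliftP ord0 j) => [j' ->|->] //.
  - have -> : tperm (lift ord0 i') (lift ord0 j') =
        lift_perm ord0 ord0 (tperm i' j') :> {perm 'I_k.+2}.
      apply/permP => l; case: (unliftP ord0 l) => [l' ->|->].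
        by rewrite lift_perm_lift inj_tperm//; exact: lift_inj.
      by rewrite lift_perm_id tpermD// eq_sym neq_lift.
    exact: invL.
  - by rewrite tpermC.
  - by rewrite tperm1.
move=> s; have [ts -> _] := prod_tpermP s.
by apply: (big_ind inv) => // s' t; exact: invM.
Qed.

Lemma symform_swap V W k (S : symform k.+2 V W) a b u :
  S (vcons a (vcons b u)) = S (vcons b (vcons a u)).
Proof.
have [_ Ss _] := symformP S.
rewrite -(Ss (tperm ord0 (lift ord0 ord0))); congr (S _).
apply/funext => i /=; case: (unliftP ord0 i) => [j ->|->].
  case: (unliftP ord0 j) => [l ->|->].
    rewrite tpermD ?neq_lift// ?(inj_eq lift_inj) ?neq_lift//.
    by rewrite !vconsS.
  by rewrite tpermR vcons0 vconsS vcons0.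
by rewrite tpermL vcons0 vconsS vcons0.
Qed.

End Currying.

(** * Classes C^k by induction on k *)
Section SmoothnessByDerivative.
Context (R : realType) (V W : normedModType R).
Implicit Types (f : V -> W) (X : set V).

Lemma is_deriv_diff_form k (g : V -> symform k V W) x A : is_deriv g x A ->
  diff_form g x = fun v => app A (v ord0) (v \o lift ord0).
Proof. by move=> /is_deriv_diff[_ gA]; apply/funext => v; rewrite diff_formE gA. Qed.

Lemma head_multilinear k (A : symform 1 V (symform k V W)) :
  multilinear (fun v : 'I_k.+1 -> V => app A (v ord0) (v \o lift ord0)).
Proof.
move=> i v a x y; case: (unliftP ord0 i) => [j ->|->].
  rewrite !lift_dfwithS !dfwithout 1?eq_sym ?neq_lift//.
  by have [Am _ _] := symformP (app A (v ord0)); rewrite Am.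
by rewrite !lift_dfwith0 !dfwithin app_linear.
Qed.

Lemma head_bounded k (A : symform 1 V (symform k V W)) :
  bounded_map (fun v : 'I_k.+1 -> V => app A (v ord0) (v \o lift ord0)).
Proof.
exists `|A| => v; rewrite (le_trans (symform_le _ _))// big_ord_recl mulrA.
by apply: ler_wpM2r; [exact: prodr_ge0|exact: app_le].
Qed.

Lemma head_sympred k (A : symform 1 V (symform k.+1 V W)) :
  (forall a b u, app A a (vcons b u) = app A b (vcons a u)) ->
  (fun v : 'I_k.+2 -> V => app A (v ord0) (v \o lift ord0)) \in @sympred R _ V W.
Proof.
move=> swap; rewrite inE; split; [exact: head_multilinear| |exact: head_bounded].
exact: symmetric_of_swap.
Qed.

Lemma symform0_bounded : bounded_linear (@symform0 R V W).
Proof.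
split; first by move=> a x y; apply: symform_ext.
exists 1 => w; rewrite mul1r; apply: symform_norm_le => // v.
by rewrite big_ord0 mulr1.
Qed.

Lemma norm_symform0 (w : W) : `|symform0 V w| = `|w|.
Proof.
apply/le_anti/andP; split.
  by apply: symform_norm_le => // v; rewrite big_ord0 mulr1.
by have := symform_le (symform0 V w) (fun=> 0); rewrite big_ord0 mulr1.
Qed.

Lemma iterDiff_is_deriv k f x : differentiable (iterDiff k f) x ->
  diff_form (iterDiff k f) x \in @sympred R k.+1 V W ->
  is_deriv (iterDiff k f) x (curh (iterDiff k.+1 f x)).
Proof.
move=> df sf; have := diff_is_deriv df; congr is_deriv.
apply: app_ext => w; apply: symform_ext => u.
rewrite curhE iterDiffS_val// (is_deriv_diff_form (diff_is_deriv df)).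
by rewrite vcons0 vcons_lift.
Qed.

Lemma is_C_iterDiff_deriv p X f k x : is_C p X f -> inN p k.+1 -> X x ->
  is_deriv (iterDiff k f) x (curh (iterDiff k.+1 f x)).
Proof. by move=> fC pk Xx; have [] := fC.1 _ pk _ Xx; exact: iterDiff_is_deriv. Qed.

Lemma iterDiff_of_deriv k f x A : is_deriv (iterDiff k f) x A ->
  (fun v => app A (v ord0) (v \o lift ord0)) \in @sympred R k.+1 V W ->
  [/\ differentiable (iterDiff k f) x,
      diff_form (iterDiff k f) x \in @sympred R k.+1 V W &
      iterDiff k.+1 f x = (fun v => app A (v ord0) (v \o lift ord0)) :> (_ -> _)].
Proof.
move=> fA sA; have dE := is_deriv_diff_form fA.
have sf : diff_form (iterDiff k f) x \in @sympred R k.+1 V W by rewrite dE.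
split=> //; first by case: (is_deriv_diff fA).
exact: etrans (iterDiffS_val sf) dE.
Qed.

Lemma iterDiff1_of_deriv f x A : is_deriv f x A ->
  [/\ differentiable (iterDiff 0 f) x,
      diff_form (iterDiff 0 f) x \in @sympred R 1 V W & iterDiff 1 f x = A].
Proof.
move=> fA.
have f0 := is_deriv_postcomp symform0_bounded fA.
have E : (fun v : 'I_1 -> V => app (mkop (@symform0 R V W \o app A)) (v ord0)
    (v \o lift ord0)) = A :> (_ -> _).
  apply/funext => v; rewrite mkopE.
    by rewrite /= /app; congr (A _); apply/funext => i; rewrite (ord1 i).
  by apply: bounded_linear_comp;
    [exact: symform0_bounded|exact: bounded_linear_app].
have sA : (fun v : 'I_1 -> V => app (mkop (@symform0 R V W \o app A)) (v ord0)
    (v \o lift ord0)) \in @sympred R 1 V W by rewrite E; exact: symform_valP.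
have [d s iE] := iterDiff_of_deriv f0 sA.
by split=> //; apply: val_inj; exact: etrans iE E.
Qed.

Lemma deriv_of_differentiable0 f x : differentiable (iterDiff 0 f) x ->
  is_deriv f x (iterDiff 1 f x).
Proof.
move=> df.
pose ev (S : symform 0 V W) := S (fun=> 0).
have evb : bounded_linear ev.
  split; first by move=> a S S'.
  by exists 1 => S; have := symform_le S (fun=> 0); rewrite big_ord0 mulr1 mul1r.
have fA := is_deriv_postcomp evb (diff_is_deriv df).
have {}fA : is_deriv f x (mkop (ev \o app (mkop ('d (iterDiff 0 f) x)))) by [].
by have [_ _ ->] := iterDiff1_of_deriv fA.
Qed.

Lemma is_C_continuous p X f k x : open X -> is_C p X f -> inN p k -> X x ->
  {for x, continuous (iterDiff k f)}.
Proof.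
move=> oX fC pk Xx; have := fC.2 k pk; rewrite continuous_open_subspace//.
by apply; exact: mem_set.
Qed.

End SmoothnessByDerivative.

Section KeyLemmas.
Context (R : realType) (V W : normedModType R).

Lemma open_near (T : topologicalType) (X : set T) x (P : T -> Prop) : open X -> X x ->
  (forall y, X y -> P y) -> \forall y \near x, P y.
Proof.
move=> oX Xx XP; have : \forall y \near x, X y by exact: open_nbhs_nbhs.
by apply: filterS.
Qed.

Section Step.
Variables (X : set V) (f : V -> W) (f' : V -> symform 1 V W) (k : nat).
Hypothesis oX : open X.
Hypothesis ff' : forall x, X x -> is_deriv f x (f' x).
Hypothesis f'C : is_C (Some k) X f'.

(** Induction on [j]. Near [x] the form [iterDiff j.+1 f] is the image under
    [uncur] of [iterDiff j f'], hence differentiable. Its derivative is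
    symmetric in the tail variables by construction, and in the two head
    variables because it is a second derivative of [iterDiff j f]. *)
Lemma iterDiff_antiderivative j : (j <= k)%N -> forall x, X x ->
  [/\ differentiable (iterDiff j f) x,
      diff_form (iterDiff j f) x \in @sympred R j.+1 V W &
      cur (iterDiff j.+1 f x) = iterDiff j f' x].
Proof.
elim: j => [_|j IH jk] x Xx.
  have [df sf iE] := iterDiff1_of_deriv (ff' Xx).
  split=> //; rewrite iE; apply: symform_ext => u; apply: app_ext => w.
  rewrite curE /= /app; congr (f' x _).
  by apply/funext => i; rewrite (ord1 i) vcons0.
have {}IH y : X y -> _ := IH (ltnW jk) y.
have dL := is_C_iterDiff_deriv f'C jk Xx.
set L := curh _ in dL.
have uE y : X y -> iterDiff j.+1 f y = uncur (iterDiff j f' y).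
  by move=> Xy; have [_ _ <-] := IH _ Xy; rewrite curK.
pose A := mkop (@uncur R V W j \o app L).
have dA : is_deriv (iterDiff j.+1 f) x A.
  apply: is_deriv_near (is_deriv_postcomp (@uncur_bounded R V W j) dL).
  by apply: (open_near oX Xx) => y Xy; rewrite uE.
clearbody A.
have curA w : cur (app A w) = app L w.
  have dA' : is_deriv (iterDiff j f') x (mkop (@cur R V W j \o app A)).
    apply: is_deriv_near (is_deriv_postcomp (@cur_bounded R V W j) dA).
    by apply: (open_near oX Xx) => y Xy /=; have [_ _ ->] := IH _ Xy.
  rewrite -(is_deriv_uniq dA' dL) mkopE//.
  exact: (bounded_linear_comp (@cur_bounded R V W j) (bounded_linear_app A)).
have swap a b u : app A a (vcons b u) = app A b (vcons a u).
  have dH : is_deriv (fun y => curh (iterDiff j.+1 f y)) x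
      (mkop (@curh R V W j \o app A)).
    exact: is_deriv_postcomp (@curh_bounded R V W j) dA.
  have near : \forall y \near x, is_deriv (iterDiff j f) y (curh (iterDiff j.+1 f y)).
    apply: (open_near oX Xx) => y Xy; have [d s _] := IH _ Xy.
    exact: iterDiff_is_deriv.
  have := schwarz a b near dH.
  rewrite !(mkopE (bounded_linear_comp (@curh_bounded R V W j) (bounded_linear_app A))).
  by move=> /(congr1 (fun S : symform j V W => S u)); rewrite /= !curhE.
have [df sf iE] := iterDiff_of_deriv dA (head_sympred swap).
split=> //; apply: symform_ext => u; apply: app_ext => w.
rewrite curE iE vcons0 vcons_lift.
rewrite -(vconsK u) swap -curE curA.
by rewrite /L curhE.
Qed.

Lemma is_C_of_deriv : is_C (Some k.+1) X f.
Proof.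
split=> j jk.
  by move=> x Xx; have [] := iterDiff_antiderivative (jk : (j <= k)%N) Xx.
rewrite continuous_open_subspace// => x /[!inE] Xx.
case: j jk => [|j] jk.
  have : differentiable (iterDiff 0 f) x by case: (iterDiff_antiderivative (leq0n k) Xx).
  exact: differentiable_continuous.
have c : {for x, continuous (@uncur R V W j \o iterDiff j f')}.
  apply: continuous_comp; first exact: (is_C_continuous oX f'C jk Xx).
  exact: (bounded_linear_cts (@uncur_bounded R V W j) (x := _)).
have E y : X y -> (@uncur R V W j \o iterDiff j f') y = iterDiff j.+1 f y.
  by move=> Xy /=; have [_ _ <-] := iterDiff_antiderivative (jk : (j <= k)%N) Xy; rewrite curK.
rewrite /continuous_at -E//; apply: cvg_trans c; apply: near_eq_cvg.
exact: (open_near oX Xx).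
Qed.

Lemma norm_iterDiffS j x : (j <= k)%N -> X x ->
  `|iterDiff j.+1 f x| = `|iterDiff j f' x|.
Proof. by move=> jk Xx; have [_ _ <-] := iterDiff_antiderivative jk Xx; rewrite norm_cur. Qed.

End Step.

(** Converse of [is_C_of_deriv]: the derivatives of [iterDiff 1 f] are the
    curried derivatives of [f]. The base case is stated apart, as
    [iterDiff 0] of an operator-valued function does not reduce to [cur]. *)
Lemma is_C_deriv (X : set V) (f : V -> W) k : open X -> is_C (Some k.+1) X f ->
  (forall x, X x -> is_deriv f x (iterDiff 1 f x)) /\
  is_C (Some k) X (iterDiff 1 f).
Proof.
move=> oX fC; split.
  by move=> x Xx; apply: deriv_of_differentiable0; have [] := fC.1 0 isT x Xx.
have E j : (j <= k)%N -> forall x, X x ->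
    iterDiff j (iterDiff 1 f) x = cur (iterDiff j.+1 f x) /\
    ((j < k)%N -> [/\ differentiable (iterDiff j (iterDiff 1 f)) x,
      diff_form (iterDiff j (iterDiff 1 f)) x \in @sympred R j.+1 V (symform 1 V W) &
      iterDiff j.+1 (iterDiff 1 f) x = cur (iterDiff j.+2 f x)]).
  elim: j => [|j IH] jk x Xx; last first.
    have [_ /(_ jk)[_ _ e]] := IH (ltnW jk) x Xx.
    split; first exact: e.
    move=> jk'; have d2 := is_C_iterDiff_deriv fC (jk' : inN (Some k.+1) j.+3) Xx.
    have d3 := is_deriv_postcomp (@cur_bounded R V W j.+1) d2.
    have {}d3 : is_deriv (iterDiff j.+1 (iterDiff 1 f)) x
        (mkop (@cur R V W j.+1 \o app (curh (iterDiff j.+3 f x)))).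
      apply: is_deriv_near d3; apply: (open_near oX Xx) => y Xy.
      by have [_ /(_ jk)[_ _ ->]] := IH (ltnW jk) y Xy.
    set A := mkop _ in d3.
    have AE : (fun v : 'I_j.+2 -> V => app A (v ord0) (v \o lift ord0)) =
        cur (iterDiff j.+3 f x) :> (_ -> _).
      apply/funext => v; apply: app_ext => w.
      rewrite /A mkopE; last first.
        exact: (bounded_linear_comp (@cur_bounded R V W j.+1) (bounded_linear_app _)).
      by rewrite /comp !curE curhE symform_swap vconsK.
    have sA : (fun v : 'I_j.+2 -> V => app A (v ord0) (v \o lift ord0)) \in
        @sympred R j.+2 V (symform 1 V W) by rewrite AE; exact: symform_valP.
    have [d s iE] := iterDiff_of_deriv d3 sA.
    by split=> //; apply: val_inj; exact: etrans iE AE.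
  have cur0 y : X y -> iterDiff 0 (iterDiff 1 f) y = cur (iterDiff 1 f y).
    move=> Xy; apply: symform_ext => u; apply: app_ext => w.
    rewrite curE /app; congr (iterDiff 1 f y _).
    by apply/funext => i; rewrite (ord1 i) vcons0.
  split; first exact: cur0.
  move=> jk'; have d2 := is_C_iterDiff_deriv fC (jk' : inN (Some k.+1) 2) Xx.
  have d3 := is_deriv_postcomp (@cur_bounded R V W 0) d2.
  have {}d3 : is_deriv (iterDiff 0 (iterDiff 1 f)) x
      (mkop (@cur R V W 0 \o app (curh (iterDiff 2 f x)))).
    by apply: is_deriv_near d3; apply: (open_near oX Xx) => y Xy; rewrite cur0.
  set A := mkop _ in d3.
  have AE : (fun v : 'I_1 -> V => app A (v ord0) (v \o lift ord0)) =
      cur (iterDiff 2 f x) :> (_ -> _).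
    apply/funext => v; apply: app_ext => w.
    rewrite /A mkopE; last first.
      exact: (bounded_linear_comp (@cur_bounded R V W 0) (bounded_linear_app _)).
    by rewrite /comp !curE curhE symform_swap vconsK.
  have sA : (fun v : 'I_1 -> V => app A (v ord0) (v \o lift ord0)) \in
      @sympred R 1 V (symform 1 V W) by rewrite AE; exact: symform_valP.
  have [d s iE] := iterDiff_of_deriv d3 sA.
  by split=> //; apply: val_inj; exact: etrans iE AE.
split=> j jk.
  move=> x Xx; have [_ /(_ jk)[d s _]] := E j (ltnW jk) x Xx.
  by split.
rewrite continuous_open_subspace// => x /[!inE] Xx.
have c : {for x, continuous (@cur R V W j \o iterDiff j.+1 f)}.
  apply: continuous_comp; first exact: (is_C_continuous oX fC (jk : inN (Some k.+1) j.+1) Xx).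
  exact: (bounded_linear_cts (@cur_bounded R V W j) (x := _)).
rewrite /continuous_at (E j jk x Xx).1; apply: cvg_trans c; apply: near_eq_cvg.
by apply: (open_near oX Xx) => y Xy; have [-> _] := E j jk y Xy.
Qed.

End KeyLemmas.

(** * Closure properties and jet estimates *)
Section SmoothBasics.
Context (R : realType).
Implicit Types V W : normedModType R.

Lemma is_C_le V W p q (X : set V) (f : V -> W) :
  (forall k, inN q k -> inN p k) -> is_C p X f -> is_C q X f.
Proof. by move=> qp [f1 f2]; split=> k qk; [exact/f1/qp|exact/f2/qp]. Qed.

Lemma is_C_of_finite_orders V W p (X : set V) (f : V -> W) :
  (forall k, inN p k -> is_C (Some k) X f) -> is_C p X f.
Proof.
move=> H; split=> k pk.
  by apply: (H _ pk).1 => /=.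
by apply: (H _ pk).2 => /=.
Qed.

Lemma is_C_order V W p (X : set V) (f : V -> W) k :
  is_C p X f -> inN p k -> is_C (Some k) X f.
Proof.
move=> fC pk; apply: is_C_le fC => j /= jk.
by case: p pk => //= p; exact: leq_trans.
Qed.

Lemma is_C_leS V W (X : set V) (f : V -> W) k :
  is_C (Some k.+1) X f -> is_C (Some k) X f.
Proof. by apply: is_C_le => j /= /leqW. Qed.

Lemma is_C_sub V W p (X X' : set V) (f : V -> W) : open X -> open X' -> X' `<=` X ->
  is_C p X f -> is_C p X' f.
Proof.
move=> oX oX' X'X fC; split=> k pk; first by move=> x /X'X; exact: fC.1.
rewrite continuous_open_subspace// => x /[!inE] /X'X Xx.
exact: (is_C_continuous oX fC pk Xx).
Qed.

Lemma is_C_local V W p (X : set V) (f : V -> W) : open X ->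
  (forall x, X x -> exists X', [/\ open X', X' x & is_C p X' f]) -> is_C p X f.
Proof.
move=> oX loc; split=> k pk.
  by move=> x /loc[X' [oX' X'x fC]]; exact: fC.1.
rewrite continuous_open_subspace// => x /[!inE] /loc[X' [oX' X'x fC]].
exact: (is_C_continuous oX' fC pk X'x).
Qed.

Lemma is_C0P V W (X : set V) (f : V -> W) : open X ->
  (is_C (Some 0) X f <-> forall x, X x -> {for x, continuous f}).
Proof.
move=> oX; split=> [fC x Xx|fc].
  have c0 := is_C_continuous oX fC (isT : inN (Some 0) 0) Xx.
  apply/cvgrPdist_le => e e0; have /cvgrPdist_le/(_ e e0) := c0.
  apply: filterS => y; have -> : iterDiff 0 f x - iterDiff 0 f y = symform0 V (f x - f y).
    exact: symform_ext.
  by rewrite norm_symform0.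
split=> // k; rewrite /inN leqn0 => /eqP ->.
rewrite continuous_open_subspace// => x /[!inE] Xx.
apply: continuous_comp; first exact: fc.
exact: (bounded_linear_cts (@symform0_bounded R V W) (x := _)).
Qed.

Lemma is_C_cont V W p (X : set V) (f : V -> W) x : open X -> is_C p X f -> X x ->
  {for x, continuous f}.
Proof.
by move=> oX fC; apply: (is_C0P f oX).1; apply: (is_C_order fC); case: (p).
Qed.

Lemma diff_form_congr V W k (f g : V -> symform k V W) x :
  'd f x = 'd g x :> (V -> symform k V W) -> diff_form f x = diff_form g x.
Proof.
move=> dE; apply/funext => v; apply: (etrans (diff_formE f x v)).
apply: (etrans _ (esym (diff_formE g x v))).
exact: (congr1 (fun A : V -> symform k V W => A (v ord0) (v \o lift ord0)) dE).
Qed.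

Lemma iterDiff_eq V W p (X : set V) (f g : V -> W) k x : open X ->
  is_C p X f -> (forall y, X y -> f y = g y) -> inN p k -> X x ->
  iterDiff k f x = iterDiff k g x.
Proof.
move=> oX fC fg; elim: k x => [|k IH] x pk Xx.
  by apply: symform_ext => v /=; exact: fg.
have near : \forall y \near x, iterDiff k f y = iterDiff k g y.
  by apply: (open_near oX Xx) => y; apply: IH; exact: inNW.
have [df _] := fC.1 _ pk _ Xx.
have [_ dE] := near_eq_diff near df.
congr insubd; exact: diff_form_congr (esym dE).
Qed.

Lemma is_C_eq V W p (X : set V) (f g : V -> W) : open X ->
  (forall y, X y -> f y = g y) -> is_C p X f -> is_C p X g.
Proof.
move=> oX fg fC; split=> k pk.
  move=> x Xx; have [df sf] := fC.1 _ pk _ Xx.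
  have near : \forall y \near x, iterDiff k f y = iterDiff k g y.
    by apply: (open_near oX Xx) => y; apply: (iterDiff_eq oX fC fg); exact: inNW.
  have [dg dE] := near_eq_diff near df.
  split; first exact: dg.
  by move: sf; rewrite (diff_form_congr dE).
rewrite continuous_open_subspace// => x /[!inE] Xx.
rewrite /continuous_at -(iterDiff_eq oX fC fg pk Xx).
apply: cvg_trans (is_C_continuous oX fC pk Xx); apply: near_eq_cvg.
by apply: (open_near oX Xx) => y; apply: (iterDiff_eq oX fC fg).
Qed.

Lemma is_C_succ V W (X : set V) (f : V -> W) k : open X -> is_C (Some k.+1) X f ->
  exists2 f', forall x, X x -> is_deriv f x (f' x) & is_C (Some k) X f'.
Proof. by move=> oX /(is_C_deriv oX)[d c]; exists (iterDiff 1 f). Qed.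

Lemma iterDiff_zero_near V W (X : set V) (f : V -> W) k x : open X ->
  (forall y, X y -> f y = 0) -> X x -> iterDiff k f x = 0.
Proof.
move=> oX f0 Xx.
rewrite -(@iterDiff_eq _ _ None X 0 f) ?iterDiff0//; first exact: is_C0.
by move=> y /f0.
Qed.

(** The weight [e] rescales the space by the factor [e], so that one product
    estimate serves both at unit scale and at the scale of a small bump. *)
Definition jet_norm V W (e : R) k (f : V -> W) x : R :=
  \sum_(j < k.+1) e ^+ j * `|iterDiff j f x|.

Lemma jet_norm0 V W e (f : V -> W) x : jet_norm e 0 f x = `|f x|.
Proof. by rewrite /jet_norm big_ord1 expr0 mul1r; exact: norm_symform0. Qed.

Lemma jet_normS V W (X : set V) (f : V -> W) f' k e x : open X ->
  (forall x, X x -> is_deriv f x (f' x)) -> is_C (Some k) X f' -> X x ->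
  jet_norm e k.+1 f x = `|f x| + e * jet_norm e k f' x.
Proof.
move=> oX ff' f'C Xx; rewrite /jet_norm big_ord_recl expr0 mul1r.
congr (_ + _); first exact: norm_symform0.
rewrite mulr_sumr; apply: eq_bigr => j _.
rewrite exprS -mulrA -(norm_iterDiffS oX ff' f'C)//.
by rewrite -ltnS.
Qed.

Lemma jet_norm_ge0 V W e k (f : V -> W) x : 0 <= e -> 0 <= jet_norm e k f x.
Proof. by move=> e0; apply: sumr_ge0 => j _; rewrite mulr_ge0// exprn_ge0. Qed.

Lemma jet_norm_geS V W e k (f : V -> W) x : 0 <= e ->
  jet_norm e k f x <= jet_norm e k.+1 f x.
Proof.
by move=> e0; rewrite /jet_norm [leRHS]big_ord_recr/= lerDl mulr_ge0// exprn_ge0.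
Qed.

Lemma jet_norm_ge V W e k (f : V -> W) x : 0 <= e -> `|f x| <= jet_norm e k f x.
Proof.
move=> e0; elim: k => [|k IH]; first by rewrite jet_norm0.
by rewrite (le_trans IH)// jet_norm_geS.
Qed.

Lemma jet_norm_lin V W p (X : set V) (f g : V -> W) a e k x : open X -> 0 <= e ->
  is_C p X f -> is_C p X g -> inN p k -> X x ->
  jet_norm e k (a *: f + g) x <= `|a| * jet_norm e k f x + jet_norm e k g x.
Proof.
move=> oX e0 fC gC pk Xx; rewrite /jet_norm mulr_sumr -big_split/=.
apply: ler_sum => j _; rewrite (iterDiff_lin a oX fC gC)//; last first.
  have jk : (j <= k)%N by rewrite -ltnS.
  by case: p pk {fC gC} => //= p; exact: leq_trans.
rewrite mulrCA -mulrDr ler_wpM2l ?exprn_ge0//.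
by rewrite (le_trans (ler_normD _ _))// normrZ.
Qed.

Lemma jet_normD V W k (X : set V) (f g : V -> W) e x : open X -> 0 <= e ->
  is_C (Some k) X f -> is_C (Some k) X g -> X x ->
  jet_norm e k (f + g) x <= jet_norm e k f x + jet_norm e k g x.
Proof.
move=> oX e0 fC gC Xx; rewrite -[f]scale1r.
by rewrite (le_trans (jet_norm_lin 1 oX e0 fC gC (leqnn k : inN (Some k) k) Xx))// normr1 mul1r scale1r.
Qed.

Lemma is_CD V W p (X : set V) (f g : V -> W) : open X ->
  is_C p X f -> is_C p X g -> is_C p X (f + g).
Proof. by move=> oX fC gC; rewrite -[f]scale1r; exact: is_C_lin. Qed.

Lemma is_CZ V W p (X : set V) (f : V -> W) a : open X ->
  is_C p X f -> is_C p X (a *: f).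
Proof.
by move=> oX fC; rewrite -[_ *: f]addr0; apply: is_C_lin => //; exact: is_C0.
Qed.

Lemma is_C_sum V W p (X : set V) (I : Type) (r : seq I) (P : pred I) (f : I -> V -> W) :
  open X -> (forall i, P i -> is_C p X (f i)) -> is_C p X (\sum_(i <- r | P i) f i).
Proof.
move=> oX fC; elim/big_rec: _ => [|i g Pi gC]; first exact: is_C0.
by apply: is_CD => //; exact: fC.
Qed.

Lemma is_C_cst V W p (X : set V) (w : W) : open X -> is_C p X (cst w : V -> W).
Proof.
move=> oX; apply: is_C_of_finite_orders => k _.
elim: k W w => [|k IH] W w.
  by apply/is_C0P => // x _; exact: cst_continuous.
apply: (is_C_of_deriv oX (f' := cst 0)); last exact: IH.
by move=> x _; exact: is_deriv_cst.
Qed.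

Lemma jet_norm_cst V W e k (w : W) (x : V) : jet_norm e k (cst w) x = `|w|.
Proof.
case: k => [|k]; first by rewrite jet_norm0.
rewrite (@jet_normS _ _ setT _ (cst 0))//; first last.
- by apply: is_C_cst; exact: openT.
- by move=> y _; exact: is_deriv_cst.
- exact: openT.
rewrite (_ : jet_norm e k (cst 0) x = 0) ?mulr0 ?addr0//.
rewrite /jet_norm big1// => j _; rewrite (iterDiff_zero_near (X := setT)) ?normr0 ?mulr0//.
exact: openT.
Qed.

Lemma is_C_linear V W p (X : set V) (L : V -> W) : open X -> bounded_linear L ->
  is_C p X L.
Proof.
move=> oX Lb; apply: is_C_of_finite_orders => -[|k] _.
  by apply/is_C0P => // x _; exact: (bounded_linear_cts Lb (x := _)).
apply: (is_C_of_deriv oX (f' := cst (mkop L))); last exact: is_C_cst.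
by move=> x _; exact: is_deriv_bounded_linear.
Qed.

(** By induction on [k], for all target spaces at once: the derivative of
    [B f g] is the sum of [bilin1 B f' g] and [bilin2 B f g'], which are
    products of the same kind. The constant [3 ^+ k] leaves room for the value
    term and the two derivative terms at each step. *)
Lemma is_C_bilin V W1 W2 W3 C (B : W1 -> W2 -> W3) k (X : set V) f g : open X ->
  bilin C B -> is_C (Some k) X f -> is_C (Some k) X g ->
  is_C (Some k) X (fun x : V => B (f x) (g x)) /\
  forall e x, 0 <= e -> X x ->
    jet_norm e k (fun x => B (f x) (g x)) x <=
    3 ^+ k * C * jet_norm e k f x * jet_norm e k g x.
Proof.
move=> oX; elim: k W1 W2 W3 B f g => [|k IH] W1 W2 W3 B f g HB fC gC.
  have [C0 Bl Br BC] := HB.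
  split; last by move=> e x e0 Xx; rewrite !jet_norm0 expr0 mul1r.
  apply/is_C0P => // x Xx.
  have fc := is_C_cont oX fC Xx; have gc := is_C_cont oX gC Xx.
  apply/cvgrPdist_le => e e0.
  pose K := C * (1 + `|g x| + `|f x|) + 1.
  have K0 : 0 < K by rewrite ltr_wpDl// mulr_ge0// !addr_ge0.
  have eK : 0 < Num.min 1 (e / K) by rewrite lt_min ltr01 divr_gt0.
  near=> y; rewrite distrC.
  have fy : `|f y - f x| <= Num.min 1 (e / K).
    by near: y; have /cvgrPdist_le/(_ _ eK) := fc; apply: filterS => y; rewrite distrC.
  have gy : `|g y - g x| <= Num.min 1 (e / K).
    by near: y; have /cvgrPdist_le/(_ _ eK) := gc; apply: filterS => y; rewrite distrC.
  have -> : B (f y) (g y) - B (f x) (g x) =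
     B (f y - f x) (g y) + B (f x) (g y - g x).
    by rewrite (linB _ _ (Bl _)) (linB _ _ (Br _)) subrKA.
  rewrite (le_trans (ler_normD _ _))//.
  apply: (@le_trans _ _ (C * (e / K) * (1 + `|g x|) + C * `|f x| * (e / K))).
    move: fy gy; rewrite !le_min => /andP[_ fy] /andP[g1 gy].
    apply: lerD; apply: (le_trans (BC _ _)).
      apply: ler_pM; rewrite ?mulr_ge0//; first exact: ler_wpM2l.
      by rewrite -(subrK (g x) (g y)) (le_trans (ler_normD _ _))// lerD2r.
    by rewrite ler_wpM2l// mulr_ge0.
  rewrite [leLHS](_ : _ = (e / K) * (K - 1)); last by rewrite /K; ring.
  by rewrite mulrBr mulr1 divfK ?gt_eqF// gerBl ltW// divr_gt0.
have [f' ff' f'C] := is_C_succ oX fC; have [g' gg' g'C] := is_C_succ oX gC.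
have [c1 j1] := IH _ _ _ (bilin1 B) f' g (bilin1P V HB) f'C (is_C_leS gC).
have [c2 j2] := IH _ _ _ (bilin2 B) f g' (bilin2P V HB) (is_C_leS fC) g'C.
have D x : X x -> is_deriv (fun x => B (f x) (g x)) x
   (((fun x => bilin1 B (f' x) (g x)) + (fun x => bilin2 B (f x) (g' x))) x).
  by move=> Xx; exact: (is_deriv_bilin HB (ff' _ Xx) (gg' _ Xx)).
have DC := is_CD oX c1 c2.
split; first exact: (is_C_of_deriv oX D DC).
move=> e x e0 Xx; rewrite (jet_normS e oX D DC Xx).
have [C0 Bl Br BC] := HB.
have a0 := jet_norm_ge0 k f' x e0; have b0 := jet_norm_ge0 k g' x e0.
have gx := jet_norm_geS k g x e0; have fx := jet_norm_geS k f x e0.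
have s1 : jet_norm e k ((fun x => bilin1 B (f' x) (g x)) +
    (fun x => bilin2 B (f x) (g' x))) x <=
    3 ^+ k * C * jet_norm e k f' x * jet_norm e k.+1 g x +
    3 ^+ k * C * jet_norm e k.+1 f x * jet_norm e k g' x.
  rewrite (le_trans (jet_normD oX e0 c1 c2 Xx))// lerD//.
    by rewrite (le_trans (j1 e x e0 Xx))// ler_wpM2l// !mulr_ge0 ?exprn_ge0.
  by rewrite (le_trans (j2 e x e0 Xx))// ler_wpM2r// ler_wpM2l// mulr_ge0 ?exprn_ge0.
have fE := jet_normS e oX ff' f'C Xx; have gE := jet_normS e oX gg' g'C Xx.
set JF := jet_norm e k.+1 f x in s1 fE *; set JG := jet_norm e k.+1 g x in s1 gE *.
have f1 : `|f x| <= JF by rewrite fE lerDl mulr_ge0.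
have g1 : `|g x| <= JG by rewrite gE lerDl mulr_ge0.
have f2 : e * jet_norm e k f' x <= JF by rewrite fE lerDr.
have g2 : e * jet_norm e k g' x <= JG by rewrite gE lerDr.
have P1 : 1 <= 3 ^+ k :> R by rewrite exprn_ege1// ler1n.
have JF0 : 0 <= JF by exact: le_trans f1.
have JG0 : 0 <= JG by exact: le_trans g1.
have PC : 0 <= 3 ^+ k * C by rewrite mulr_ge0 ?exprn_ge0.
apply: (@le_trans _ _ (3 ^+ k * C * (JF * JG) + (3 ^+ k * C * (JF * JG) +
  3 ^+ k * C * (JF * JG)))); last by rewrite exprS; nra.
apply: lerD.
  apply: (le_trans (BC _ _)); rewrite -(mulrA C); apply: ler_pM => //.
  - by rewrite ler_peMl.
  - exact: ler_pM.
rewrite (le_trans (ler_wpM2l e0 s1))// mulrDr; apply: lerD.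
  rewrite [leLHS](_ : _ = 3 ^+ k * C * ((e * jet_norm e k f' x) * JG)); last by ring.
  by rewrite ler_wpM2l// ler_wpM2r.
rewrite [leLHS](_ : _ = 3 ^+ k * C * (JF * (e * jet_norm e k g' x))); last by ring.
by rewrite ler_wpM2l// ler_wpM2l.
Unshelve. all: by end_near. Qed.

Lemma bilin_scale V : bilin 1 (fun (a : R^o) (v : V) => a *: v).
Proof.
split=> //.
- by move=> v a x y; rewrite scalerDl scalerA.
- by move=> a b x y; rewrite scalerDr !scalerA mulrC.
- by move=> a v; rewrite normrZ mul1r.
Qed.

Lemma is_C_scale V W p (X : set V) (u : V -> R^o) (f : V -> W) : open X ->
  is_C p X u -> is_C p X f -> is_C p X (fun x => u x *: f x).
Proof.
move=> oX uC fC; apply: is_C_of_finite_orders => k pk.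
by have [] := is_C_bilin oX (bilin_scale W) (is_C_order uC pk) (is_C_order fC pk).
Qed.

Lemma jet_norm_scale V W p (X : set V) (u : V -> R^o) (f : V -> W) k e x : open X ->
  is_C p X u -> is_C p X f -> inN p k -> 0 <= e -> X x ->
  jet_norm e k (fun x => u x *: f x) x <= 3 ^+ k * jet_norm e k u x * jet_norm e k f x.
Proof.
move=> oX uC fC pk e0 Xx.
have [_ /(_ e x e0 Xx)] := is_C_bilin oX (bilin_scale W) (is_C_order uC pk) (is_C_order fC pk).
by rewrite mulr1.
Qed.

Lemma is_C_postcomp V W1 W2 p (X : set V) (L : W1 -> W2) (f : V -> W1) : open X ->
  bounded_linear L -> is_C p X f -> is_C p X (L \o f).
Proof.
move=> oX Lb fC; apply: is_C_of_finite_orders => k /(is_C_order fC) {fC}.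
elim: k W1 W2 L f Lb => [|k IH] W1 W2 L f Lb fC.
  apply/is_C0P => // x Xx; apply: continuous_comp; first exact: (is_C_cont oX fC Xx).
  exact: (bounded_linear_cts Lb (x := _)).
have [f' ff' f'C] := is_C_succ oX fC.
pose L' (A : symform 1 V W1) : symform 1 V W2 := mkop (L \o app A).
have LA A : app (L' A) =1 L \o app A.
  exact: mkopE (bounded_linear_comp Lb (bounded_linear_app A)).
have L'b : bounded_linear L'.
  have [C C0 LC] := bounded_linear_ge0 Lb; split.
    move=> a A B; apply: app_ext => v.
    by rewrite appDl appZl !LA; exact: (Lb.1 a (app A v) (app B v)).
  exists C => A; apply: app_norm_le; first by rewrite mulr_ge0.
  by move=> v; rewrite LA /= (le_trans (LC _))// -mulrA ler_wpM2l// app_le.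
apply: (is_C_of_deriv oX (f' := L' \o f')); last exact: IH.
by move=> x Xx; exact: (is_deriv_postcomp Lb (ff' _ Xx)).
Qed.

End SmoothBasics.

(** * Inverses, flat functions, homotheties *)
Section ScalarFunctions.
Context (R : realType).
Implicit Types V W : normedModType R.

(** At a zero of [w] the factor [r] need only be continuous. This yields the
    derivatives of inverses and of implicit functions, whose increments are
    products of such an [r] with a differentiable function. *)
Lemma is_deriv_mul_vanishing V W (r : V -> R^o) (w : V -> W) x A :
  {for x, continuous r} -> is_deriv w x A -> w x = 0 ->
  is_deriv (fun y => r y *: w y) x (r x *: A).
Proof.
move=> rc wA wx0 e e0.
pose K := (`|r x| + 1) + (`|A| + 1).
have K0 : 0 < K by apply: addr_gt0; rewrite ltr_wpDl.
have eK : 0 < Num.min 1 (e / K) by rewrite lt_min ltr01 divr_gt0.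
near=> y.
have ry : `|r y - r x| <= Num.min 1 (e / K).
  by near: y; have /cvgrPdist_le/(_ _ eK) := rc; apply: filterS => y; rewrite distrC.
have w1 : `|w y - app A (y - x)| <= e / K * `|y - x|.
  have : `|w y - w x - app A (y - x)| <= e / K * `|y - x|.
    by near: y; apply: wA; exact: divr_gt0.
  by rewrite wx0 subr0.
rewrite wx0 scaler0 subr0 appZl.
have -> : r y *: w y - r x *: app A (y - x) =
    r y *: (w y - app A (y - x)) + (r y - r x) *: app A (y - x).
  by rewrite scalerBr scalerBl subrKA.
rewrite (le_trans (ler_normD _ _))// !normrZ.
move: ry; rewrite le_min => /andP[r1 re].
have rB : `|r y| <= `|r x| + 1.
  by rewrite -[r y](subrK (r x)) (le_trans (ler_normD _ _))// addrC lerD2l.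
apply: (@le_trans _ _ ((`|r x| + 1) * (e / K * `|y - x|) +
    e / K * ((`|A| + 1) * `|y - x|))).
  apply: lerD; first exact: ler_pM.
  apply: ler_pM => //; rewrite (le_trans (app_le _ _))// ler_wpM2r//.
  by rewrite lerDl.
rewrite [leLHS](_ : _ = (e / K) * K * `|y - x|); last by rewrite /K; ring.
by rewrite divfK// gt_eqF.
Unshelve. all: by end_near. Qed.

Lemma is_deriv_inv V (u : V -> R^o) x A : u x != 0 -> is_deriv u x A ->
  is_deriv (fun y => (u y)^-1 : R^o) x (- ((u x)^-1 * (u x)^-1) *: A).
Proof.
move=> ux0 uA; have uc := is_deriv_continuous uA.
pose r y : R^o := - ((u y)^-1 * (u x)^-1).
have rc : {for x, continuous r}.
  by apply: cvgN; apply: cvgM; [exact: cvgV|exact: cvg_cst].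
have wA : is_deriv (fun y => u y - u x) x A.
  by move=> e e0; apply: filterS (uA e e0) => y; rewrite subrr subr0.
have := is_deriv_mul_vanishing rc wA (subrr _).
move=> /(is_deriv_lin 1)/(_ (is_deriv_cst ((u x)^-1 : R^o) x)).
rewrite scale1r addr0; apply: is_deriv_near.
have : \forall y \near x, u y != 0.
  by have /cvgr_neq0/(_ ux0) := uc.
apply: filterS => y uy0; rewrite scale1r /r /cst.
rewrite -[_ *: _]/(_ * _); field; exact/andP.
Qed.

Lemma is_C_inv V p (X : set V) (u : V -> R^o) : open X -> is_C p X u ->
  (forall x, X x -> u x != 0) -> is_C p X (fun x => (u x)^-1 : R^o).
Proof.
move=> oX uC u0; apply: is_C_of_finite_orders => k /(is_C_order uC) {}uC.
elim: k uC => [|k IH] uC.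
  apply/is_C0P => // x Xx; apply: cvgV; first exact: u0.
  exact: (is_C_cont oX uC Xx).
have [u' uu' u'C] := is_C_succ oX uC.
have vC := IH (is_C_leS uC).
apply: (is_C_of_deriv oX (f' := fun x => - ((u x)^-1 * (u x)^-1) *: u' x)).
  by move=> x Xx; apply: is_deriv_inv (uu' _ Xx); exact: u0.
apply: is_C_scale => //.
have := is_CZ (-1) oX (is_C_scale oX vC vC).
by apply: is_C_eq => // y Xy; rewrite -[LHS]/(-1 *: (_ *: _)) scaleN1r.
Qed.

(** The family [t^-m * exp(-1/t)], extended by 0, is stable under
    differentiation; a single such function would not allow an induction. *)
Definition flat m (t : R) : R^o :=
  if 0 < t then t^-1 ^+ m * expR (- t^-1) else 0.

(** From [exp x >= (x / (m+2)) ^+ (m+2)] at [x = 1/t]; a quadratic bound is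
    what differentiability at 0 requires. *)
Lemma flat_le m t : `|flat m t| <= (m.+2)%:R ^+ m.+2 * t ^+ 2.
Proof.
rewrite /flat; case: ifPn => t0; last by rewrite normr0 mulr_ge0 ?sqr_ge0 ?exprn_ge0.
rewrite ger0_norm; last by rewrite mulr_ge0 ?expR_ge0// exprn_ge0// invr_ge0 ltW.
have h : t^-1 ^+ m.+2 <= (m.+2)%:R ^+ m.+2 * expR (t^-1).
  rewrite -{2}[t^-1](@divfK _ (m.+2)%:R) ?pnatr_eq0// expRM_natr -exprMn.
  rewrite lerXn2r ?nnegrE ?mulr_ge0 ?expR_ge0 ?invr_ge0 ?(ltW t0)//.
  rewrite -ler_pdivrMl ?ltr0n// mulrC (le_trans _ (expR_ge1Dx _))//.
  by rewrite lerDr.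
rewrite expRN ler_pdivrMr ?expR_gt0//.
rewrite -(ler_pM2r (_ : 0 < t^-1 ^+ 2)) ?exprn_gt0 ?invr_gt0//.
rewrite -exprD addn2 (le_trans h)//.
rewrite le_eqVlt; apply/orP; left; apply/eqP.
move: (_ ^+ m.+2) (expR _) => N E; field; exact: lt0r_neq0.
Qed.

Lemma is_deriv_flat m (t : R^o) :
  is_deriv (flat m) t ((- (m%:R) * flat m.+1 t + flat m.+2 t) *: mkop (@id R^o)).
Proof.
have idb : bounded_linear (@id R^o).
  by split=> //; exists 1 => v; rewrite mul1r.
have [t0|t0] := ltP 0 t; last first.
  have z k : flat k t = 0 by rewrite /flat ltNge t0.
  rewrite !z mulr0 addr0 scale0r => e e0; rewrite z.
  have [tn|] := ltP t 0.
    near=> s; rewrite app0l !subr0 /flat ltNge.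
    have -> /= : s <= 0 by apply: ltW; near: s; exact: lt_nbhsl.
    by rewrite normr0 mulr_ge0// ltW.
  move=> t0'; have {t0 t0' z} -> : t = 0 by apply/le_anti/andP.
  have c0 : 0 < (m.+2)%:R ^+ m.+2 :> R by rewrite exprn_gt0// ltr0n.
  have ec := divr_gt0 e0 c0.
  near=> s; rewrite app0l !subr0 (le_trans (flat_le _ _))//.
  rewrite -[s ^+ 2]ger0_norm ?sqr_ge0// normrX expr2 mulrA ler_wpM2r//.
  suff : `|s - 0| <= e / (m.+2)%:R ^+ m.+2 by rewrite subr0 ler_pdivlMr// mulrC.
  by near: s; exact: (@near_dist_le R R^o 0 _ ec).
have tn0 : t != 0 by rewrite gt_eqF.
pose g (s : R) : R := s^-1 ^+ m * expR (- s^-1).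
have dg : is_derive (t : R) 1 g (- (m%:R) * flat m.+1 t + flat m.+2 t).
  have di : is_derive (t : R) 1 (fun s : R => s^-1) (- t ^- 2 *: (1 : R)).
    exact: is_deriveV.
  have dp := @is_deriveX R R (fun s : R => s^-1) m t 1 _ di.
  have dn := @is_deriveN R R R (fun s : R => s^-1) t 1 _ di.
  have de := @is_derive1_comp R expR (fun s : R => - s^-1) t _ _
    (is_derive_expR _) dn.
  have dM := @is_deriveM R R _ _ t 1 _ _ dp de.
  have gE : g = (fun s : R => s^-1) ^+ m * (expR \o (fun s : R => - s^-1)).
    by apply/funext => s; rewrite /g [RHS]/(_ * _) exprfctE.
  move: dM; rewrite -gE; set val := (X in is_derive _ _ _ X -> _).
  have -> // : val = - (m%:R) * flat m.+1 t + flat m.+2 t.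
  rewrite /val exprfctE /flat t0 /=.
  rewrite -![_ *: _]/(_ * _) mulr1.
  rewrite -exprVn; move: (t^-1) (expR _) => w E.
  by case: m {g gE dp val} => [|m] /=; rewrite ?exprS; ring.
have tg : \forall s \near t, g s = flat m s.
  near=> s; rewrite /flat /g.
  have -> // : 0 < s by near: s; exact: lt_nbhsr.
have dgt : differentiable (g : R^o -> R^o) t.
  by apply/derivable1_diffP; case: dg.
apply: (is_deriv_near tg); apply: is_deriv_of_diff => // v.
rewrite appZl mkopE// diff1E// derive1E.
have [_ H1] := dg; by rewrite H1; exact: mulrC.
Unshelve. all: by end_near. Qed.

Lemma is_deriv_flat_comp V (u : V -> R^o) x u' m : is_deriv u x u' ->
  is_deriv (flat m \o u) x ((- (m%:R) * flat m.+1 (u x) + flat m.+2 (u x)) *: u').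
Proof.
move=> uu'; have := is_deriv_comp (is_deriv_flat m (u x)) uu'.
congr is_deriv; apply: app_ext => v.
have idb : bounded_linear (@id R^o).
  by split=> //; exists 1 => w; rewrite mul1r.
rewrite mkopE; last first.
  by apply: bounded_linear_comp; exact: bounded_linear_app.
by rewrite /comp !appZl mkopE.
Qed.

Lemma is_C_flat V p (X : set V) (u : V -> R^o) m : open X -> is_C p X u ->
  is_C p X (flat m \o u).
Proof.
move=> oX uC; apply: is_C_of_finite_orders => k /(is_C_order uC) {}uC.
elim: k m uC => [|k IH] m uC.
  apply/is_C0P => // x Xx.
  apply: continuous_comp; first exact: (is_C_cont oX uC Xx).
  exact: (is_deriv_continuous (is_deriv_flat m (u x))).
have [u' uu' u'C] := is_C_succ oX uC.
have uC' := is_C_leS uC.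
apply: (is_C_of_deriv oX (f' := fun x =>
  ((- (m%:R) *: (flat m.+1 \o u) + (flat m.+2 \o u)) x : R^o) *: u' x)).
  by move=> x Xx; exact: (is_deriv_flat_comp m (uu' x Xx)).
by apply: is_C_scale => //; apply: is_C_lin => //; exact: IH.
Qed.

Lemma flat_gt0 m t : 0 < t -> 0 < flat m t.
Proof.
by move=> t0; rewrite /flat t0 mulr_gt0 ?expR_gt0// exprn_gt0// invr_gt0.
Qed.

Lemma flat_eq0 m t : t <= 0 -> flat m t = 0.
Proof. by move=> t0; rewrite /flat ltNge t0. Qed.

Lemma flat_ge0 m t : 0 <= flat m t.
Proof. by have [/(flat_gt0 m)/ltW|/(flat_eq0 m) ->] := ltP 0 t. Qed.

Lemma affine_deriv V (a : R) (x0 x : V) :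
  is_deriv (fun x : V => a *: (x - x0)) x (a *: mkop (@id V)).
Proof.
have idb : bounded_linear (@id V).
  by split=> //; exists 1 => v; rewrite mul1r.
have := is_deriv_lin a (is_deriv_bounded_linear x idb) (is_deriv_cst (- (a *: x0)) x).
rewrite addr0; congr is_deriv; apply/funext => y.
by rewrite scalerBr.
Qed.

(** Composition with a dilation multiplies the derivative of order [j] by
    [a ^+ j], which is absorbed in the weight of the jet norm. *)
Lemma is_C_affine V W p (f : V -> W) (a : R) (x0 : V) : is_C p setT f ->
  is_C p setT (fun x => f (a *: (x - x0))) /\
  forall k e x, inN p k -> 0 <= e ->
    jet_norm e k (fun x => f (a *: (x - x0))) x <=
    jet_norm (e * `|a|) k f (a *: (x - x0)).
Proof.
move=> fC.
have H k : is_C (Some k) setT f -> is_C (Some k) setT (fun x => f (a *: (x - x0))) /\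
  forall e x, 0 <= e ->
    jet_norm e k (fun x => f (a *: (x - x0))) x <=
    jet_norm (e * `|a|) k f (a *: (x - x0)).
  elim: k W f {fC} => [|k IH] W f fC.
    split; last by move=> e x e0; rewrite !jet_norm0.
    apply/is_C0P => [|x _]; first exact: openT.
    apply: (@continuous_comp _ _ _ (fun x => a *: (x - x0)) f).
      apply: is_deriv_continuous (affine_deriv a x0 x).
    exact: (is_C_cont openT fC (I : setT _)).
  have [f' ff' f'C] := is_C_succ openT fC.
  have [gC gJ] := IH _ _ f'C.
  pose g := a *: (fun x => f' (a *: (x - x0))).
  have g'C : is_C (Some k) setT g by apply: is_CZ => //; exact: openT.
  have D x : setT x -> is_deriv (fun x => f (a *: (x - x0))) x (g x).
    move=> _.
    have := @is_deriv_comp _ _ _ _ f (fun x => a *: (x - x0)) x _ _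
      (ff' (a *: (x - x0)) Logic.I) (affine_deriv a x0 x).
    congr is_deriv; apply: app_ext => v.
    rewrite mkopE; last by apply: bounded_linear_comp; exact: bounded_linear_app.
    rewrite /comp appZl mkopE.
      by rewrite (linZ _ _ (app_linear _)).
    by split=> //; exists 1 => w; rewrite mul1r.
  split; first exact: (is_C_of_deriv openT D g'C).
  move=> e x e0; rewrite (jet_normS e openT D g'C)// (jet_normS _ openT ff' f'C)//.
  rewrite lerD2l -mulrA ler_wpM2l//.
  have := jet_norm_lin a openT e0 gC (@is_C0 _ _ _ (Some k) setT) (leqnn k : inN (Some k) k)
    (Logic.I : setT x).
  rewrite addr0 => /le_trans -> //.
  rewrite [jet_norm e k 0 x](_ : _ = 0) ?addr0; last first.
    by rewrite [LHS]jet_norm_cst normr0.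
  by rewrite ler_wpM2l// gJ.
split; first by apply: is_C_of_finite_orders => k /(is_C_order fC) /H [].
by move=> k e x /(is_C_order fC)/H [_]; apply.
Qed.

End ScalarFunctions.

(** * Bump functions on row vectors *)
Section Bump.
Context (R : realType) (n : nat).
Local Notation V := 'rV[R]_n.

Definition coord (j : 'I_n) (x : V) : R^o := x ord0 j.

Lemma coord_le j (x : V) : `|coord j x| <= `|x|.
Proof.
rewrite [leRHS]/Num.norm /= mx_normrE; apply/bigmax_geP; right => /=.
by exists (ord0, j).
Qed.

Lemma coord_bounded j : bounded_linear (coord j).
Proof.
split; first by move=> a x y; rewrite /coord !mxE.
by exists 1 => x; rewrite mul1r coord_le.
Qed.

Lemma is_C_coord p X j : open X -> is_C p X (coord j).
Proof. by move=> oX; apply: is_C_linear => //; exact: coord_bounded. Qed.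

Definition sum_sq (x : V) : R^o := \sum_(j < n) coord j x ^+ 2.

Lemma is_C_sum_sq p X : open X -> is_C p X sum_sq.
Proof.
move=> oX.
have -> : sum_sq = \sum_(j < n) (fun x => coord j x *: coord j x).
  apply/funext => x; rewrite fct_sumE; apply: eq_bigr => j _.
  by rewrite expr2.
by apply: is_C_sum => // j _; apply: is_C_scale => //; exact: is_C_coord.
Qed.

Lemma sum_sq_ge1 (x : V) : 1 <= `|x| -> 1 <= sum_sq x.
Proof.
move=> x1.
have x0 : mx_norm x != 0 by rewrite gt_eqF// (lt_le_trans ltr01 x1).
have [[i j] xE] := mx_norm_neq0 x0.
have {xE} xE : `|x| = `|coord j x| by rewrite /coord [LHS]xE /= (ord1 i).
rewrite /sum_sq (bigD1 j)//= -[1]addr0 lerD ?sumr_ge0//; last by move=> *; exact: sqr_ge0.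
by rewrite -[coord j x ^+ 2]ger0_norm ?sqr_ge0// normrX -xE exprn_ege1.
Qed.

Lemma sum_sq_le (x : V) : sum_sq x <= n%:R * `|x| ^+ 2.
Proof.
have -> : n%:R * `|x| ^+ 2 = \sum_(j < n) `|x| ^+ 2.
  by rewrite sumr_const card_ord mulr_natl.
apply: ler_sum => j _.
rewrite -[coord j x ^+ 2]ger0_norm ?sqr_ge0// normrX.
by rewrite lerXn2r ?nnegrE ?coord_le.
Qed.

(** The two arguments of [flat] are never both nonpositive, so that the
    denominator does not vanish; the quotient is 1 where the sum of squares is
    at most 1/2 and 0 where it is at least 1. *)
Definition smooth_bump (x : V) : R^o :=
  flat 0 (1 - sum_sq x) / (flat 0 (1 - sum_sq x) + flat 0 (sum_sq x - 2^-1)).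

Lemma is_C_smooth_bump : is_C None setT smooth_bump.
Proof.
have oT : open [set: V] by exact: openT.
have c1 : is_C None setT (fun x => flat 0 (1 - sum_sq x)).
  apply: (@is_C_flat R V None setT (fun x => 1 - sum_sq x) 0 oT).
  have := is_C_lin (-1) oT (is_C_sum_sq None oT) (@is_C_cst R V R^o None setT 1 oT).
  apply: is_C_eq => // x _; rewrite -[LHS]/(-1 *: sum_sq x + 1).
  by rewrite scaleN1r addrC.
have c2 : is_C None setT (fun x => flat 0 (sum_sq x - 2^-1)).
  apply: (@is_C_flat R V None setT (fun x => sum_sq x - 2^-1) 0 oT).
  exact: (is_CD oT (is_C_sum_sq None oT) (@is_C_cst R V R^o None setT (- 2^-1) oT)).
have c3 := is_CD oT c1 c2.
have c4 : is_C None setT (fun x => (flat 0 (1 - sum_sq x) + flat 0 (sum_sq x - 2^-1))^-1 : R^o).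
  apply: is_C_inv => // x _; rewrite gt_eqF//.
  have [s1|s1] := ltP (sum_sq x) 1.
    by rewrite ltr_pwDl ?flat_ge0 ?flat_gt0 ?subr_gt0.
  rewrite ltr_wpDl ?flat_ge0// flat_gt0// subr_gt0 (lt_le_trans _ s1)//.
  by rewrite invf_lt1// ltr1n.
exact: (is_C_scale oT c1 c4).
Qed.

Lemma smooth_bump_eq0 (x : V) : 1 <= `|x| -> smooth_bump x = 0.
Proof.
by move=> /sum_sq_ge1 x1; rewrite /smooth_bump flat_eq0 ?mul0r// subr_le0.
Qed.

Lemma smooth_bump_eq1 : exists2 r : R, 0 < r & forall x, `|x| <= r -> smooth_bump x = 1.
Proof.
have n0 : 0 < 2 * (n%:R + 1) :> R by rewrite mulr_gt0// ltr_wpDl.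
exists (2 * (n%:R + 1))^-1 => [|x xr]; first by rewrite invr_gt0.
have sx : sum_sq x <= 2^-1.
  apply: (le_trans (sum_sq_le x)).
  have x1 : `|x| <= 1.
    rewrite (le_trans xr)// invf_le1//; have : 0 <= n%:R :> R by []; lra.
  apply: (@le_trans _ _ (n%:R * `|x|)).
    by rewrite ler_wpM2l// expr2 ler_piMl.
  apply: (le_trans (ler_wpM2l _ xr)) => //.
  rewrite ler_pdivrMr// mulrA mulVf ?mul1r// ?lerDl//.
rewrite /smooth_bump [flat 0 (sum_sq x - _)]flat_eq0 ?subr_le0// addr0 divff// gt_eqF//.
by rewrite flat_gt0// subr_gt0 (le_lt_trans sx)// invf_lt1// ltr1n.
Qed.

Lemma smooth_bump_jet_bounded k : exists C, forall x, jet_norm 1 k smooth_bump x <= C.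
Proof.
have oT : open [set: V] by exact: openT.
pose B := [set x : V | `|x| <= 1].
have Bc : compact B.
  apply: bounded_closed_compact; first by exists 1; split => // M M1 x /= x1; rewrite (le_trans x1)// ltW.
  have -> : B = (fun x : V => `|x|) @^-1` [set t : R | t <= 1] by [].
  by apply: closed_comp => [x _|]; [exact: norm_continuous|exact: closed_le].
have H j : exists C, forall x, `|iterDiff j smooth_bump x| <= C.
  have ctn : {within B, continuous (iterDiff j smooth_bump)}.
    apply: continuous_subspaceT => x.
    exact: (is_C_continuous oT is_C_smooth_bump isT Logic.I).
  have /compact_bounded[M [_ HM]] := continuous_compact ctn Bc.
  exists (`|M| + 1) => x.
  have [x1|x1] := leP `|x| 1.
    apply: (HM (`|M| + 1)); first by rewrite (le_lt_trans (ler_norm _))// ltrDl.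
    by exists x.
  rewrite (@iterDiff_zero_near _ _ _ [set x : V | 1 < `|x|]) ?normr0//.
    have -> : [set x : V | 1 < `|x|] = (fun x : V => `|x|) @^-1` [set t : R | 1 < t] by [].
    by apply: open_comp => [y _|]; [exact: norm_continuous|exact: open_gt].
  by move=> y /= /ltW; exact: smooth_bump_eq0.
have [C HC] := choice H.
exists (\sum_(j < k.+1) C j) => x; apply: ler_sum => j _.
by rewrite expr1n mul1r.
Qed.

End Bump.

(** * Taylor monomials and small jets *)
Section TaylorMonomials.
Context (R : realType).
Implicit Types V W : normedModType R.

Lemma bilin_app V W : bilin 1 (@app R V W).
Proof.
split=> //; first by move=> A a u v; exact: app_linear.
by move=> A v; rewrite mul1r app_le.
Qed.

Lemma id_bounded V : bounded_linear (@id V).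
Proof. by split=> //; exists 1 => v; rewrite mul1r. Qed.

Definition monomial V W k (S : symform k V W) (t x : V) : W := S (fun=> x - t).

Lemma vcons_cst (V : Type) k (x : V) : vcons x (fun _ : 'I_k => x) = (fun=> x).
Proof.
by apply/funext => i; case: (unliftP ord0 i) => [j ->|->]; rewrite ?vconsS ?vcons0.
Qed.

Lemma monomialS V W k (S : symform k.+1 V W) t x :
  monomial S t x = app (monomial (cur S) t x) (x - t).
Proof. by rewrite /monomial curE vcons_cst. Qed.

(** [monomial S t x] is the operator [monomial (cur S) t x] applied to
    [x - t]; by the product rule and the symmetry of [S] all [k.+1] variables
    contribute equally. *)
Lemma monomial_deriv V W k (S : symform k.+1 V W) t x :
  is_deriv (monomial S t) x (k.+1%:R *: monomial (cur S) t x).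
Proof.
elim: k W S => [|k IH] W S.
  have -> : 1%:R *: monomial (cur S) t x = S.
    apply: app_ext => w; rewrite scale1r /monomial curE /app; congr (S _).
    by apply/funext => i; rewrite (ord1 i) vcons0.
  have : is_deriv (app S) (x - t) S.
    have := is_deriv_bounded_linear (x - t) (bounded_linear_app S).
    by congr is_deriv; apply: app_ext => v; rewrite mkopE//; exact: bounded_linear_app.
  exact: is_deriv_shift.
have -> : monomial S t = fun y => app (monomial (cur S) t y) (y - t).
  by apply/funext => y; rewrite monomialS.
have dt : is_deriv (fun y => y - t) x (mkop (@id V)).
  exact: is_deriv_shift (is_deriv_bounded_linear _ (id_bounded V)).
have := is_deriv_bilin (bilin_app V W) (IH _ (cur S)) dt.
congr is_deriv; apply: app_ext => w.
rewrite appDl (bilin1E (bilin_app V W)) (bilin2E _ _ _ (bilin_app V W)).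
rewrite mkopE; last exact: id_bounded.
rewrite !appZl.
have -> : app (app (monomial (cur (cur S)) t x) w) (x - t) =
    app (monomial (cur S) t x) w.
  by rewrite /monomial !curE symform_swap vcons_cst.
by rewrite /= -[X in _ + X = _]scale1r -scalerDl natr1.
Qed.

Lemma is_C_monomial V W p X k (S : symform k V W) t : open X -> is_C p X (monomial S t).
Proof.
move=> oX; elim: k W S p => [|k IH] W S p.
  rewrite (_ : monomial S t = cst (S (fun=> 0))); first exact: is_C_cst.
  by apply/funext => x; rewrite /monomial /cst; congr (S _); apply/funext => -[].
apply: is_C_of_finite_orders => -[|m] _.
  apply/is_C0P => // x _; exact: (is_deriv_continuous (monomial_deriv S t x)).
apply: (is_C_of_deriv oX (f' := k.+1%:R *: monomial (cur S) t)).
  by move=> x _; exact: monomial_deriv.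
by apply: is_CZ => //; exact: IH.
Qed.

Lemma iterDiffS_cst V W k (w : W) (x : V) : iterDiff k.+1 (cst w) x = 0.
Proof.
apply/eqP; rewrite -normr_eq0.
rewrite (@norm_iterDiffS _ _ _ setT (cst w) (cst 0) k openT)//.
- by rewrite (@iterDiff_zero_near _ _ _ setT) ?normr0//; exact: openT.
- by move=> y _; exact: is_deriv_cst.
- by apply: is_C_cst; exact: openT.
Qed.

Lemma iterDiffZ V W (X : set V) p (f : V -> W) a k x : open X -> is_C p X f ->
  inN p k -> X x -> iterDiff k (a *: f) x = a *: iterDiff k f x.
Proof.
move=> oX fC pk Xx; rewrite -[a *: f]addr0 (iterDiff_lin a oX fC (is_C0 _ _ _) pk Xx).
by rewrite iterDiff0 addr0.
Qed.

(** The Taylor polynomial of a monomial at its centre is itself. *)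
Lemma iterDiff_monomial V W k (S : symform k V W) t :
  iterDiff k (monomial S t) t = (k`!)%:R *: S /\
  (forall j, j != k -> iterDiff j (monomial S t) t = 0).
Proof.
elim: k W S => [|k IH] W S.
  have E : monomial S t = cst (S (fun=> 0)).
    by apply/funext => x; rewrite /monomial /cst; congr (S _); apply/funext => -[].
  split=> [|[//|j] _]; last by rewrite E iterDiffS_cst.
  rewrite fact0 scale1r; apply: symform_ext => v; rewrite E /=.
  by congr (S _); apply/funext => -[].
have D j : cur (iterDiff j.+1 (monomial S t) t) =
    k.+1%:R *: iterDiff j (monomial (cur S) t) t.
  have mC := @is_C_monomial _ _ None setT k (cur S) t openT.
  have mC' : is_C (Some j) setT (k.+1%:R *: monomial (cur S) t).
    by apply: (is_C_order _ (isT : inN None j)); apply: is_CZ => //; exact: openT.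
  have [_ _ ->] := iterDiff_antiderivative openT (fun x _ => monomial_deriv S t x) mC'
    (leqnn j) (Logic.I : setT t).
  exact: (iterDiffZ _ openT mC).
have [IH1 IH2] := IH _ (cur S).
split=> [|[_|j jk]].
- apply: cur_inj; rewrite D IH1 scalerA factS natrM.
  by rewrite (linZ _ _ (@cur_lin _ _ _ _)).
- apply: symform_ext => v /=; rewrite /monomial.
  by apply: (@symform_eq0 _ _ _ _ _ _ ord0); rewrite subrr.
- apply: cur_inj; rewrite D IH2// scaler0.
  by rewrite (lin0 (@cur_lin _ _ _ _)).
Qed.

(** Taylor estimate without remainder formula: by induction the jet of the
    derivative is small, and the mean value inequality on the segment from
    [x0] to [x] controls the value of [f]. *)
Lemma small_jets V W (X : set V) (f : V -> W) k x0 : open X -> X x0 ->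
  is_C (Some k) X f -> (forall j, (j <= k)%N -> iterDiff j f x0 = 0) ->
  forall d, 0 < d -> exists2 r, 0 < r & forall e x, 0 < e -> e <= r ->
    `|x - x0| <= e -> X x /\ jet_norm e k f x <= d * e ^+ k.
Proof.
move=> oX Xx0.
have [r0 r00 Xr0] : exists2 r, 0 < r & forall x, `|x - x0| <= r -> X x.
  have /nbhs_ballP[r /= r0 rX] : nbhs x0 X by exact: open_nbhs_nbhs.
  exists (r / 2) => [|x xr]; first by rewrite divr_gt0.
  apply: rX; rewrite -ball_normE /= distrC (le_lt_trans xr)//.
  by rewrite ltr_pdivrMr// ltr_pMr// ltr1n.
elim: k W f => [|k IH] W f fC f0 d d0.
  have fx0 : f x0 = 0.
    have := f0 0 isT => /(congr1 (fun S : symform 0 V W => S (fun=> 0))) //.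
  have /cvgrPdist_le/(_ _ d0) := is_C_cont oX fC Xx0.
  move=> /nbhs_ballP[r /= rp rf].
  exists (Num.min r0 (r / 2)) => [|e x e0]; first by rewrite lt_min r00 divr_gt0.
  rewrite le_min => /andP[er0 er] xe; split; first by apply: Xr0; exact: le_trans er0.
  rewrite jet_norm0 expr0 mulr1.
  have := rf x; rewrite -ball_normE /= fx0 sub0r normrN; apply.
  rewrite distrC (le_lt_trans xe)// (le_lt_trans er)//.
  by rewrite ltr_pdivrMr// ltr_pMr// ltr1n.
have [f' ff' f'C] := is_C_succ oX fC.
have f'0 j : (j <= k)%N -> iterDiff j f' x0 = 0.
  move=> jk; apply/eqP; rewrite -normr_eq0 -(norm_iterDiffS oX ff' f'C jk Xx0).
  by rewrite f0// normr0.
have fx0 : f x0 = 0.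
  have := f0 0 isT => /(congr1 (fun S : symform 0 V W => S (fun=> 0))) //.
have d2 : 0 < d / 2 by rewrite divr_gt0.
have [r rp rf] := IH _ f' f'C f'0 _ d2.
exists (Num.min r0 r) => [|e x e0]; first by rewrite lt_min r00.
rewrite le_min => /andP[er0 er] xe.
have Xx : X x by apply: Xr0; exact: le_trans er0.
split=> //; rewrite (jet_normS e oX ff' f'C Xx).
have [_ Jx] := rf e x e0 er xe.
rewrite [d in leRHS]splitr mulrDl; apply: lerD; last first.
  by rewrite exprS mulrCA ler_wpM2l// ltW.
have := @mean_value_inequality R V W f x0 (x - x0) (d / 2 * e ^+ k.+1).
rewrite subrKC fx0 subr0; apply=> t /andP[t0 t1].
have te : `|x0 + t *: (x - x0) - x0| <= e.
  by rewrite add_subl normrZ ger0_norm// (le_trans _ xe)// ler_piMl.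
have [Xt Jt] := rf e _ e0 er te.
exists (f' (x0 + t *: (x - x0))); first exact: ff'.
rewrite (le_trans (app_le _ _))// exprSr mulrA.
apply: ler_pM => //; apply: le_trans Jt; apply: jet_norm_ge; exact: ltW.
Qed.

Lemma jet_vanish_bilin_aux V W1 W2 W3 C (B : W1 -> W2 -> W3) (X : set V) k f g g' x0 :
  open X -> X x0 -> bilin C B -> is_C (Some k.+1) X f -> is_C (Some k.+1) X g ->
  (forall x, X x -> is_deriv g x (g' x)) -> is_C (Some k) X g' ->
  f x0 = 0 -> jet_norm 1 k g x0 = 0 ->
  jet_norm 1 k.+1 (fun x => B (f x) (g x)) x0 <=
  jet_norm 1 k (fun x => bilin2 B (f x) (g' x)) x0.
Proof.
move=> oX Xx0 HB fC gC gg' g'C fx0 g0.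
have [f' ff' f'C] := is_C_succ oX fC.
have [C0 Bl Br BC] := HB.
have D x : X x -> is_deriv (fun x => B (f x) (g x)) x
   (((fun x => bilin1 B (f' x) (g x)) + (fun x => bilin2 B (f x) (g' x))) x).
  by move=> Xx; exact: (is_deriv_bilin HB (ff' _ Xx) (gg' _ Xx)).
have [c1 j1] := is_C_bilin oX (bilin1P V HB) f'C (is_C_leS gC).
have [c2 _] := is_C_bilin oX (bilin2P V HB) (is_C_leS fC) g'C.
rewrite (jet_normS 1 oX D (is_CD oX c1 c2) Xx0) mul1r.
rewrite fx0 (lin0 (Bl _)) normr0 add0r.
apply: (le_trans (jet_normD oX ler01 c1 c2 Xx0)).
by rewrite gerDr; apply: (le_trans (j1 1 x0 ler01 Xx0)); rewrite g0 mulr0.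
Qed.

(** Multiplication by a factor vanishing at [x0] raises the order of vanishing
    by one. *)
Lemma jet_vanish_bilin V W1 W2 W3 C (B : W1 -> W2 -> W3) (X : set V) k f g x0 :
  open X -> X x0 -> bilin C B -> is_C (Some k.+1) X f -> is_C (Some k.+1) X g ->
  f x0 = 0 -> jet_norm 1 k g x0 = 0 ->
  jet_norm 1 k.+1 (fun x => B (f x) (g x)) x0 = 0.
Proof.
move=> oX Xx0; elim: k W2 W3 B g => [|k IH] W2 W3 B g HB fC gC fx0 g0.
  have [g' gg' g'C] := is_C_succ oX gC.
  apply/le_anti; rewrite jet_norm_ge0// andbT.
  apply: (le_trans (jet_vanish_bilin_aux oX Xx0 HB fC gC gg' g'C fx0 g0)).
  have [_ B2l _ _] := bilin2P V HB.
  by rewrite jet_norm0 fx0 (lin0 (B2l _)) normr0.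
have [g' gg' g'C] := is_C_succ oX gC.
apply/le_anti; rewrite jet_norm_ge0// andbT.
apply: (le_trans (jet_vanish_bilin_aux oX Xx0 HB fC gC gg' g'C fx0 g0)).
rewrite (IH _ _ (bilin2 B) g' (bilin2P V HB) (is_C_leS fC) g'C fx0)//.
apply/le_anti; rewrite jet_norm_ge0// andbT -g0.
by rewrite (jet_normS 1 oX gg' (is_C_leS g'C) Xx0) mul1r lerDr.
Qed.

Lemma is_C_pow V p (X : set V) (u : V -> R^o) m : open X -> is_C p X u ->
  is_C p X (fun x => u x ^+ m : R^o).
Proof.
move=> oX uC; elim: m => [|m IH]; first exact: (@is_C_cst R V R^o p X 1 oX).
by apply: is_C_eq (is_C_scale oX uC IH) => // x _; rewrite exprS.
Qed.

Lemma jet_vanish_pow V W (X : set V) (u : V -> R^o) (f : V -> W) k x0 :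
  open X -> X x0 -> is_C (Some k) X u -> is_C (Some k) X f -> u x0 = 0 ->
  jet_norm 1 k (fun x => u x ^+ k.+1 *: f x) x0 = 0.
Proof.
move=> oX Xx0 uC fC ux0.
suff H i : (i <= k)%N -> jet_norm 1 i (fun x => u x ^+ i.+1 *: f x) x0 = 0.
  exact: H.
elim: i => [_|i IH ik]; first by rewrite jet_norm0 ux0 expr1 scale0r normr0.
have -> : (fun x => u x ^+ i.+2 *: f x) = (fun x => u x *: (u x ^+ i.+1 *: f x)).
  by apply/funext => x; rewrite scalerA -exprS.
apply: (jet_vanish_bilin oX Xx0 (bilin_scale W)) => //.
- exact: is_C_order uC _.
- apply: (@is_C_order _ _ _ (Some k)) => //.
  by apply: is_C_scale => //; exact: is_C_pow.
- by apply: IH; exact: ltnW.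
Qed.

End TaylorMonomials.

(** * Norming functionals *)
Section HahnBanach.
Context (R : realType) (F : normedModType R) (w0 : F).

(** Functionals on subspaces are represented by their graphs, ordered by
    inclusion; domination by the norm makes these relations single-valued. *)
Let dominated (A : set (F * R)) : Prop :=
  (forall a u r v s, A (u, r) -> A (v, s) -> A (a *: u + v, a * r + s)) /\
  (forall u r, A (u, r) -> r <= `|u|).

Let admissible (A : set (F * R)) : Prop :=
  dominated A /\ (A !=set0 -> A (w0, `|w0|)).

Let graph0 (A : set (F * R)) u r : dominated A -> A (u, r) -> A (0, 0).
Proof.
move=> [Al _] Aur; have := Al (-1) u r u r Aur Aur.
by rewrite scaleN1r mulN1r !addNr.
Qed.

Let graphZ (A : set (F * R)) a u r : dominated A -> A (u, r) -> A (a *: u, a * r).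
Proof.
move=> Ad Aur; have := Ad.1 a u r 0 0 Aur (graph0 Ad Aur).
by rewrite !addr0.
Qed.

Let admissible_chain (C : set (set (F * R))) : C `<=` admissible ->
  total_on C subset -> admissible (\bigcup_(A in C) A).
Proof.
move=> CP Ctot; split; last first.
  by move=> [x [A CA Ax]]; exists A => //; apply: (CP _ CA).2; exists x.
split; last by move=> u r [A CA Aur]; exact: (CP _ CA).1.2 Aur.
move=> a u r v s [A CA Aur] [B CB Bvs].
have [AB|BA] := Ctot _ _ CA CB.
  by exists B => //; apply: (CP _ CB).1.1 => //; exact: AB.
by exists A => //; apply: (CP _ CA).1.1 => //; exact: BA.
Qed.

Let admissible_line : admissible [set x | exists a, x = (a *: w0, a * `|w0|)].
Proof.
split; last by move=> _; exists 1; rewrite scale1r mul1r.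
split=> [a u r v s [b [-> ->]] [c [-> ->]]|u r [a [-> ->]]].
  by exists (a * b + c); rewrite scalerDl mulrDl scalerA mulrA.
by rewrite normrZ ler_wpM2r// ler_norm.
Qed.

(** The value [c] at [x] must lie above all [r - |u - x|] and below all
    [|v + x| - s]; the triangle inequality makes this possible. *)
Let extend (A : set (F * R)) (x : F) : admissible A -> A (w0, `|w0|) ->
  exists c, admissible [set z | exists u r t, A (u, r) /\ z = (u + t *: x, r + t * c)].
Proof.
move=> [Ad _] A0.
have le1 u r v s : A (u, r) -> A (v, s) -> r - `|u - x| <= `|v + x| - s.
  move=> Au Av; rewrite lerBlDr addrAC lerBrDr.
  have := Ad.2 _ _ (Ad.1 1 _ _ _ _ Au Av); rewrite scale1r mul1r => /le_trans; apply.
  have -> : u + v = (v + x) + (u - x) by rewrite addrACA subrr addr0 addrC.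
  exact: ler_normD.
pose S := [set z : R | exists u r, A (u, r) /\ z = r - `|u - x|].
have hS : has_sup S.
  split; first by exists (`|w0| - `|w0 - x|), w0, `|w0|.
  by exists (`|w0 + x| - `|w0|) => _ [u [r [Au ->]]]; exact: le1.
pose c := sup S.
have c1 u r : A (u, r) -> r - `|u - x| <= c.
  by move=> Au; apply: (sup_upper_bound hS); exists u, r.
have c2 v s : A (v, s) -> c <= `|v + x| - s.
  move=> Av; apply: ge_sup; first by case: hS.
  by move=> _ [u [r [Au ->]]]; exact: le1.
exists c; split; last by exists w0, `|w0|, 0; rewrite scale0r mul0r !addr0.
split=> [a _ _ _ _ [u [r [t [Au [-> ->]]]]] [v [s [t' [Av [-> ->]]]]]|].
  exists (a *: u + v), (a * r + s), (a * t + t'); split; first exact: Ad.1.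
  congr pair; last by ring.
  by rewrite scalerDr scalerDl scalerA addrACA.
move=> _ _ [u [r [t [Au [-> ->]]]]].
have [t0|t0|->] := ltrgtP t 0; last first.
- by rewrite scale0r mul0r !addr0; exact: Ad.2.
- have := c2 _ _ (graphZ t^-1 Ad Au).
  have -> : t^-1 *: u + x = t^-1 *: (u + t *: x).
    by rewrite scalerDr scalerA mulVf ?scale1r// gt_eqF.
  rewrite normrZ gtr0_norm ?invr_gt0// -mulrBr ler_pdivlMl//; lra.
- have nt : 0 < - t by rewrite oppr_gt0.
  have := c1 _ _ (graphZ (- t)^-1 Ad Au).
  have -> : (- t)^-1 *: u - x = (- t)^-1 *: (u + t *: x).
    rewrite scalerDr scalerA invrN mulNr mulVf ?scaleN1r//.
    by rewrite lt_eqF.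
  rewrite normrZ gtr0_norm ?invr_gt0// -mulrBr ler_pdivrMl//; lra.
Qed.

Lemma norming_functional : exists2 l : F -> R^o, bounded_linear l & l w0 = `|w0|.
Proof.
have [A [AP Amax]] := Zorn_bigcup admissible_chain.
have A0 : A (w0, `|w0|).
  have [A0|/set0P/AP.2//] := eqVneq A set0.
  exfalso; apply: (Amax _ _ admissible_line); rewrite A0; split=> //.
  by move=> /(_ (w0, `|w0|)); apply; exists 1; rewrite scale1r mul1r.
have [Ad _] := AP.
have tot x : exists r, A (x, r).
  apply: contrapT => nx; have [c Bc] := extend x AP A0.
  apply: (Amax _ _ Bc); split.
    by move=> [u r] Aur; exists u, r, 0; rewrite scale0r mul0r !addr0.
  move=> /(_ (x, c)) h; apply: nx; exists c; apply: h.
  exists 0, 0, 1; rewrite scale1r mul1r !add0r; split=> //.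
  exact: graph0 A0.
have fn x r s : A (x, r) -> A (x, s) -> r <= s.
  move=> Ar As; have := Ad.2 _ _ (Ad.1 (-1) _ _ _ _ As Ar).
  rewrite scaleN1r addNr normr0 mulN1r; lra.
have [l Al] := choice tot.
exists l; last by apply/le_anti; rewrite !(fn w0).
split.
  move=> a u v; have Auv := Ad.1 a _ _ _ _ (Al u) (Al v).
  by apply/le_anti/andP; split; exact: fn Auv || exact: (fn _ _ _ Auv).
exists 1 => v; rewrite mul1r ler_norml Ad.2// andbT.
have := Ad.2 _ _ (graphZ (-1) Ad (Al v)); rewrite scaleN1r normrN; lra.
Qed.

End HahnBanach.

(** * Zeros of polynomials with smooth coefficients *)
Section Implicit.
Context (R : realType) (H : normedModType R).

(** As a continuous zero [h] is given, only its regularity is at stake. The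
    divided difference [Q y z] satisfies
    [Q y z * (h z - h y) = - \sum_i h y ^+ i * (c i z - c i y)] and is
    continuous and nonzero at [z = y]. Hence [h] is differentiable, with a
    derivative given by a formula in [h] and the [c i]: if [h] is [C^m] then so
    is its derivative, as long as [m < q]. *)
Lemma is_C_implicit q N (O : set H) (c : nat -> H -> R^o) (h : H -> R^o) :
  open O -> (forall i, is_C (Some q) O (c i)) ->
  (forall y, O y -> {for y, continuous h}) ->
  (forall y, O y -> \sum_(i < N) c i y * h y ^+ i = 0) ->
  (forall y, O y -> \sum_(i < N) c i y * (h y ^+ i.-1 *+ i) != 0) ->
  is_C (Some q) O h.
Proof.
move=> oO cC hc h0 hd.
(* divided difference in [h y] and [h z] of the polynomial at [z] *)
pose Q y z : R^o := \sum_(i < N) c i z * \sum_(l < i) h z ^+ (i.-1 - l) * h y ^+ l.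
have QE y : Q y y = \sum_(i < N) c i y * (h y ^+ i.-1 *+ i).
  apply: eq_bigr => i _; congr (_ * _).
  rewrite -[X in _ *+ X]card_ord -sumr_const; apply: eq_bigr => l _.
  by rewrite -exprD subnK// -ltnS prednK// (leq_ltn_trans _ (ltn_ord l)).
have sumC p (I : finType) (f : I -> H -> R^o) : (forall i, is_C p O (f i)) ->
    is_C p O (fun y => \sum_i f i y : R^o).
  move=> fC; have -> : (fun y => \sum_i f i y : R^o) = \sum_i f i.
    by apply/funext => y; rewrite fct_sumE.
  exact: is_C_sum.
have smul p (f g : H -> R^o) : is_C p O f -> is_C p O g ->
    is_C p O (fun y => f y * g y : R^o).
  by move=> fC gC; exact: is_C_scale.
have h0C : is_C (Some 0) O h by apply/is_C0P.
have Qc y z : O z -> {for z, continuous (Q y)}.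
  move=> Oz; apply: (is_C_cont oO _ Oz (p := Some 0)).
  apply: (sumC) => i; apply: (smul); first exact: is_C_order (cC i) _.
  apply: (sumC) => l; apply: (smul); first exact: is_C_pow.
  exact: (@is_C_cst R H R^o (Some 0) O (h y ^+ l) oO).
have diffh y z : O y -> O z -> Q y z * (h z - h y) =
    - \sum_(i < N) h y ^+ i * (c i z - c i y).
  move=> Oy Oz; rewrite mulr_suml.
  transitivity (\sum_(i < N) (c i z * h z ^+ i - c i z * h y ^+ i)).
    apply: eq_bigr => i _; rewrite -mulrBr subrXX -mulrA; congr (_ * _).
    by rewrite mulrC.
  have -> : \sum_(i < N) h y ^+ i * (c i z - c i y) =
      \sum_(i < N) c i z * h y ^+ i - \sum_(i < N) c i y * h y ^+ i.
    by rewrite -sumrB; apply: eq_bigr => i _; rewrite mulrBr !(mulrC (h y ^+ i)).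
  by rewrite sumrB !h0// sub0r subr0.
suff HC m : (m <= q)%N -> is_C (Some m) O h by exact: HC.
elim: m => // m IH mq.
have hm := IH (ltnW mq).
have cS i : (forall x, O x -> is_deriv (c i) x (iterDiff 1 (c i) x)) /\
    is_C (Some m) O (iterDiff 1 (c i)).
  by apply: is_C_deriv => //; exact: is_C_order (cC i) _.
pose w' y := \sum_(i < N) h y ^+ i *: iterDiff 1 (c i) y.
pose h' y := - (Q y y)^-1 *: w' y.
apply: (is_C_of_deriv oO (f' := h')); last first.
  apply: is_C_scale => //.
    have : is_C (Some m) O (fun y => (Q y y)^-1 : R^o).
      apply: is_C_inv => //; last by move=> y Oy; rewrite QE hd.
      have -> : (fun y => Q y y) = (fun y => \sum_(i < N) c i y * (h y ^+ i.-1 *+ i)).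
        by apply/funext => y; rewrite QE.
      apply: (sumC) => i; apply: (smul); first exact: is_C_order (cC i) (ltnW mq).
      have := is_CZ (i%:R) oO (is_C_pow i.-1 oO hm).
      by apply: is_C_eq => // y _; rewrite -[LHS]/(i%:R *: (h y ^+ i.-1 : R^o)) scaler_nat.
    move=> /(is_CZ (-1) oO); apply: is_C_eq => // y _.
    by rewrite -[LHS]/(-1 *: _) scaleN1r.
  have -> : w' = \sum_(i < N) (fun y => h y ^+ i *: iterDiff 1 (c i) y).
    by apply/funext => y; rewrite fct_sumE.
  apply: is_C_sum => // i _; apply: is_C_scale => //; first exact: is_C_pow.
  exact: (cS i).2.
move=> y Oy.
have Qy0 : Q y y != 0 by rewrite QE hd.
pose w z : R^o := \sum_(i < N) h y ^+ i * (c i z - c i y).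
have wD : is_deriv w y (w' y).
  have -> : w = \sum_(i < N) (fun z => h y ^+ i *: (c i z - c i y) : R^o).
    by apply/funext => z; rewrite fct_sumE.
  rewrite /w'; elim/big_rec2: _ => [|i f' f _ fD]; first exact: is_deriv_cst.
  apply: (@is_deriv_lin R H R^o (h y ^+ i) (fun z => c i z - c i y)) => //.
  move=> e e0; have [/(_ y Oy e e0) + _] := cS i.
  by apply: filterS => z; rewrite subrr subr0.
have rC : {for y, continuous (fun z => - (Q y z)^-1 : R^o)}.
  by apply: cvgN; apply: cvgV => //; exact: Qc.
have w0 : w y = 0 by rewrite /w big1// => i _; rewrite subrr mulr0.
have := is_deriv_lin 1 (is_deriv_mul_vanishing rC wD w0) (is_deriv_cst (h y) y).
rewrite scale1r addr0; apply: is_deriv_near.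
near=> z; rewrite scale1r /cst.
have Oz : O z by near: z; exact: open_nbhs_nbhs.
have Qz : Q y z != 0 by near: z; have /cvgr_neq0/(_ Qy0) := Qc y y Oy.
have := diffh y z Oy Oz; rewrite -/(w z) => E.
apply: (addIr (- h y)); rewrite addrK; apply: (mulfI Qz).
by rewrite E -[_ *: _]/(_ * _) mulNr mulrN mulVKf.
Unshelve. all: by end_near. Qed.

End Implicit.

(** * The topology of the spaces C^p *)
Section CspaceBasics.
Context (R : realType) (V W : normedModType R) (p : option nat) (X : set V).
Context (oX : open X).
Local Notation C := (Cspace p oX W).
Implicit Types (f g : C) (K : set V).

Lemma Cspace_is_C f : is_C p X f.
Proof. by have := CfunP f; rewrite inE => -[]. Qed.

Lemma Cspace_out f x : ~ X x -> f x = 0.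
Proof. by have := CfunP f; rewrite inE => -[_]; apply. Qed.

Lemma Cspace_ext f g : (forall x, X x -> f x = g x) -> f = g.
Proof.
move=> fg; apply/val_inj/funext => x; have [/fg//|nX] := pselect (X x).
exact: etrans (Cspace_out _ nX) (esym (Cspace_out _ nX)).
Qed.

Lemma Cspace_lin f g a x : (a *: f + g : C) x = a *: f x + g x.
Proof. by []. Qed.

Definition restrict0 (u : V -> W) (x : V) : W := if `[< X x >] then u x else 0.

Lemma restrict0E u x : X x -> restrict0 u x = u x.
Proof. by move=> /asboolT; rewrite /restrict0 => ->. Qed.

(** The value 0 is taken when [u] is not of class [C^p] on [X]. *)
Definition ofC (u : V -> W) : C := insubd 0 (restrict0 u).

Lemma ofCE u x : is_C p X u -> X x -> ofC u x = u x.
Proof.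
move=> uC Xx.
have H : restrict0 u \in Cpred_of p oX.
  rewrite inE; split; last by move=> y nX; rewrite /restrict0 asboolF.
  by apply: is_C_eq uC => // y Xy; rewrite restrict0E.
by rewrite -[RHS](restrict0E u Xx) -[in RHS](insubdK (0 : C) H).
Qed.

Lemma iterDiff_Cspace_lin f g a k x : inN p k -> X x ->
  iterDiff k (a *: f + g : C) x = a *: iterDiff k f x + iterDiff k g x.
Proof.
by move=> pk Xx; apply: (iterDiff_lin a oX (Cspace_is_C f) (Cspace_is_C g)).
Qed.

Lemma inN_le k j : inN p k -> (j <= k)%N -> inN p j.
Proof. by case: p => //= m; move=> ? /leq_trans; apply. Qed.

Lemma inN_max k j : inN p k -> inN p j -> inN p (maxn k j).
Proof. by case: p => //= m; rewrite geq_max => -> ->. Qed.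

Let inner k f x := [set `|iterDiff j f x| | j in `I_k.+1].

Let inner_sup k f x : has_sup (inner k f x).
Proof.
split; first by exists `|iterDiff 0 f x|, 0.
exists (jet_norm 1 k f x) => _ [j /= jk <-].
rewrite /jet_norm (bigD1 (Ordinal jk))//= expr1n mul1r lerDl.
by apply: sumr_ge0 => i _; rewrite expr1n mul1r.
Qed.

Lemma iterDiff_le_jet k j (f : V -> W) x : (j <= k)%N ->
  `|iterDiff j f x| <= jet_norm 1 k f x.
Proof.
rewrite -ltnS => jk; rewrite /jet_norm (bigD1 (Ordinal jk))//= expr1n mul1r lerDl.
by apply: sumr_ge0 => i _; rewrite expr1n mul1r.
Qed.

Lemma seminorm_le K k f c : 0 <= c ->
  (forall x, K x -> forall j, (j <= k)%N -> `|iterDiff j f x| <= c) ->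
  Cseminorm K k f <= c.
Proof.
move=> c0 H; have [[x Kx]|K0] := pselect (K !=set0); last first.
  rewrite /Cseminorm (_ : K = set0) ?image_set0 ?sup0//.
  by apply/seteqP; split=> // x Kx; case: K0; exists x.
apply: ge_sup; first by exists (sup (inner k f x)), x.
move=> _ [y Ky <-]; apply: ge_sup; first by case: (inner_sup k f y).
by move=> _ [j /= jk <-]; apply: H.
Qed.

Lemma seminorm_ge K k f x j : compact K -> K `<=` X -> inN p k -> K x -> (j <= k)%N ->
  `|iterDiff j f x| <= Cseminorm K k f.
Proof.
move=> cK KX pk Kx jk.
apply: (@le_trans _ _ (sup (inner k f x))).
  by apply: (sup_upper_bound (inner_sup k f x)); exists j.
apply: sup_upper_bound; last by exists x.
split; first by exists (sup (inner k f x)), x.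
have B i : exists M, (i <= k)%N -> forall y, K y -> `|iterDiff i f y| <= M.
  have [ik|] := boolP (i <= k)%N; last by exists 0.
  have ctn : {within K, continuous (iterDiff i f)}.
    by apply: continuous_subspaceW KX _; exact: (Cspace_is_C f).2 (inN_le pk ik).
  have /compact_bounded[M [_ HM]] := continuous_compact ctn cK.
  exists (`|M| + 1) => _ y Ky; apply: (HM (`|M| + 1)).
    by rewrite (le_lt_trans (ler_norm _))// ltrDl.
  by exists y.
have [M HM] := choice B.
exists (\sum_(i < k.+1) `|M i|) => _ [y Ky <-].
apply: ge_sup; first by case: (inner_sup k f y).
move=> _ [i /= ik <-]; apply: (le_trans (HM i _ y Ky)) => //.
rewrite (bigD1 (Ordinal ik))//= (le_trans (ler_norm _))// lerDl.
by apply: sumr_ge0.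
Qed.

Lemma seminorm_ge0 K k f : compact K -> K `<=` X -> inN p k -> 0 <= Cseminorm K k f.
Proof.
move=> cK KX pk; have [[x Kx]|K0] := pselect (K !=set0).
  by apply: le_trans (seminorm_ge f cK KX pk Kx (leq0n k)).
rewrite /Cseminorm (_ : K = set0) ?image_set0 ?sup0//.
by apply/seteqP; split=> // x Kx; case: K0; exists x.
Qed.

Lemma seminorm_lin K k f g a : compact K -> K `<=` X -> inN p k ->
  Cseminorm K k (a *: f + g) <= `|a| * Cseminorm K k f + Cseminorm K k g.
Proof.
move=> cK KX pk; apply: seminorm_le => [|x Kx j jk].
  by rewrite addr_ge0 ?mulr_ge0 ?seminorm_ge0.
rewrite iterDiff_Cspace_lin//; [|exact: inN_le jk|exact: KX].
rewrite (le_trans (ler_normD _ _))// normrZ lerD//; last exact: seminorm_ge.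
by rewrite ler_wpM2l// seminorm_ge.
Qed.

Lemma seminorm0 K k : Cseminorm K k (0 : C) = 0 :> R.
Proof.
have [[x Kx]|K0] := pselect (K !=set0); last first.
  rewrite /Cseminorm (_ : K = set0) ?image_set0 ?sup0//.
  by apply/seteqP; split=> // x Kx; case: K0; exists x.
have I0 j y : iterDiff j (0 : C) y = 0 :> symform j V W.
  exact: iterDiff0.
apply/le_anti/andP; split.
  by apply: seminorm_le => // y _ j _; rewrite I0 normr0.
have E : inner k (0 : C) = fun=> [set 0].
  apply/funext => y; apply/seteqP; split=> [_ [j _ <-]|_ ->].
    by rewrite /= I0 normr0.
  by exists 0 => //; rewrite I0 normr0.
have -> : Cseminorm K k (0 : C) = sup [set sup (inner k (0 : C) y) | y in K] by [].
rewrite E sup1.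
have -> : [set (0 : R) | y in K] = [set 0].
  by apply/seteqP; split=> [_ [y _ <-]//|_ ->]; exists x.
by rewrite sup1.
Qed.

Lemma seminormZ K k f a : compact K -> K `<=` X -> inN p k ->
  Cseminorm K k (a *: f) <= `|a| * Cseminorm K k f.
Proof.
move=> cK KX pk; have := seminorm_lin f 0 a cK KX pk.
by rewrite addr0 seminorm0 addr0.
Qed.

Lemma seminormD K k f g : compact K -> K `<=` X -> inN p k ->
  Cseminorm K k (f + g) <= Cseminorm K k f + Cseminorm K k g.
Proof.
move=> cK KX pk; have := seminorm_lin f g 1 cK KX pk.
by rewrite scale1r normr1 mul1r.
Qed.

Lemma seminorm_mono K K' k k' f : compact K' -> K' `<=` X -> inN p k' ->
  K `<=` K' -> (k <= k')%N -> Cseminorm K k f <= Cseminorm K' k' f.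
Proof.
move=> cK KX pk KK' kk'; apply: seminorm_le; first exact: seminorm_ge0.
by move=> x Kx j jk; apply: seminorm_ge => //; [exact: KK'|exact: leq_trans kk'].
Qed.

Lemma jet_le_seminorm K k f x : compact K -> K `<=` X -> inN p k -> K x ->
  jet_norm 1 k f x <= k.+1%:R * Cseminorm K k f.
Proof.
move=> cK KX pk Kx.
have -> : k.+1%:R * Cseminorm K k f = \sum_(j < k.+1) Cseminorm K k f.
  by rewrite sumr_const card_ord mulr_natl.
apply: ler_sum => j _; rewrite expr1n mul1r; apply: seminorm_ge => //.
by rewrite -ltnS.
Qed.

Lemma seminorm_le_jet K k f c : 0 <= c ->
  (forall x, K x -> jet_norm 1 k f x <= c) -> Cseminorm K k f <= c.
Proof.
move=> c0 H; apply: seminorm_le => // x Kx j jk.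
exact: le_trans (iterDiff_le_jet f x jk) (H x Kx).
Qed.

(** Seminorm balls are directed, since seminorms increase with the compact set
    and the order; the finite intersections in the definition of the topology
    can thus be avoided. *)
Definition basic_nbhs f : set_system C := [set A | exists K k e,
  [/\ compact K, K `<=` X, inN p k, 0 < e & [set g | Cseminorm K k (g - f) < e] `<=` A]].

Lemma basic_nbhs_filter f : Filter (basic_nbhs f).
Proof.
split.
- exists set0, 0, 1; split => //; first exact: compact0.
  by case: p.
- move=> A B [K [k [e [cK KX pk e0 KA]]]] [K' [k' [e' [cK' K'X pk' e'0 KB]]]].
  exists (K `|` K'), (maxn k k'), (Num.min e e').
  have cU := compactU cK cK'.
  have UX : K `|` K' `<=` X by move=> x []; [exact: KX|exact: K'X].
  have pm := inN_max pk pk'.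
  split => //; first by rewrite lt_min e0.
  move=> g /=; rewrite lt_min => /andP[ge ge']; split.
    apply: KA => /=; apply: le_lt_trans ge; apply: seminorm_mono => //.
    exact: leq_maxl.
  apply: KB => /=; apply: le_lt_trans ge'; apply: seminorm_mono => //.
  exact: leq_maxr.
- move=> A B AB [K [k [e [cK KX pk e0 KA]]]]; exists K, k, e; split => //.
  exact: subset_trans AB.
Qed.

Lemma Cball_open K k e f : compact K -> K `<=` X -> inN p k -> 0 < e ->
  open [set g : C | Cseminorm K k (g - f) < e].
Proof.
move=> cK KX pk e0.
exists [set [set g : C | Cseminorm K k (g - f) < e]]; last by rewrite bigcup_set1.
move=> _ ->; exists (fset1 (f, K, k, e)); last by rewrite set_fset1 bigcap_set1.
by move=> i /fset1P ->; rewrite inE.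
Qed.

Lemma Cspace_nbhsE f : nbhs f = basic_nbhs f.
Proof.
apply/seteqP; split=> A; last first.
  move=> [K [k [e [cK KX pk e0 KA]]]]; rewrite nbhsE; exists [set g : C | Cseminorm K k (g - f) < e] => //.
  split; first exact: Cball_open.
  by rewrite /= subrr seminorm0.
rewrite nbhsE => -[B [[D sD BE] Bf] BA].
have FF := basic_nbhs_filter f.
apply: (filterS BA); move: Bf; rewrite -BE => -[G DG Gf].
have /sD[I sI IE] := DG.
have : basic_nbhs f G; last first.
  by apply: filterS => g Gg; exists G.
move: Gf; rewrite -IE => Gf.
apply: filter_bigI => -[[[g K] k] e] /[dup] /sI; rewrite inE => -[cK KX pk e0] gI.
have /= fg := Gf _ gI.
exists K, k, (e - Cseminorm K k (f - g)).
split; [exact: cK|exact: KX|exact: pk|by rewrite subr_gt0|].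
move=> g' gg'; have {}gg' : Cseminorm K k (g' - f) < e - Cseminorm K k (f - g) := gg'.
have le : Cseminorm K k (g' - g) <= Cseminorm K k (g' - f) + Cseminorm K k (f - g).
  by have := seminormD (g' - f) (f - g) cK KX pk; rewrite subrKA.
rewrite ltrBrDr in gg'.
exact: le_lt_trans le gg'.
Qed.

Lemma Cspace_nbhsP f (A : set C) : nbhs f A <-> exists K k e,
  [/\ compact K, K `<=` X, inN p k, 0 < e & [set g | Cseminorm K k (g - f) < e] `<=` A].
Proof. by rewrite Cspace_nbhsE. Qed.

Lemma Cspace_ball_nbhs f K k e : compact K -> K `<=` X -> inN p k -> 0 < e ->
  nbhs f [set g : C | Cseminorm K k (g - f) < e].
Proof.
move=> cK KX pk e0; rewrite Cspace_nbhsE; exists K, k, e.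
by split; [exact: cK|exact: KX|exact: pk|exact: e0|].
Qed.

(** The finite nets through which compactness yields the equicontinuity in
    [compact_family_norm_continuous]. *)
Lemma compact_totally_bounded (A : set C) K k e : compact A ->
  compact K -> K `<=` X -> inN p k -> 0 < e ->
  exists s : seq C, forall f, A f -> exists2 g, g \in s & Cseminorm K k (f - g) < e.
Proof.
rewrite compact_cover => cA cK KX pk e0.
have [| |D _ AD] := cA C setT (fun g : C => [set f : C | Cseminorm K k (f - g) < e]).
- by move=> g _; exact: Cball_open.
- by move=> f _; exists f => //=; rewrite subrr seminorm0.
- by exists D => f /AD[g gD fg]; exists g.
Qed.

Lemma eval_continuous k x : inN p k -> X x -> continuous (fun f : C => iterDiff k f x).
Proof.
move=> pk Xx f; apply/(@cvgrPdist_le _ _ _ (nbhs f) (nbhs_filter f)) => e e0.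
have KX : [set x] `<=` X by move=> _ ->.
apply: (@filterS _ (nbhs f) (nbhs_filter f) _ _ _
  (Cspace_ball_nbhs f (@compact_set1 _ x) KX pk e0)).
move=> g /= fg; rewrite distrC.
have -> : iterDiff k g x - iterDiff k f x = iterDiff k (g - f : C) x.
  have -> : g - f = -1 *: f + g by rewrite scaleN1r addrC.
  by rewrite iterDiff_Cspace_lin// scaleN1r addrC.
by apply: le_trans (ltW fg); apply: (seminorm_ge _ (@compact_set1 _ x)).
Qed.

Lemma compact_eval_bounded (A : set C) k x : compact A -> inN p k -> X x ->
  exists M, forall f, A f -> `|iterDiff k f x| <= M.
Proof.
move=> cA pk Xx.
have ctn : {within A, continuous (fun f : C => iterDiff k f x)}.
  by apply: continuous_subspaceT; exact: eval_continuous.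
have /compact_bounded[M [_ HM]] := continuous_compact ctn cA.
exists (`|M| + 1) => f Af; apply: (HM (`|M| + 1)).
  by rewrite (le_lt_trans (ler_norm _))// ltrDl.
by exists f.
Qed.

Lemma Cspace_add_continuous : continuous (fun z : C * C => z.1 + z.2).
Proof.
move=> [f g] A /= /Cspace_nbhsP[K [k [e [cK KX pk e0 KA]]]].
have e2 : 0 < e / 2 by rewrite divr_gt0.
exists ([set f' | Cseminorm K k (f' - f) < e / 2], [set g' | Cseminorm K k (g' - g) < e / 2]).
  by split; exact: Cspace_ball_nbhs.
move=> [f' g'] /= [ff' gg']; apply: KA => /=.
rewrite opprD addrACA (le_lt_trans (seminormD _ _ cK KX pk))// [e]splitr.
exact: ltrD.
Qed.

Lemma compact_add (A B : set C) : compact A -> compact B ->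
  compact [set h | exists f g, [/\ A f, B g & h = f + g]].
Proof.
move=> cA cB.
have -> : [set h | exists f g, [/\ A f, B g & h = f + g]] =
    (fun z : C * C => z.1 + z.2) @` (A `*` B).
  apply/seteqP; split=> [_ [f [g [Af Bg ->]]]|_ [[f g] [/= Af Bg] <-]].
    by exists (f, g).
  by exists f, g.
apply: continuous_compact; last exact: compact_setX.
by apply: continuous_subspaceT; exact: Cspace_add_continuous.
Qed.

End CspaceBasics.

(** * Operators between spaces of smooth functions *)
Section CspaceLinear.
Context (R : realType) (V W V' W' : normedModType R) (p q : option nat).
Context (X : set V) (oX : open X) (Y : set V') (oY : open Y).

Definition bounded_operator (L : Cspace p oX W -> Cspace q oY W') : Prop :=
  linear L /\ forall K m, compact K -> K `<=` Y -> inN q m ->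
    exists K' k c, [/\ compact K', K' `<=` X, inN p k &
      forall f, Cseminorm K m (L f) <= c * Cseminorm K' k f].

Lemma bounded_operator_continuous L : bounded_operator L -> continuous L.
Proof.
move=> [Ll LC] f A /Cspace_nbhsP[K [m [e [cK KY qm e0 KA]]]].
have [K' [k [c [cK' K'X pk Lc]]]] := LC K m cK KY qm.
have c1 : 0 < `|c| + 1 by rewrite ltr_wpDl.
apply: (@filterS _ (nbhs f) (nbhs_filter f) _ _ _
  (Cspace_ball_nbhs f cK' K'X pk (divr_gt0 e0 c1))).
move=> g /= gf; apply: KA => /=.
have -> : L g - L f = L (g - f).
  have E := Ll (-1) f g; rewrite !scaleN1r in E.
  by rewrite [L g - _]addrC [g - f]addrC; exact: esym E.
apply: (le_lt_trans (Lc _)); move: gf; rewrite ltr_pdivlMr// mulrC; apply: le_lt_trans.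
rewrite ler_wpM2r ?seminorm_ge0// (le_trans (ler_norm _))// lerDl//.
Qed.

Lemma compact_image L (A : set (Cspace p oX W)) : bounded_operator L -> compact A ->
  compact (L @` A).
Proof.
move=> Lb; apply: continuous_compact; apply: continuous_subspaceT.
exact: bounded_operator_continuous.
Qed.

End CspaceLinear.

Section Multiplication.
Context (R : realType) (V W : normedModType R) (p : option nat) (X : set V).
Context (oX : open X).
Local Notation C := (Cspace p oX W).

Definition smul (g : V -> R^o) (f : C) : C := ofC p oX (fun x => g x *: f x).

Lemma smulE g (f : C) x : is_C p X g -> smul g f x = g x *: f x.
Proof.
move=> gC; have [Xx|nX] := pselect (X x); last by rewrite !Cspace_out// scaler0.
by rewrite ofCE//; apply: is_C_scale => //; exact: Cspace_is_C.
Qed.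

Lemma jet_bounded_on_compact (g : V -> W) K k : is_C p X g -> compact K -> K `<=` X ->
  inN p k -> exists2 c, 0 <= c & forall x, K x -> jet_norm 1 k g x <= c.
Proof.
move=> gC cK KX pk; pose g' : C := ofC p oX g.
exists (k.+1%:R * Cseminorm K k g'); first by rewrite mulr_ge0 ?seminorm_ge0.
move=> x Kx; apply: le_trans (jet_le_seminorm g' cK KX pk Kx).
rewrite le_eqVlt; apply/orP; left; apply/eqP; apply: eq_bigr => j _.
rewrite (iterDiff_eq (g := g') oX gC)//; last exact: KX.
- by move=> y Xy; rewrite ofCE.
- by apply: inN_le pk _; rewrite -ltnS.
Qed.

End Multiplication.

Section Operators.
Context (R : realType) (V W : normedModType R) (p : option nat) (X : set V).
Context (oX : open X).
Local Notation C := (Cspace p oX W).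

Lemma smul_bounded (g : V -> R^o) : is_C p X g -> bounded_operator (@smul R V W p X oX g).
Proof.
move=> gC; split.
  move=> a f f'; apply: Cspace_ext => x Xx.
  by rewrite Cspace_lin !smulE// Cspace_lin scalerDr !scalerA mulrC.
move=> K m cK KX pm; have [c c0 gc] := jet_bounded_on_compact oX gC cK KX pm.
exists K, m, (3 ^+ m * c * m.+1%:R); split=> // f.
have P0 : 0 <= 3 ^+ m * c by rewrite mulr_ge0 ?exprn_ge0.
apply: seminorm_le_jet; first by rewrite !mulr_ge0 ?seminorm_ge0 ?exprn_ge0.
move=> x Kx; have Xx := KX _ Kx.
have -> : jet_norm 1 m (smul g f) x = jet_norm 1 m (fun x => g x *: f x) x.
  apply: eq_bigr => j _; congr (_ * `|_|); apply: (iterDiff_eq (p := p) oX) => //.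
  - exact: Cspace_is_C.
  - by move=> y _; rewrite smulE.
  - by apply: inN_le pm _; rewrite -ltnS.
rewrite (le_trans (jet_norm_scale oX gC (Cspace_is_C f) pm ler01 Xx))//.
rewrite -[leRHS]mulrA; apply: ler_pM; rewrite ?mulr_ge0 ?jet_norm_ge0 ?exprn_ge0//.
  by rewrite ler_wpM2l ?exprn_ge0// gc.
exact: jet_le_seminorm.
Qed.

Lemma scale_bounded (a : R) : bounded_operator (fun f : C => a *: f).
Proof.
split; first by move=> b f g; rewrite scalerDr !scalerA mulrC.
by move=> K m cK KX pm; exists K, m, `|a|; split=> // f; exact: seminormZ.
Qed.

Lemma compact_shift (A : set C) (f0 : C) : compact A ->
  exists2 B, compact B & forall f, A f -> B (f + f0).
Proof.
move=> cA; exists [set h | exists f g, [/\ A f, [set f0] g & h = f + g]].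
  by apply: compact_add => //; exact: compact_set1.
by move=> f Af; exists f, f0.
Qed.

Lemma compact_dilate (A : set C) (a : R) : compact A ->
  exists2 B, compact B & forall f, A f -> B (a *: f).
Proof.
move=> cA; exists ((fun f => a *: f) @` A); last by move=> f Af; exists f.
by apply: compact_image => //; exact: scale_bounded.
Qed.

End Operators.

Section Restriction.
Context (R : realType) (V W : normedModType R) (p : option nat) (X X' : set V).
Context (oX : open X) (oX' : open X').
Hypothesis X'X : X' `<=` X.

Definition restrictC (f : Cspace p oX W) : Cspace p oX' W := ofC p oX' f.

Lemma restrictCE f x : X' x -> restrictC f x = f x.
Proof.
move=> X'x; rewrite ofCE//; apply: (is_C_sub oX) => //; exact: Cspace_is_C.
Qed.

Lemma restrictC_bounded : bounded_operator restrictC.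
Proof.
split.
  move=> a f g; apply: Cspace_ext => x X'x.
  by rewrite Cspace_lin !restrictCE// Cspace_lin.
move=> K m cK KX' pm; exists K, m, 1.
have KX : K `<=` X by exact: subset_trans X'X.
split=> // f; rewrite mul1r; apply: seminorm_le; first exact: seminorm_ge0.
move=> x Kx j jm.
rewrite (iterDiff_eq (g := f) oX' (Cspace_is_C _))//; last first.
- exact: KX'.
- exact: inN_le jm.
- by move=> y X'y; exact: restrictCE.
exact: seminorm_ge.
Qed.

End Restriction.

Section CompactOperator.
Context (R : realType) (V H E F : normedModType R) (p : option nat) (q : nat).
Context (X : set V) (oX : open X) (Y : set H) (oY : open Y).
Context (T : {linear Cspace p oX E -> Cspace (Some q) oY F}).

(** The neighbourhood witnessing compactness contains a translate of a
    seminorm ball, and translating back keeps the image in a compact set. *)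
Lemma compact_operator_ball : compact_map T ->
  exists K l d A, [/\ compact K, K `<=` X, inN p l & 0 < d] /\
    (compact A /\ forall f, Cseminorm K l f < d -> A (T f)).
Proof.
move=> [U [oU [u0 Uu0] [B TUB [cB _]]]].
have /Cspace_nbhsP[K [l [d [cK KX pl d0 KU]]]] : nbhs u0 U by exact: open_nbhs_nbhs.
have [A cA BA] := compact_shift (- T u0) cB.
exists K, l, d, A; split; first by split.
split=> // f fd; have -> : T f = T (u0 + f) - T u0.
  by rewrite linearD addrC addKr.
apply: BA; apply: TUB; exists (u0 + f) => //; apply: KU => /=.
by rewrite addrC addKr.
Qed.

Section Ball.
Variables (K : set V) (l : nat) (d : R) (A : set (Cspace (Some q) oY F)).
Hypotheses (cK : compact K) (KX : K `<=` X) (pl : inN p l) (d0 : 0 < d).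
Hypotheses (cA : compact A) (TA : forall f, Cseminorm K l f < d -> A (T f)).

Lemma compact_operator_le c : exists2 B, compact B &
  forall f, Cseminorm K l f <= c -> B (T f).
Proof.
pose a := d / (2 * (`|c| + 1)).
have c1 : 0 < `|c| + 1 by rewrite ltr_wpDl.
have a0 : 0 < a by rewrite divr_gt0// mulr_gt0.
have [B cB AB] := compact_dilate a^-1 cA; exists B => // f fc.
rewrite -(scale1r f) -(mulVf (lt0r_neq0 a0)) -scalerA linearZ; apply: AB; apply: TA.
rewrite (le_lt_trans (seminormZ _ _ cK KX pl))// gtr0_norm//.
apply: (@le_lt_trans _ _ (a * (`|c| + 1))).
  by rewrite ler_wpM2l ?(ltW a0)// (le_trans fc)// (le_trans (ler_norm _))// lerDl.
rewrite /a (_ : d / (2 * (`|c| + 1)) * (`|c| + 1) = d / 2).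
  by rewrite ltr_pdivrMr// ltr_pMr// ltr1n.
by field; rewrite lt0r_neq0.
Qed.

(** Values at [y] are bounded on the compact set containing the image of a
    ball; homogeneity turns this into a bound by the seminorm. The room [eta]
    covers functions of seminorm 0. *)
Lemma compact_operator_eval y : Y y ->
  exists2 M, 0 <= M & forall f, `|T f y| <= M * Cseminorm K l f.
Proof.
move=> Yy; have [M HM] := compact_eval_bounded cA (isT : inN (Some q) 0) Yy.
have M0 : 0 <= M.
  have A0 : A (T 0) by apply: TA; rewrite seminorm0.
  exact: le_trans (normr_ge0 _) (HM _ A0).
exists (2 * M / d) => [|f]; first by rewrite mulr_ge0 ?invr_ge0 ?(ltW d0)// mulr_ge0.
apply/ler_addgt0Pr => e e0.
set s := Cseminorm K l f.
have s0 : 0 <= s by exact: seminorm_ge0.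
pose eta := e * d / (2 * M + 1).
have M1 : 0 < 2 * M + 1 by rewrite ltr_wpDl// mulr_ge0.
have eta0 : 0 < eta by rewrite divr_gt0// mulr_gt0.
pose a := d / (2 * (s + eta)).
have se : 0 < s + eta by rewrite ltr_wpDl.
have a0 : 0 < a by rewrite divr_gt0// mulr_gt0.
have af : Cseminorm K l (a *: f) < d.
  rewrite (le_lt_trans (seminormZ _ _ cK KX pl))// gtr0_norm// -/s.
  apply: (@le_lt_trans _ _ (a * (s + eta))).
    by rewrite ler_wpM2l ?(ltW a0)// lerDl ltW.
  rewrite /a (_ : d / (2 * (s + eta)) * (s + eta) = d / 2).
    by rewrite ltr_pdivrMr// ltr_pMr// ltr1n.
  by field; rewrite lt0r_neq0.
have := HM _ (TA af); rewrite linearZ [iterDiff 0 _ _]/=.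
rewrite norm_symform0 -[X in `|X|]/(a *: T f y) normrZ gtr0_norm//.
rewrite -ler_pdivlMl// => /le_trans; apply.
rewrite /a (_ : (d / (2 * (s + eta)))^-1 * M = 2 * M / d * s + 2 * M * eta / d); last first.
  by field; rewrite !lt0r_neq0.
rewrite lerD2l /eta.
have -> : 2 * M * (e * d / (2 * M + 1)) / d = e * (2 * M / (2 * M + 1)).
  by field; rewrite !lt0r_neq0.
by rewrite ler_piMr ?(ltW e0)// ler_pdivrMr// mul1r lerDl.
Qed.

End Ball.
End CompactOperator.

(** * Locality at the support point *)
Section SupportMap.
Context (R : realType) (V H E F : normedModType R) (p q : option nat).
Context (X : set V) (oX : open X) (Y : set H) (oY : open Y).
Context (T : Cspace p oX E -> Cspace q oY F) (h : H -> V).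
Local Notation cpt := (set_type (@support_cpt R V p X oX)).

Let value_at (psi : Cspace p oX R^o) (z : cpt) : one_point_compactification R^o :=
  (set_val z) psi.

Let value_continuous psi : continuous (value_at psi).
Proof.
move=> z; apply: (@continuous_comp _ _ _ (set_val : cpt -> _)
  (@proj _ (fun _ => one_point_compactification R^o) psi)).
  exact: initial_continuous.
exact: proj_continuous.
Qed.

Let open_value psi (A : set R^o) : open A -> open (value_at psi @^-1` (Some @` A)).
Proof.
move=> oA; apply: open_comp; first by move=> z _; exact: value_continuous.
exact: one_point_compactification_open_some.
Qed.

Let nbhs_some_neq (w : one_point_compactification R^o) :
  w <> Some 0 -> nbhs w (fun v => v <> Some 0).
Proof.
case: w => [r|_].
  move=> r0; have r0' : r != 0 by apply/eqP => rE; apply: r0; rewrite rE.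
  apply: (filterS _ (@one_point_compactification_some_nbhs R^o r [set s : R^o | s != 0] _)).
    by move=> _ [s /eqP s0 <-] [].
  by apply: open_nbhs_nbhs; split=> //; exact: open_neq.
exists [set 0]; first by split; [exact: compact_set1|exact: closed_eq].
by move=> _ [[s s0 <-] [sE]|->//]; apply: s0; rewrite sE.
Qed.

(** If [T f y] were not 0, the set where [psi < 1/2] in the compactification
    would be an admissible neighbourhood of the support of [f], as [psi = 0]
    there; but its closure avoids [h y], where [psi = 1]. *)
Lemma support_map_local y (f : Cspace p oX E) (psi : Cspace p oX R^o) : is_support_map T h -> Y y -> psi (h y) = 1 ->
  (forall x, X x -> f x <> 0 -> psi x = 0) -> T f y = 0.
Proof.
move=> hT Yy psi1 fpsi; apply: contrapT => Tfy.
have [Xhy hE] := hT y Yy.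
(* a neighbourhood of the closed support of [f] whose closure avoids [h y] *)
pose U := value_at psi @^-1` (Some @` [set r : R^o | r < 2^-1]).
have oU : open U by apply: open_value; exact: open_lt.
have fU : csupport f `<=` U.
  move=> z; rewrite /csupport => zf.
  have z0 : value_at psi z = Some 0.
    apply: contrapT => /nbhs_some_neq zn.
    have [z' [[x [Xx fx] xz'] z'0]] := zf _ (value_continuous zn).
    by apply: z'0; rewrite /value_at -xz' /support_emb fpsi.
  by rewrite /U /preimage /= z0; exists 0 => //=; rewrite invr_gt0.
have nU : support_nbhs T y U by split=> //; exists f; split.
have z0P : support_cpt (@support_emb R V p X oX (h y)).
  by apply: subset_closure; exists (h y).
pose z0 : cpt := SigSub (mem_set z0P).
have : (\bigcap_(U in support_nbhs T y) closure U) z0 by rewrite hE.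
move=> /(_ _ nU) /(_ (value_at psi @^-1` (Some @` [set r : R^o | 2^-1 < r]))).
case.
  apply: open_nbhs_nbhs; split; first by apply: open_value; exact: open_gt.
  exists 1; first by rewrite /= invf_lt1// ltr1n.
  have -> : value_at psi z0 = Some (psi (h y)) by rewrite /value_at set_valE.
  by rewrite psi1.
move=> z [[r rlt rE] [s sgt sE]].
have [rs] : Some r = Some s :> option R by rewrite rE sE.
by move: rlt sgt => /= rlt; rewrite -rs ltNge (ltW rlt).
Qed.

End SupportMap.

Lemma open_far (R : realType) (V : normedModType R) (a : V) (r : R) :
  open [set x : V | r < `|x - a|].
Proof.
apply: (@open_comp _ _ (fun x : V => `|x - a|) [set t : R | r < t]); last exact: open_gt.
by move=> z _; apply: cvg_norm; apply: cvgB; [exact: cvg_id|exact: cvg_cst].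
Qed.

Section BumpAt.
Context (R : realType) (n : nat).
Local Notation V := 'rV[R]_n.

Definition bump_at (r : R) (x0 x : V) : R^o := @smooth_bump R n (r^-1 *: (x - x0)).

Lemma is_C_bump_at p X r x0 : open X -> is_C p X (bump_at r x0).
Proof.
move=> oX; have [bC _] := is_C_affine r^-1 x0 (@is_C_smooth_bump R n).
apply: (is_C_sub openT) => //; exact: is_C_le bC.
Qed.

Lemma bump_at_far r x0 x : 0 < r -> r <= `|x - x0| -> bump_at r x0 x = 0.
Proof.
move=> r0 rx; apply: smooth_bump_eq0; rewrite normrZ gtr0_norm ?invr_gt0//.
by rewrite ler_pdivlMl// mulr1.
Qed.

Lemma bump_at_near r x0 : 0 < r ->
  exists2 s, 0 < s & forall x, `|x - x0| <= s -> bump_at r x0 x = 1.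
Proof.
move=> r0; have [s s0 Hs] := @smooth_bump_eq1 R n; exists (r * s); first exact: mulr_gt0.
move=> x xs; apply: Hs; rewrite normrZ gtr0_norm ?invr_gt0//.
by rewrite ler_pdivrMl.
Qed.

Lemma bump_at_center r x0 : 0 < r -> bump_at r x0 x0 = 1.
Proof.
by move=> r0; have [s s0] := bump_at_near x0 r0; apply; rewrite subrr normr0 ltW.
Qed.

(** Scaling invariance: with weight [r] the jets of a bump of radius [r] are
    bounded independently of [r]. *)
Lemma bump_at_jet k : exists2 c, 0 <= c & forall r x0 x, 0 < r ->
  jet_norm r k (bump_at r x0) x <= c.
Proof.
have [c Hc] := @smooth_bump_jet_bounded R n k; exists c.
  by apply: le_trans (Hc 0); exact: jet_norm_ge0.
move=> r x0 x r0; have [_ bJ] := is_C_affine r^-1 x0 (@is_C_smooth_bump R n).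
apply: (le_trans (bJ k r x isT (ltW r0))).
by rewrite gtr0_norm ?invr_gt0// mulfV ?Hc// gt_eqF.
Qed.

End BumpAt.

Section RowSupport.
Context (R : realType) (n : nat) (H E F : normedModType R) (p q : option nat).
Local Notation V := 'rV[R]_n.
Context (X : set V) (oX : open X) (Y : set H) (oY : open Y).
Context (T : {linear Cspace p oX E -> Cspace q oY F}) (h : H -> V).
Hypothesis hT : is_support_map T h.

Lemma vanish_near (f : Cspace p oX E) y r : Y y -> 0 < r ->
  (forall x, X x -> `|x - h y| < r -> f x = 0) -> T f y = 0.
Proof.
move=> Yy r0 f0; have [Xhy _] := hT Yy.
have bC := @is_C_bump_at R n p X r (h y) oX.
apply: (support_map_local (psi := ofC p oX (bump_at r (h y))) hT Yy).
  by rewrite ofCE// bump_at_center.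
move=> x Xx fx; rewrite ofCE// bump_at_far// leNgt; apply/negP => xr.
by apply: fx; exact: f0.
Qed.

Lemma agree_near (f g : Cspace p oX E) y r : Y y -> 0 < r ->
  (forall x, X x -> `|x - h y| < r -> f x = g x) -> T f y = T g y.
Proof.
move=> Yy r0 fg; apply/eqP; rewrite -subr_eq0; apply/eqP.
have -> : T f y - T g y = T (f - g) y by rewrite linearB.
apply: (vanish_near Yy r0) => x Xx xr.
by rewrite -[LHS]/(f x - g x) fg// subrr.
Qed.

Definition localize (r : R) (x0 : V) (f : Cspace p oX E) := smul (bump_at r x0) f.

Lemma localize_T f y r : Y y -> 0 < r -> T (localize r (h y) f) y = T f y.
Proof.
move=> Yy r0; have [s s0 bs] := bump_at_near (h y) r0.
apply: (agree_near Yy s0) => x Xx xs.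
by rewrite smulE ?bs ?scale1r ?(ltW xs)//; exact: is_C_bump_at.
Qed.

Lemma localize_far f r x0 x : 0 < r -> r <= `|x - x0| -> localize r x0 f x = 0.
Proof.
move=> r0 rx; rewrite smulE; last exact: is_C_bump_at.
by rewrite bump_at_far// scale0r.
Qed.

(** Localize near [h y] a function on which [T] does not vanish at [y]. By
    continuity [T] does not vanish on it at the points [z] near [y], so [h z]
    stays close to the support of the bump. *)
Lemma support_map_continuous y : nowhere_trivial T -> Y y -> {for y, continuous h}.
Proof.
move=> nt Yy; have [f fy] := nt y Yy.
apply/cvgrPdist_le => e e0.
have fc : {for y, continuous (T (localize e (h y) f))}.
  exact: (is_C_cont oY (Cspace_is_C _) Yy).
have Tn : T (localize e (h y) f) y != 0 by rewrite localize_T//; exact/eqP.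
near=> z.
have Yz : Y z by near: z; exact: open_nbhs_nbhs.
have Tz : T (localize e (h y) f) z != 0.
  by near: z; have /cvgr_neq0/(_ Tn) := fc.
rewrite leNgt; apply/negP => ez; move/eqP: Tz; apply.
pose r := `|h y - h z| - e.
have r0 : 0 < r by rewrite subr_gt0.
apply: (vanish_near Yz r0) => x Xx xr; apply: localize_far => //.
have : `|h y - h z| <= `|h z - x| + `|x - h y|.
  by rewrite [leLHS]distrC -(subrKA x) ler_normD.
by rewrite (distrC (h z)); move: xr; rewrite /r; lra.
Unshelve. all: by end_near. Qed.

Section Bounded.
Variables (K : set V) (l : nat).
Hypotheses (cK : compact K) (KX : K `<=` X) (pl : inN p l).
Hypothesis T_le : forall y, Y y -> exists2 M, 0 <= M &
  forall f, `|T f y| <= M * Cseminorm K l f.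

(** A function localized away from [K] has seminorm 0, hence image 0. *)
Lemma support_map_in : nowhere_trivial T -> forall y, Y y -> K (h y).
Proof.
move=> nt y Yy; apply: contrapT => Khy.
have [f fy] := nt y Yy; have [M M0 TM] := T_le Yy.
have cl : closed K by apply: compact_closed cK; exact: norm_hausdorff.
have : nbhs (h y) (~` K) by apply: open_nbhs_nbhs; split=> //; exact: closed_openC.
move=> /nbhs_ballP[r /= r0 rK].
have r2 : 0 < r / 2 by rewrite divr_gt0.
apply: fy; rewrite -(localize_T f Yy r2).
apply/eqP; rewrite -normr_le0 (le_trans (TM _))//.
suff : Cseminorm K l (localize (r / 2) (h y) f) <= 0.
  by move=> h0; rewrite mulr_ge0_le0.
apply: seminorm_le => // x Kx j jl.
rewrite (@iterDiff_zero_near _ _ _ [set x | r / 2 < `|x - h y|]) ?normr0//.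
- exact: open_far.
- by move=> z /= /ltW; exact: localize_far.
- rewrite /= ltNge; apply/negP => xr; apply: (rK x) => //.
  rewrite -ball_normE /= distrC (le_lt_trans xr)//.
  by rewrite ltr_pdivrMr// ltr_pMr// ltr1n.
Qed.

(** Shrink the radius [r] of a bump multiplying [f]: with weight [r] the jet
    of the product at points within [r] of [h y] is at most a constant times
    [d * r ^+ l], so its derivatives of order at most [l] are at most that
    constant times [d]. *)
Lemma vanish_jets (f : Cspace p oX E) y : Y y -> (forall j, (j <= l)%N -> iterDiff j f (h y) = 0) ->
  T f y = 0.
Proof.
move=> Yy f0; have [M M0 TM] := T_le Yy; have [Xhy _] := hT Yy.
have [c c0 bc] := @bump_at_jet R n l.
apply/eqP; rewrite -normr_le0; apply/ler_addgt0Pr => e e0; rewrite add0r.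
pose P := M * (3 ^+ l * c) + 1.
have P0 : 0 < P by rewrite ltr_wpDl// !mulr_ge0// exprn_ge0.
(* small enough to beat the norm of evaluation and the product constant *)
pose d := e / P.
have d0 : 0 < d by rewrite divr_gt0.
have fC := is_C_order (Cspace_is_C f) pl.
have [r0 r00 rf] := small_jets oX Xhy fC f0 d0.
pose r := Num.min r0 1.
have rp : 0 < r by rewrite lt_min r00 ltr01.
have r1 : r <= 1 by rewrite ge_min lexx orbT.
have rr0 : r <= r0 by rewrite ge_min lexx.
rewrite -(localize_T f Yy rp).
suff H0 : Cseminorm K l (localize r (h y) f) <= 3 ^+ l * c * d.
  rewrite (le_trans (TM _))// (le_trans (ler_wpM2l M0 H0))// mulrA.
  by rewrite /d mulrCA ler_piMr ?(ltW e0)// ler_pdivrMr// mul1r lerDl.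
have B0 : 0 <= 3 ^+ l * c * d by rewrite mulr_ge0 ?(ltW d0)// mulr_ge0 ?exprn_ge0.
apply: seminorm_le => // x Kx j jl; have Xx := KX Kx.
have [xr|xr] := ltP r `|x - h y|.
  rewrite (@iterDiff_zero_near _ _ _ [set x | r < `|x - h y|]) ?normr0//.
    exact: open_far.
  by move=> z /= /ltW; exact: localize_far.
have [_ Jx] := rf r x rp rr0 xr.
have bC := @is_C_bump_at R n p X r (h y) oX.
have J1 := jet_norm_scale oX bC (Cspace_is_C f) pl (ltW rp) Xx.
have J2 : jet_norm r l (localize r (h y) f) x <= 3 ^+ l * c * d * r ^+ l.
  have -> : jet_norm r l (localize r (h y) f) x =
      jet_norm r l (fun x => bump_at r (h y) x *: f x) x.
    apply: eq_bigr => i _; congr (_ * `|_|); apply: (iterDiff_eq (p := p) oX) => //.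
    - exact: Cspace_is_C.
    - by move=> z _; rewrite smulE.
    - by apply: inN_le pl _; rewrite -ltnS.
  rewrite (le_trans J1)// -[leRHS]mulrA; apply: ler_pM => //.
  - by rewrite mulr_ge0 ?exprn_ge0 ?jet_norm_ge0// ltW.
  - by rewrite jet_norm_ge0// ltW.
  - by rewrite ler_wpM2l ?exprn_ge0// bc.
rewrite -(ler_pM2r (exprn_gt0 l rp)); apply: le_trans J2.
rewrite mulrC; apply: (@le_trans _ _ (r ^+ j * `|iterDiff j (localize r (h y) f) x|)).
  by rewrite ler_wpM2r// ler_wiXn2l// ltW.
have jl' : (j < l.+1)%N by [].
rewrite /jet_norm (bigD1 (Ordinal jl'))//= lerDl.
by apply: sumr_ge0 => i _; rewrite mulr_ge0// exprn_ge0// ltW.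
Qed.

End Bounded.
End RowSupport.

(** * Representation and regularity of the support map *)
Section CspaceSums.
Context (R : realType) (V W : normedModType R) (p : option nat) (X : set V).
Context (oX : open X).
Local Notation C := (Cspace p oX W).

Lemma Cspace_sumE (I : Type) (r : seq I) (P : pred I) (f : I -> C) x :
  (\sum_(i <- r | P i) f i) x = \sum_(i <- r | P i) f i x.
Proof.
by elim/big_rec2: _ => // i u v _ <-.
Qed.

Lemma iterDiff_Cspace_sum (I : Type) (r : seq I) (P : pred I) (a : I -> R)
    (f : I -> C) k x : inN p k -> X x ->
  iterDiff k (\sum_(i <- r | P i) a i *: f i) x =
  \sum_(i <- r | P i) a i *: iterDiff k (f i) x.
Proof.
move=> pk Xx; elim/big_rec2: _ => [|i u v _ <-]; first exact: iterDiff0.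
exact: iterDiff_Cspace_lin.
Qed.

End CspaceSums.

Section Representation.
Context (R : realType) (n : nat) (H E F : normedModType R) (p : option nat) (q : nat).
Local Notation V := 'rV[R]_n.
Context (X : set V) (oX : open X) (Y : set H) (oY : open Y).
Context (T : {linear Cspace p oX E -> Cspace (Some q) oY F}) (h : H -> V).
Hypothesis T_nowhere_trivial : nowhere_trivial T.
Hypothesis hT : is_support_map T h.
Variables (K : set V) (l : nat).
Hypotheses (cK : compact K) (KX : K `<=` X) (pl : inN p l).
Hypothesis T_le : forall y, Y y -> exists2 M, 0 <= M &
  forall f, `|T f y| <= M * Cseminorm K l f.

Definition jet_coef k (y : H) (S : symform k V E) : F :=
  (k`!%:R)^-1 *: T (ofC p oX (monomial S (h y))) y.

Lemma representation f y : Y y ->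
  T f y = \sum_(k < l.+1) jet_coef y (iterDiff k f (h y)).
Proof.
move=> Yy; have [Xhy _] := hT Yy; set t := h y.
pose m (k : 'I_l.+1) : Cspace p oX E := ofC p oX (monomial (iterDiff k f t) t).
pose g := f - \sum_(k < l.+1) (k`!%:R)^-1 *: m k.
have g0 : T g y = 0.
  apply: (vanish_jets hT KX pl T_le Yy) => j jl.
  have pj : inN p j by exact: inN_le jl.
  have -> : g = -1 *: (\sum_(k < l.+1) (k`!%:R)^-1 *: m k) + f by rewrite scaleN1r addrC.
  rewrite iterDiff_Cspace_lin// scaleN1r iterDiff_Cspace_sum// -/t.
  have mE (k : 'I_l.+1) : iterDiff j (m k) t = iterDiff j (monomial (iterDiff k f t) t) t.
    apply: (iterDiff_eq (p := p) oX) => //; first exact: Cspace_is_C.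
    by move=> x Xx; rewrite ofCE//; exact: is_C_monomial.
  have jl' : (j < l.+1)%N by [].
  rewrite (bigD1 (Ordinal jl'))//= mE big1 => [|k kj].
    have [-> _] := iterDiff_monomial (iterDiff j f t) t.
    by rewrite scalerA mulVf ?pnatr_eq0 -?lt0n ?fact_gt0// scale1r addr0 addNr.
  rewrite mE; have [_ ->] := iterDiff_monomial (iterDiff k f t) t.
    by rewrite scaler0.
  by apply: contra kj => /eqP jk; apply/eqP/val_inj.
have -> : f = g + \sum_(k < l.+1) (k`!%:R)^-1 *: m k by rewrite subrK.
rewrite linearD linear_sum -[LHS]/(T g y + (\sum_(k < l.+1) T ((k`!%:R)^-1 *: m k)) y).
rewrite g0 add0r Cspace_sumE; apply: eq_bigr => k _.
rewrite linearZ /jet_coef -/t; congr (_ *: T (ofC p oX (monomial _ t)) y).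
by rewrite subrK.
Qed.

Lemma support_coord_continuous j y : Y y ->
  {for y, continuous (fun y => coord j (h y))}.
Proof.
move=> Yy; apply: (@continuous_comp _ _ _ h (@coord R n j)).
  exact: (support_map_continuous hT T_nowhere_trivial Yy).
have cc := bounded_linear_cts (@coord_bounded R n j); by apply: cc.
Qed.

Section OneCoordinate.
Variable j : 'I_n.

Definition shifted_power (t : R) N (f : Cspace p oX E) :=
  smul (fun x => (coord j x - t) ^+ N) f.

Lemma is_C_shift (t : R) N r : is_C r X (fun x => (coord j x - t) ^+ N : R^o).
Proof.
apply: is_C_pow => //.
exact: (is_CD oX (@is_C_coord R n r X j oX) (@is_C_cst R V R^o r X (- t) oX)).
Qed.

Lemma is_C_coord_pow N r : is_C r X (fun x => coord j x ^+ N : R^o).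
Proof. by apply: is_C_pow => //; exact: is_C_coord. Qed.

Lemma shifted_power0 t f : shifted_power t 0 f = f.
Proof.
apply: Cspace_ext => x Xx; rewrite smulE; last exact: is_C_shift.
by rewrite expr0 scale1r.
Qed.

Lemma shifted_power_expand t N f y : T (shifted_power t N f) y =
  \sum_(i < N.+1) ('C(N, i)%:R * (- t) ^+ i) *: T (smul (fun x => coord j x ^+ (N - i)) f) y.
Proof.
have -> : shifted_power t N f = \sum_(i < N.+1)
    ('C(N, i)%:R * (- t) ^+ i) *: smul (fun x => coord j x ^+ (N - i)) f.
  apply: Cspace_ext => x Xx; rewrite smulE; last exact: is_C_shift.
  rewrite Cspace_sumE exprDn scaler_suml; apply: eq_bigr => i _.
  rewrite -[RHS]/((_ * _) *: (smul _ _ x)) smulE; last exact: is_C_coord_pow.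
  by rewrite scalerA -mulr_natl; congr (_ *: _); ring.
by rewrite linear_sum Cspace_sumE; apply: eq_bigr => i _; rewrite linearZ.
Qed.

Lemma shifted_power_vanish f y : Y y -> T (shifted_power (coord j (h y)) l.+1 f) y = 0.
Proof.
move=> Yy; have [Xhy _] := hT Yy.
apply: (vanish_jets hT KX pl T_le Yy) => i il.
pose u x : R^o := coord j x - coord j (h y).
have uC : is_C (Some l) X u.
  exact: (is_CD oX (@is_C_coord R n _ X j oX) (@is_C_cst R V R^o _ X (- coord j (h y)) oX)).
have J0 : jet_norm 1 l (fun x => u x ^+ l.+1 *: f x) (h y) = 0.
  apply: (jet_vanish_pow oX Xhy uC); last by rewrite /u subrr.
  exact: is_C_order (Cspace_is_C f) pl.
apply/eqP; rewrite -normr_le0 -J0.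
rewrite (iterDiff_eq (p := p) (g := fun x => u x ^+ l.+1 *: f x) oX)//.
- exact: iterDiff_le_jet.
- exact: Cspace_is_C.
- by move=> x Xx; rewrite smulE//; exact: is_C_shift.
- exact: inN_le il.
Qed.

(** The exponent [a] exists because exponent 0 gives a nonzero value and
    exponent [l.+1] never does. The binomial formula turns the images of
    [(x_j - t) ^+ a.+1 f] into a polynomial in [t] with smooth coefficients;
    its derivative at [t = h_j y] is a multiple of the value for exponent
    [a]. *)
Lemma coord_regular_somewhere (O : set H) : open O -> O !=set0 -> O `<=` Y ->
  exists O', [/\ open O', O' !=set0, O' `<=` O &
    is_C (Some q) O' (fun y => coord j (h y) : R^o)].
Proof.
move=> oO O0 OY.
pose nz a := exists y f, O y /\ T (shifted_power (coord j (h y)) a f) y <> 0.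
(* the order of [T] in direction [j], seen from [O] *)
have [a [nza nza1]] : exists a, nz a /\ ~ nz a.+1.
  apply: contrapT => H0.
  have all a : nz a.
    elim: a => [|a IH]; last by apply: contrapT => na; apply: H0; exists a.
    have [y Oy] := O0; have [f fy] := T_nowhere_trivial (OY _ Oy).
    by exists y, f; rewrite shifted_power0.
  have [y [f [ Oy]]] := all l.+1; apply.
  exact: shifted_power_vanish (OY _ Oy).
have [y1 [f [ Oy1 fy1]]] := nza.
have [L Lb LE] := norming_functional (T (shifted_power (coord j (h y1)) a f) y1).
have Ll := Lb.1.
pose mom N y : R^o := L (T (smul (fun x => coord j x ^+ N) f) y).
have momC N r : (r <= q)%N -> is_C (Some r) Y (mom N).
  move=> rq; apply: is_C_postcomp => //.
  exact: (is_C_order (Cspace_is_C _) (rq : inN (Some q) r)).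
have Lexp t N y : L (T (shifted_power t N f) y) =
    \sum_(i < N.+1) 'C(N, i)%:R * (- t) ^+ i * mom (N - i)%N y.
  rewrite shifted_power_expand.
  have Lsum (I : Type) (s : seq I) (b : I -> R) (v : I -> F) :
      L (\sum_(i <- s) b i *: v i) = \sum_(i <- s) b i * L (v i).
    by elim: s => [|i s IH]; rewrite ?big_nil ?(lin0 Ll)// !big_cons Ll IH.
  exact: Lsum.
pose c i y : R^o := 'C(a.+1, i)%:R * (-1) ^+ i * mom (a.+1 - i)%N y.
pose hj y : R^o := coord j (h y).
have cs y : \sum_(i < a.+2) c i y * hj y ^+ i = L (T (shifted_power (hj y) a.+1 f) y).
  rewrite Lexp; apply: eq_bigr => i _; rewrite /c [in RHS]exprNn; ring.
have cd y : \sum_(i < a.+2) c i y * (hj y ^+ i.-1 *+ i) =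
    - (a.+1%:R * L (T (shifted_power (hj y) a f) y)).
  rewrite big_ord_recl mulr0n mulr0 add0r Lexp mulr_sumr -sumrN; apply: eq_bigr => i _.
  rewrite /= /c /bump /= add1n add0n subSS exprS [in RHS]exprNn -[_ *+ i.+1]mulr_natl.
  have EE := congr1 (fun k => k%:R : R) (mul_bin_diag a.+1 i).
  rewrite /= !natrM in EE.
  rewrite [LHS](_ : _ = - (i.+1%:R * 'C(a.+1, i.+1)%:R * (-1) ^+ i * mom (a - i)%N y * hj y ^+ i)); last by ring.
  by rewrite -EE; congr (- _); ring.
have hjc y : Y y -> {for y, continuous hj} by exact: support_coord_continuous.
pose w y : R^o := \sum_(i < a.+1) 'C(a, i)%:R * (- hj y) ^+ i * mom (a - i)%N y.
have wE y : w y = L (T (shifted_power (hj y) a f) y) by rewrite Lexp.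
have w1 : w y1 != 0.
  by rewrite wE LE normr_eq0; apply/eqP.
have hj0 : is_C (Some 0) Y hj by apply/is_C0P.
have wc : is_C (Some 0) Y w.
  have -> : w = \sum_(i < a.+1) (fun y => 'C(a, i)%:R * (- hj y) ^+ i * mom (a - i)%N y : R^o).
    by apply/funext => y; rewrite fct_sumE.
  apply: is_C_sum => // i _.
  apply: (is_C_scale oY (u := fun y => 'C(a, i)%:R * (- hj y) ^+ i)); last exact: momC.
  apply: (is_C_scale oY (u := fun=> 'C(a, i)%:R)); first exact: (@is_C_cst R H R^o _ Y _ oY).
  apply: is_C_pow => //.
  have := is_CZ (-1) oY hj0; apply: is_C_eq => // y _.
  by rewrite -[LHS]/(-1 *: hj y) scaleN1r.
have : nbhs y1 [set y | O y /\ w y != 0].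
  apply: filterI; first exact: open_nbhs_nbhs.
  by have /cvgr_neq0/(_ w1) := is_C_cont oY wc (OY _ Oy1).
rewrite nbhsE => -[ O' [oO' O'y1] O'sub].
have O'O : O' `<=` O by move=> y /O'sub [].
have O'Y : O' `<=` Y by exact: subset_trans OY.
exists O'; split=> //; first by exists y1.
apply: (@is_C_implicit R H q a.+2 O' c hj oO').
- move=> i; apply: (is_C_sub oY oO' O'Y).
  apply: (is_C_scale oY (u := fun=> 'C(a.+1, i)%:R * (-1) ^+ i)); last exact: momC.
  exact: (@is_C_cst R H R^o _ Y _ oY).
- by move=> y /O'Y; exact: hjc.
- move=> y O'y; rewrite cs; have -> : T (shifted_power (hj y) a.+1 f) y = 0.
    by apply: contrapT => N0; apply: nza1; exists y, f; split=> //; exact: O'O.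
  exact: lin0.
- move=> y O'y; rewrite cd oppr_eq0 mulf_neq0 ?pnatr_eq0// -wE.
  by have [] := O'sub _ O'y.
Qed.

End OneCoordinate.

Lemma support_regular_somewhere (O : set H) : open O -> O !=set0 -> O `<=` Y ->
  exists O', [/\ open O', O' !=set0, O' `<=` O & is_C (Some q) O' h].
Proof.
move=> oO O0 OY.
have [ O' [oO' O'0 O'O O'C]] : exists O', [/\ open O', O' !=set0, O' `<=` O &
    forall j, j \in enum 'I_n -> is_C (Some q) O' (fun y => coord j (h y) : R^o)].
  elim: (enum 'I_n) => [|j s [ O1 [oO1 O10 O1O O1C]]]; first by exists O; split=> // j; rewrite in_nil.
  have [ O2 [oO2 O20 O2O O2C]] := coord_regular_somewhere j oO1 O10 (subset_trans O1O OY).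
  exists O2; split=> //; first exact: subset_trans O1O.
  move=> i /[!inE] /predU1P[->//|si].
  by apply: (is_C_sub oO1 oO2 O2O); exact: O1C.
exists O'; split=> //.
have -> : h = \sum_(j < n) (fun y => coord j (h y) *: delta_mx ord0 j).
  by apply/funext => y; rewrite fct_sumE [LHS]row_sum_delta.
apply: is_C_sum => // j _; apply: is_C_scale => //; last exact: is_C_cst.
by apply: O'C; rewrite mem_enum.
Qed.

Definition regular_set : set H :=
  [set y | exists O, [/\ open O, O `<=` Y, O y & is_C (Some q) O h]].

Lemma regular_set_open : open regular_set.
Proof.
rewrite openE => y [ O [oO OY Oy OC]]; rewrite /interior nbhsE.
by exists O; [split|move=> z Oz; exists O].
Qed.

Lemma regular_set_sub : regular_set `<=` Y.
Proof. by move=> y [ O [_ OY Oy _]]; exact: OY. Qed.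

Lemma regular_set_dense : Y `<=` closure regular_set.
Proof.
move=> y Yy B By.
have : nbhs y (B `&` Y) by apply: filterI => //; exact: open_nbhs_nbhs.
rewrite nbhsE => -[ O [oO Oy] OBY].
have OY : O `<=` Y by move=> z /OBY [].
have [ O' [oO' [z O'z] O'O O'C]] := support_regular_somewhere oO (ex_intro _ y Oy) OY.
exists z; split; last by have [] := OBY z (O'O _ O'z).
by exists O'; split=> //; exact: subset_trans OY.
Qed.

Lemma regular_set_is_C : is_C (Some q) regular_set h.
Proof.
apply: is_C_local; first exact: regular_set_open.
by move=> y [ O [oO OY Oy OC]]; exists O.
Qed.

End Representation.

(** * Compact families of coefficients *)
Section CompactTopology.

Lemma compact_subtype (T : topologicalType) (X K : set T) : compact K -> K `<=` X ->
  compact (set_val @^-1` K : set X).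
Proof.
move=> cK KX G PG GK.
pose G' := (set_val : X -> T) @ G.
have [x [Kx xG]] := cK G' (fmap_proper_filter _ PG) GK.
pose z : X := SigSub (mem_set (KX _ Kx)).
exists z; split; first by rewrite /preimage /= set_valE.
move=> A N GA; rewrite nbhsE => -[B [[W oW WB] Bz] BN].
have GA' : G' (set_val @` A).
  by change (G (set_val @^-1` (set_val @` A))); apply: filterS GA => a Aa; exists a.
have Wx : nbhs x W.
  by apply: open_nbhs_nbhs; split=> //; move: Bz; rewrite -WB /preimage /= set_valE.
have [_ [[a Aa <-] Wa]] := xG _ _ GA' Wx.
by exists a; split=> //; apply: BN; rewrite -WB.
Qed.

Lemma closed_subtype (T : topologicalType) (X K : set T) : closed K ->
  closed (set_val @^-1` K : set X).
Proof. by move=> clK; apply: closed_comp => // x _; exact: initial_continuous. Qed.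

(** A proper filter not clustering at the limit lives on finitely many terms. *)
Lemma compact_sequence (T : topologicalType) (z : nat -> T) (y : T) :
  (forall B, nbhs y B -> exists N, forall n, (N <= n)%N -> B (z n)) ->
  compact ([set y] `|` range z).
Proof.
move=> zy G PG GK; have [yG|nyG] := pselect (cluster G y).
  by exists y; split=> //; left.
have [A [B [GA By AB]]] : exists A B, [/\ G A, nbhs y B & A `&` B = set0].
  apply: contrapT => H0; apply: nyG => A B GA By.
  by apply/set0P/eqP => AB; apply: H0; exists A, B.
have [N zB] := zy B By.
pose D := z @` [set i | (i < N)%N].
have cD : compact D.
  by apply: finite_compact; apply: finite_image; exact: finite_II.
have GD : G D.
  apply: filterS (filterI GA GK) => x [Ax [xy|[i _ zi]]].
    have : (A `&` B) x by split=> //; rewrite xy; exact: nbhs_singleton.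
    by rewrite AB.
  exists i => //=; rewrite ltnNge; apply/negP => Ni.
  have : (A `&` B) x by split=> //; rewrite -zi; exact: zB.
  by rewrite AB.
have [x [[i _ zi] xG]] := cD G PG GD.
by exists x; split=> //; right; exists i.
Qed.

End CompactTopology.

Section MonomialSplitting.
Context (R : realType) (n : nat) (E : normedModType R) (p : option nat).
Local Notation V := 'rV[R]_n.
Context (X : set V) (oX : open X).

Definition contr_at k (w : V) (S : symform k.+1 V E) : symform k V E := contr S w.

Lemma contr_at_bounded k (w : V) : bounded_linear (@contr_at k w).
Proof.
split; first by move=> a S S'; apply: symform_ext.
by exists `|w| => S; rewrite mulrC; exact: contr_le.
Qed.

(** One variable at a time: this separates the dependence on [t] from the
    dependence on [x], at the cost of contracting [S] with basis vectors. *)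
Lemma monomial_split k (S : symform k.+1 V E) (t x : V) : monomial S t x =
  \sum_(j < n) (coord j x - coord j t) *: monomial (contr_at (delta_mx ord0 j) S) t x.
Proof.
rewrite monomialS [X in app _ X]row_sum_delta.
have Al := app_linear (monomial (cur S) t x).
have sumL (I : Type) (s : seq I) (b : I -> R) (v : I -> V) :
    app (monomial (cur S) t x) (\sum_(i <- s) b i *: v i) =
    \sum_(i <- s) b i *: app (monomial (cur S) t x) (v i).
  by elim: s => [|i s IH]; rewrite ?big_nil ?(lin0 Al)// !big_cons Al IH.
rewrite sumL; apply: eq_bigr => j _; rewrite !mxE /monomial curE.
by [].
Qed.

Lemma smul_monomial_split k (g : V -> R^o) (S : symform k.+1 V E) (t : V) :
  is_C p X g ->
  smul g (ofC p oX (monomial S t)) = \sum_(j < n)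
    (smul (fun x => g x * coord j x) (ofC p oX (monomial (contr_at (delta_mx ord0 j) S) t)) -
     coord j t *: smul g (ofC p oX (monomial (contr_at (delta_mx ord0 j) S) t))).
Proof.
move=> gC; apply: Cspace_ext => x Xx; rewrite Cspace_sumE smulE//.
rewrite ofCE//; last exact: is_C_monomial.
rewrite monomial_split scaler_sumr; apply: eq_bigr => j _.
set m := contr_at _ _.
have mE : ofC p oX (monomial m t) x = monomial m t x by rewrite ofCE//; exact: is_C_monomial.
rewrite -[RHS]/(smul (fun x => g x * coord j x) (ofC p oX (monomial m t)) x -
  coord j t *: smul g (ofC p oX (monomial m t)) x).
rewrite !smulE// ?mE; last first.
  by apply: (is_C_scale oX (u := g)) => //; exact: is_C_coord.
by rewrite !scalerA -scalerBl; congr (_ *: _); ring.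
Qed.

Lemma seminorm_const (K : set V) l (e : E) : compact K -> K `<=` X -> inN p l ->
  Cseminorm K l (ofC p oX (cst e)) <= `|e|.
Proof.
move=> cK KX pl; apply: seminorm_le_jet => // x Kx.
rewrite -(jet_norm_cst 1 l e x) le_eqVlt; apply/orP; left; apply/eqP.
apply: eq_bigr => j _; congr (_ * `|_|); apply: (iterDiff_eq (p := p) oX).
- exact: Cspace_is_C.
- by move=> z Xz; rewrite ofCE//; exact: is_C_cst.
- by apply: inN_le pl _; rewrite -ltnS.
- exact: KX.
Qed.

Lemma ofC_cst_linear : linear (fun e : E => ofC p oX (cst e)).
Proof.
move=> a e e'; apply: Cspace_ext => x Xx; rewrite Cspace_lin.
by rewrite !ofCE//; exact: is_C_cst.
Qed.

Lemma monomial0 (S : symform 0 V E) t : monomial S t = cst (S (fun=> 0)).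
Proof. by apply/funext => x; rewrite /monomial /cst; congr (S _); apply/funext => -[]. Qed.

Lemma symform0_eval_bounded : bounded_linear (fun S : symform 0 V E => S (fun=> 0)).
Proof.
split; first by move=> a S S'.
by exists 1 => S; have := symform_le S (fun=> 0); rewrite big_ord0 mulr1 mul1r.
Qed.

End MonomialSplitting.

Section Coefficients.
Context (R : realType) (n : nat) (H E F : normedModType R) (p : option nat) (q : nat).
Local Notation V := 'rV[R]_n.
Context (X : set V) (oX : open X) (Y : set H) (oY : open Y).
Context (T : {linear Cspace p oX E -> Cspace (Some q) oY F}) (h : H -> V).
Variables (K : set V) (l : nat).
Hypotheses (cK : compact K) (KX : K `<=` X) (pl : inN p l).
Hypothesis T_le : forall y, Y y -> exists2 M, 0 <= M &
  forall f, `|T f y| <= M * Cseminorm K l f.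

Lemma const_seminorm_le (g : V -> R^o) : is_C p X g -> exists2 c, 0 <= c &
  forall e : E, Cseminorm K l (smul g (ofC p oX (cst e))) <= c * `|e|.
Proof.
move=> gC; have [_ /(_ K l cK KX pl)[K' [k [c [cK' K'X pk Hc]]]]] := smul_bounded E oX gC.
exists `|c| => // e; apply: (le_trans (Hc _)).
apply: (@le_trans _ _ (`|c| * Cseminorm K' k (ofC p oX (cst e)))).
  by rewrite ler_wpM2r ?seminorm_ge0// ler_norm.
by rewrite ler_wpM2l// seminorm_const.
Qed.

(** The smooth factor [g] absorbs the coordinate functions produced by
    [smul_monomial_split], which lowers the degree [k]. *)
Lemma coef_bounded k (g : V -> R^o) y : is_C p X g -> Y y ->
  exists2 c, 0 <= c & forall S : symform k V E,
    `|T (smul g (ofC p oX (monomial S (h y)))) y| <= c * `|S|.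
Proof.
move=> + Yy; elim: k g => [|k IH] g gC.
  have [M M0 TM] := T_le Yy; have [c c0 gc] := const_seminorm_le gC.
  exists (M * c) => [|S]; first exact: mulr_ge0.
  rewrite monomial0 (le_trans (TM _))// -mulrA ler_wpM2l// (le_trans (gc _))//.
  rewrite ler_wpM2l//.
  by have := symform_le S (fun=> 0); rewrite big_ord0 mulr1.
have gC' j : is_C p X (fun x => g x * coord j x : R^o).
  by apply: (is_C_scale oX (u := g)) => //; exact: is_C_coord.
have [c1 Hc1] := choice (fun j => let: ex_intro2 c c0 Hc := IH _ (gC' j) in
  ex_intro (fun c => 0 <= c /\ forall S : symform k V E, _ <= c * `|S|) c (conj c0 Hc)).
have [c2 c20 Hc2] := IH _ gC.
pose c j := c1 j + `|coord j (h y)| * c2.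
have c0 j : 0 <= c j by rewrite addr_ge0 ?mulr_ge0//; case: (Hc1 j).
exists (\sum_(j < n) c j * `|delta_mx ord0 j : V|) => [|S].
  by apply: sumr_ge0 => j _; rewrite mulr_ge0.
rewrite smul_monomial_split// linear_sum Cspace_sumE mulr_suml.
apply: (le_trans (ler_norm_sum _ _ _)); apply: ler_sum => j _.
set m := contr_at _ _.
have mS : `|m| <= `|delta_mx ord0 j : V| * `|S| by rewrite mulrC; exact: contr_le.
rewrite -mulrA; apply: (@le_trans _ _ (c j * `|m|)); last by rewrite ler_wpM2l.
rewrite linearB linearZ -[X in `|X|]/(T _ y - coord j (h y) *: T _ y).
rewrite (le_trans (ler_normB _ _))// normrZ mulrDl; apply: lerD.
  by have [_] := Hc1 j; apply.
by rewrite -mulrA ler_wpM2l.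
Qed.

Lemma coef_linear k (g : V -> R^o) t y : is_C p X g ->
  linear (fun S : symform k V E => T (smul g (ofC p oX (monomial S t))) y).
Proof.
move=> gC a S S'.
have -> : smul g (ofC p oX (monomial (a *: S + S') t)) =
    a *: smul g (ofC p oX (monomial S t)) + smul g (ofC p oX (monomial S' t)).
  apply: Cspace_ext => x Xx; rewrite Cspace_lin !smulE// !ofCE//; try exact: is_C_monomial.
  by rewrite -[monomial _ _ x]/(a *: monomial S t x + monomial S' t x)
    scalerDr !scalerA mulrC.
by rewrite linearP.
Qed.

Lemma smul1 (f : Cspace p oX E) : smul (fun=> 1) f = f.
Proof.
apply: Cspace_ext => x Xx; rewrite smulE ?scale1r//.
exact: (@is_C_cst R V R^o _ X 1 oX).
Qed.

Lemma jet_coefE k y (S : symform k V E) : jet_coef T h y S =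
  (k`!%:R)^-1 *: T (smul (fun=> 1) (ofC p oX (monomial S (h y)))) y.
Proof. by rewrite smul1. Qed.

Lemma jet_coef_bounded k y : Y y -> bounded_linear (@jet_coef R n H E F p q X oX Y oY T h k y).
Proof.
move=> Yy; have C1 := @is_C_cst R V R^o p X 1 oX.
split.
  move=> a S S'; rewrite !jet_coefE (coef_linear (h y) y C1 a S S').
  by rewrite scalerDr !scalerA mulrC.
have [c c0 Hc] := coef_bounded k C1 Yy.
exists (`|(k`!%:R)^-1| * c) => S; rewrite jet_coefE normrZ -mulrA ler_wpM2l//.
Qed.

Section Good.
Hypothesis T_compact : forall c, exists2 B, compact B &
  forall f, Cseminorm K l f <= c -> B (T f).
Variables (U : set H).
Hypotheses (oU : open U) (UY : U `<=` Y) (hU : is_C (Some q) U h).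
Local Notation CU := (Cspace (Some q) oU F).

(** The functions [Psi ^~ S], for [S] in the unit ball, are restrictions of
    elements of a compact set of [C^q] functions on [U], linearly in [S]. This
    single property implies the smoothness in [y], the compactness and the
    norm continuity of all derivatives. *)
Definition compact_family (Z : normedModType R) (Psi : H -> Z -> F) : Prop :=
  exists2 L : Z -> CU, linear L /\ (forall S y, U y -> L S y = Psi y S) &
    exists2 B, compact B & forall S, `|S| <= 1 -> B (L S).

Lemma compact_family_dilate (Z : normedModType R) (L : Z -> CU) B c : linear L ->
  compact B -> (forall S, `|S| <= 1 -> B (L S)) ->
  exists2 B', compact B' & forall S, `|S| <= c -> B' (L S).
Proof.
move=> Ll cB LB; have [B' cB' BB'] := compact_dilate (`|c| + 1) cB.
exists B' => // S Sc; have c1 : 0 < `|c| + 1 by rewrite ltr_wpDl.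
have -> : L S = (`|c| + 1) *: L ((`|c| + 1)^-1 *: S).
  have LZ a u : L (a *: u) = a *: L u.
    have L0 : L 0 = 0.
      by have := Ll (-1) 0 0; rewrite scaler0 addr0 scaleN1r addNr.
    by have := Ll a u 0; rewrite !addr0 L0 addr0.
  by rewrite LZ scalerA mulfV ?scale1r// gt_eqF.
apply: BB'; apply: LB; rewrite normrZ gtr0_norm ?invr_gt0// ler_pdivrMl// mulr1.
by rewrite (le_trans Sc)// (le_trans (ler_norm _))// lerDl.
Qed.

Lemma compact_family_ext (Z : normedModType R) (Psi Psi' : H -> Z -> F) :
  (forall y S, U y -> Psi y S = Psi' y S) -> compact_family Psi -> compact_family Psi'.
Proof.
move=> PP [L [Ll LP] LB]; exists L => //; split=> // S y Uy.
by rewrite LP// PP.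
Qed.

Lemma compact_family_comp (Z Z' : normedModType R) (Psi : H -> Z -> F) (A : Z' -> Z) :
  bounded_linear A -> compact_family Psi -> compact_family (fun y S => Psi y (A S)).
Proof.
move=> Ab [L [Ll LP] [B cB LB]]; have [c c0 Ac] := bounded_linear_ge0 Ab.
exists (L \o A).
  split; last by move=> S y Uy; exact: LP.
  by move=> a S S'; rewrite /= (Ab.1 a) Ll.
have [B' cB' LB'] := compact_family_dilate c Ll cB LB.
exists B' => // S S1; apply: LB'; rewrite (le_trans (Ac _))// ler_piMr//.
Qed.

Lemma compact_family_image (Z : normedModType R) (Psi Psi' : H -> Z -> F) (A : CU -> CU) :
  bounded_operator A -> (forall (f : CU) y S, U y -> f y = Psi y S -> A f y = Psi' y S) ->
  compact_family Psi -> compact_family Psi'.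
Proof.
move=> Ab AP [L [Ll LP] [B cB LB]]; exists (A \o L).
  split; last by move=> S y Uy; apply: AP => //; exact: LP.
  by move=> a S S'; rewrite /= Ll Ab.1.
exists (A @` B); first exact: compact_image.
by move=> S S1; exists (L S) => //; exact: LB.
Qed.

Lemma compact_familyZ (Z : normedModType R) (Psi : H -> Z -> F) (eta : H -> R^o) :
  is_C (Some q) U eta -> compact_family Psi ->
  compact_family (fun y S => eta y *: Psi y S).
Proof.
move=> eC; apply: (compact_family_image (smul_bounded F oU eC)).
by move=> f y S Uy fy; rewrite smulE// fy.
Qed.

Lemma compact_familyD (Z : normedModType R) (Psi Psi' : H -> Z -> F) :
  compact_family Psi -> compact_family Psi' ->
  compact_family (fun y S => Psi y S + Psi' y S).
Proof.
move=> [L [Ll LP] [B cB LB]] [L' [Ll' LP'] [B' cB' LB']].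
exists (fun S => L S + L' S).
  split; last by move=> S y Uy; rewrite -LP// -LP'.
  by move=> a S S'; rewrite Ll Ll' scalerDr addrACA.
exists [set k | exists f g, [/\ B f, B' g & k = f + g]]; first exact: compact_add.
by move=> S S1; exists (L S), (L' S); split; [exact: LB|exact: LB'|].
Qed.

Lemma compact_family0 (Z : normedModType R) : compact_family (fun _ (_ : Z) => 0).
Proof.
exists (fun=> 0); first by split=> // a S S'; rewrite scaler0 addr0.
by exists [set 0]; first exact: compact_set1.
Qed.

Lemma compact_family_sum (Z : normedModType R) (I : Type) (r : seq I)
    (Psi : I -> H -> Z -> F) : (forall i, compact_family (Psi i)) ->
  compact_family (fun y S => \sum_(i <- r) Psi i y S).
Proof.
move=> PG; elim: r => [|i r IH].
  by apply: compact_family_ext (compact_family0 Z) => y S _; rewrite big_nil.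
apply: compact_family_ext (compact_familyD (PG i) IH) => y S _.
by rewrite big_cons.
Qed.

Lemma compact_family_const (g : V -> R^o) : is_C p X g ->
  compact_family (fun y (e : E) => T (smul g (ofC p oX (cst e))) y).
Proof.
move=> gC; have [c c0 gc] := const_seminorm_le gC.
have [B cB TB] := T_compact c.
exists (fun e => restrictC oU (T (smul g (ofC p oX (cst e))))).
  split; last by move=> e y Uy; rewrite restrictCE.
  move=> a e e'.
  have mb := smul_bounded E oX gC.
  rewrite (ofC_cst_linear p oX a e e') mb.1 linearP.
  by have [rl _] := @restrictC_bounded R H F (Some q) Y U oY oU UY; rewrite rl.
exists ((@restrictC R H F (Some q) Y U oY oU) @` B).
  by apply: compact_image => //; exact: restrictC_bounded.
move=> e e1; exists (T (smul g (ofC p oX (cst e)))) => //; apply: TB.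
by rewrite (le_trans (gc _))// ler_piMr.
Qed.

(** Same induction as for [coef_bounded]; the coordinates of [h y] appear as
    [C^q] factors, which is where the regularity of [h] on [U] enters. *)
Lemma compact_family_monomial k (g : V -> R^o) : is_C p X g ->
  compact_family (fun y (S : symform k V E) => T (smul g (ofC p oX (monomial S (h y)))) y).
Proof.
elim: k g => [|k IH] g gC.
  apply: compact_family_ext (compact_family_comp (@symform0_eval_bounded R n E)
    (compact_family_const gC)) => y S _.
  by rewrite monomial0.
have gC' j : is_C p X (fun x => g x * coord j x : R^o).
  by apply: (is_C_scale oX (u := g)) => //; exact: is_C_coord.
have hC j : is_C (Some q) U (fun y => - coord j (h y) : R^o).
  have := is_CZ (-1) oU (is_C_postcomp oU (@coord_bounded R n j) hU).
  by apply: is_C_eq => // y _; rewrite -[LHS]/(-1 *: _) scaleN1r.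
have S1 j := compact_familyD (IH _ (gC' j)) (compact_familyZ (hC j) (IH _ gC)).
have S2 j := compact_family_comp (@contr_at_bounded R n E k (delta_mx ord0 j)) (S1 j).
apply: compact_family_ext (compact_family_sum (index_enum 'I_n) S2) => y S Uy.
rewrite smul_monomial_split// linear_sum Cspace_sumE; apply: eq_bigr => j _.
by rewrite linearB linearZ scaleNr.
Qed.

Lemma compact_family_jet_coef k :
  compact_family (@jet_coef R n H E F p q X oX Y oY T h k).
Proof.
have C1 := @is_C_cst R V R^o p X 1 oX.
have C2 := @is_C_cst R H R^o (Some q) U (k`!%:R)^-1 oU.
apply: compact_family_ext (compact_familyZ C2 (compact_family_monomial k C1)) => y S _.
by rewrite jet_coefE.
Qed.

Section Consequences.
Variables (Z : normedModType R) (Psi : H -> Z -> F).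
Hypothesis PsiC : compact_family Psi.

Lemma compact_family_is_C S : is_C (Some q) U (Psi ^~ S).
Proof.
have [L [_ LP] _] := PsiC.
by apply: is_C_eq (Cspace_is_C (L S)) => // y Uy; exact: LP.
Qed.

Let iterDiff_L (L : Z -> CU) m y S : (forall S y, U y -> L S y = Psi y S) ->
  (m <= q)%N -> U y -> iterDiff m (Psi ^~ S) y = iterDiff m (L S) y.
Proof.
move=> LP mq Uy; apply: esym.
by apply: (iterDiff_eq (p := Some q) oU (Cspace_is_C _)) => // z Uz; exact: LP.
Qed.

Lemma compact_family_linear m y : (m <= q)%N -> U y ->
  linear (fun S => iterDiff m (Psi ^~ S) y).
Proof.
move=> mq Uy; have [L [Ll LP] _] := PsiC.
by move=> a S S'; rewrite !(iterDiff_L _ LP mq Uy) Ll iterDiff_Cspace_lin.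
Qed.

Lemma compact_family_compact m y : (m <= q)%N -> U y ->
  compact_map (fun S => iterDiff m (Psi ^~ S) y).
Proof.
move=> mq Uy; have [L [Ll LP] [B cB LB]] := PsiC.
exists (ball (0 : Z) 1); split; first exact: ball_open.
  by exists 0; exact: ballxx.
pose D := (fun f : CU => iterDiff m f y) @` B.
have cD : compact D.
  by apply: continuous_compact => //; apply: continuous_subspaceT; exact: eval_continuous.
apply: (@precompact_subset _ _ D); last first.
  by apply: compact_precompact => //; exact: norm_hausdorff.
move=> _ [S S1 <-]; rewrite (iterDiff_L S LP mq Uy); exists (L S) => //; apply: LB.
by move: S1; rewrite -ball_normE /= sub0r normrN => /ltW.
Qed.

(** Otherwise the operator norms stay away from 0 along a sequence tending to
    [y]. The sequence with its limit is a compact set [Q], over which the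
    family has a finite net for the seminorm of order [m]; as the elements of
    the net have continuous derivatives of order [m], this is a
    contradiction. *)
Lemma compact_family_norm_continuous m : (m <= q)%N ->
  norm_continuous_on U (fun y S => iterDiff m (Psi ^~ S) y).
Proof.
move=> mq; have [L [Ll LP] [B cB LB]] := PsiC.
split=> y Uy.
  split; first exact: compact_family_linear.
  have [M HM] := compact_eval_bounded cB (mq : inN (Some q) m) Uy.
  have [B1 cB1 LB1] := compact_family_dilate 1 Ll cB LB.
  have Al := compact_family_linear mq Uy.
  exists M => S; have [->|S0] := eqVneq S 0.
    by rewrite (lin0 Al) !normr0 mulr0.
  have S1 : `|(`|S|^-1 *: S)| <= 1.
    by rewrite normrZ normfV normr_id mulVf// normr_eq0.
  have := HM _ (LB _ S1); rewrite -(iterDiff_L _ LP mq Uy) (linZ _ _ Al).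
  rewrite normrZ normfV normr_id ler_pdivrMl ?normr_gt0// mulrC.
  by [].
apply/cvgrPdist_le => e e0; apply: contrapT => He.
have e3 : 0 < e / 3 by rewrite divr_gt0.
pose bad w := U w /\ ~ (forall S, `|S| <= 1 ->
  `|iterDiff m (Psi ^~ S) w - iterDiff m (Psi ^~ S) y| <= e).
have Hbad k : exists w, `|w - y| < k.+1%:R^-1 /\ bad w.
  apply: contrapT => nb; apply: He; apply/nbhs_ballP; exists k.+1%:R^-1 => /=.
    by rewrite invr_gt0.
  move=> w; rewrite -ball_normE /= distrC => wy Uw.
  have good S : `|S| <= 1 ->
      `|iterDiff m (Psi ^~ S) w - iterDiff m (Psi ^~ S) y| <= e.
    move=> S1; apply: contrapT => nS; apply: nb; exists w; split=> //.
    by split=> // all; apply: nS; exact: all.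
  rewrite sub0r normrN ger0_norm.
    apply: ge_sup; first by eexists; exists 0; rewrite //= normr0.
    by move=> _ [S S1 <-]; exact: good.
  have bnd : has_sup [set `|(fun S => iterDiff m (Psi ^~ S) w) S -
      (fun S => iterDiff m (Psi ^~ S) y) S| | S in [set S : Z | `|S| <= 1]].
    split; first by eexists; exists 0; rewrite //= normr0.
    by exists e => _ [S S1 <-]; exact: good.
  apply: (le_trans (normr_ge0 (iterDiff m (Psi ^~ 0) w - iterDiff m (Psi ^~ 0) y))).
  by apply: (sup_upper_bound bnd); exists 0; rewrite //= normr0.
have [w Hw] := choice Hbad.
have wy Q : nbhs y Q -> exists N, forall k, (N <= k)%N -> Q (w k).
  move=> /nbhs_ballP[r /= r0 rQ].
  have [N Nr] : exists N, N.+1%:R^-1 < r.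
    have [N _ HN] := near_infty_natSinv_lt (PosNum r0).
    by exists N; apply: HN => /=.
  exists N => k Nk; apply: rQ; rewrite -ball_normE /= distrC.
  have [wk _] := Hw k; rewrite (lt_trans wk)//; apply: le_lt_trans Nr.
  by rewrite lef_pV2 ?posrE// ler_nat ltnS.
have cQ := compact_sequence wy.
have QU : [set y] `|` range w `<=` U.
  by move=> _ [->//|[k _ <-]]; have [_ []] := Hw k.
have [s Hs] := compact_totally_bounded cB cQ QU (mq : inN (Some q) m) e3.
have [N HN] : exists N, forall k, (N <= k)%N -> forall g, g \in s ->
    `|iterDiff m (g : CU) (w k) - iterDiff m g y| <= e / 3.
  elim: s {Hs} => [|g s [N HN]]; first by exists 0 => k _ g; rewrite in_nil.
  have gc := is_C_continuous oU (Cspace_is_C g) (mq : inN (Some q) m) Uy.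
  have /cvgrPdist_le/(_ _ e3) := gc => /wy[N' HN'].
  exists (maxn N N') => k; rewrite geq_max => /andP[Nk N'k] g' /[!inE] /predU1P[->|].
    by rewrite distrC; exact: HN'.
  exact: HN.
have [_ [Uw]] := Hw N; apply => S S1.
have [g gs Lg] := Hs _ (LB _ S1).
have D z : ([set y] `|` range w) z -> `|iterDiff m (L S) z - iterDiff m g z| <= e / 3.
  move=> Qz; have Uz := QU _ Qz.
  have -> : iterDiff m (L S) z - iterDiff m g z = iterDiff m (L S - g : CU) z.
    have -> : L S - g = -1 *: g + L S by rewrite scaleN1r addrC.
    by rewrite iterDiff_Cspace_lin// scaleN1r addrC.
  by apply: le_trans (ltW Lg); apply: seminorm_ge.
rewrite !(iterDiff_L _ LP)//.
have h1 : `|iterDiff m (L S) (w N) - iterDiff m g (w N)| <= e / 3.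
  by apply: D; right; exists N.
have h2 : `|iterDiff m (L S) y - iterDiff m g y| <= e / 3 by apply: D; left.
have h3 := HN N (leqnn N) g gs.
have -> : iterDiff m (L S) (w N) - iterDiff m (L S) y =
  (iterDiff m (L S) (w N) - iterDiff m g (w N)) +
  (iterDiff m g (w N) - iterDiff m g y) - (iterDiff m (L S) y - iterDiff m g y).
  by rewrite subrKA opprB addrA subrK.
rewrite (le_trans (ler_normB _ _))// (le_trans (lerD (ler_normD _ _) (lexx _)))//.
rewrite (le_trans (lerD (lerD h1 h3) h2))//; lra.
Qed.

End Consequences.
End Good.
End Coefficients.

Theorem theorem32 (R : realType) (n : nat) (H E F : completeNormedModType R)
  (p : option nat) (q : nat) (q_lt_p : ltinf q p)
  (X : set 'rV[R]_n) (oX : open X) (Y : set H) (oY : open Y)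
  (T : {linear Cspace p oX E -> Cspace (Some q) oY F})
  (T_compact : compact_map T)
  (T_separating : separating T)
  (T_nowhere_trivial : nowhere_trivial T)
  (h : H -> 'rV[R]_n) (h_support : is_support_map T h) :
  exists (l : nat) (Phi : forall k : nat, H -> symform k 'rV[R]_n E -> F),
  [/\ inN p l,
      forall (f : Cspace p oX E) (y : H), Y y ->
        T f y = \sum_(k < l.+1) Phi k y (iterDiff k f (h y)),
      forall (k : nat) (y : H), (k <= l)%N -> Y y -> bounded_linear (Phi k y),
      precompact (set_val @^-1` (h @` Y) : set X) &
      exists U : set H,
      [/\ [/\ open U, U `<=` Y & Y `<=` closure U],
          is_C (Some q) U h,
          forall (k : nat) (S : symform k 'rV[R]_n E), (k <= l)%N ->
            is_C (Some q) U (Phi k ^~ S),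
          forall (k : nat) (y : H) (m : nat), (k <= l)%N -> U y -> (m <= q)%N ->
            let A := fun S => iterDiff m (Phi k ^~ S) y in
            linear A /\ compact_map A &
          forall (k m : nat), (k <= l)%N -> (m <= q)%N ->
            norm_continuous_on U (fun y S => iterDiff m (Phi k ^~ S) y)]].
Proof.
have [K [l [d [A [[cK KX pl d0] [cA TA]]]]]] := compact_operator_ball T_compact.
have T_le := compact_operator_eval cK KX pl d0 cA TA.
have T_cpt := compact_operator_le cK KX pl d0 cA TA.
have oU := regular_set_open q Y h.
have UY := @regular_set_sub R n H q Y h.
have hU := @regular_set_is_C R n H q Y h.
have PhiC k := compact_family_jet_coef cK KX pl T_cpt oU UY hU k.
exists l, (fun k y S => jet_coef T h y S); split=> //.
- by move=> f y Yy; exact: (representation h_support KX pl T_le).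
- by move=> k y _ Yy; exact: (jet_coef_bounded h cK KX pl T_le k Yy).
- exists (set_val @^-1` K).
    move=> x [y Yy hyx]; rewrite /preimage /= -hyx.
    exact: (support_map_in h_support cK T_le T_nowhere_trivial Yy).
  split; first exact: compact_subtype.
  by apply: closed_subtype; apply: (compact_closed (@norm_hausdorff _ _) cK).
exists (regular_set q Y h); split.
- split; [exact: oU|exact: UY|].
  exact: (regular_set_dense T_nowhere_trivial h_support KX pl T_le).
- exact: hU.
- by move=> k S _; exact: (compact_family_is_C (PhiC k)).
- move=> k y m _ Uy mq; split; first exact: (compact_family_linear (PhiC k) mq Uy).
  exact: (compact_family_compact (PhiC k) mq Uy).
- by move=> k m _ mq; exact: (compact_family_norm_continuous (PhiC k) mq).
Qed.
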